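(* Let $B$ be a Blaschke product with infinite zero set $\Lambda=\{\lambda_k\}_{k\ge1}$. Then: (a) There exists a function $H\in\mathrm{Har}_+(\mathbb{D})$ with $\limsup_{k\to\infty}H(\lambda_k)=+\infty$ such that $-\log|B|$ has a harmonic majorant on the set $\{z\in\mathbb{D}:\rho(z,\Lambda)\geq e^{-H(z)}\}$. (b) There exists a function $H\in\mathrm{Har}_+(\mathbb{D})$ with $\limsup_{k\to\infty}H(\lambda_k)=+\infty$ such that if $f\in H^\infty$, $\|f\|_\infty\leq 1$, satisfies $|f(\lambda_k)|\geq e^{-H(\lambda_k)}$ for $k=1,2,\ldots$, then there exist $g,h\in\mathcal{N}$ such that $fg=1+Bh$.
   Context: $\mathbb{D}$ is the open unit disc of $\mathbb{C}$. $\mathrm{Har}_+(\mathbb{D})$ is the cone of positive harmonic functions in $\mathbb{D}$. The Nevanlinna class $\mathcal{N}$ is the algebra of analytic functions $f$ in $\mathbb{D}$ such that $\log|f|$ has a positive harmonic majorant in $\mathbb{D}$. $H^\infty$ is the algebra of bounded analytic functions in $\mathbb{D}$, with $\|f\|_\infty=\sup_{\mathbb{D}}|f|$. The pseudohyperbolic distance is $\rho(a_1,a_2)=\left|\frac{a_1-a_2}{1-\overline{a_2}a_1}\right|$, and $\rho(z,\Lambda)=\inf_{\lambda\in\Lambda}\rho(z,\lambda)$. A function $F$ with values in $[0,+\infty)$ has a harmonic majorant on a set $E\subset\mathbb{D}$ if there exists $H_1\in\mathrm{Har}_+(\mathbb{D})$ such that $F(z)\leq H_1(z)$ for all $z\in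 E$ (only the values of $F$ on $E$ matter). Zeros of $B$ are listed with repetition according to multiplicity. *)

(* Defs.v *)
(* Stdlib reals with Coquelicot.  Functions on the disc are total functions
   on C whose values off the disc are never used. *)
From Stdlib Require Import Reals.
From Coquelicot Require Import Coquelicot.

Open Scope R_scope.

Definition unit_disc (z : C) : Prop := Cmod z < 1.

Definition harmonic (u : C -> R) : Prop :=
  forall x y : R, unit_disc (x, y) ->
    (* [ex_diff_n _ 2 x y] at every point of the disc says that u is C^2 *)
    ex_diff_n (fun s t => u (s, t)) 2 x y /\
    partial_derive 2 0 (fun s t => u (s, t)) x y
      + partial_derive 0 2 (fun s t => u (s, t)) x y = 0.

Definition Har_pos (u : C -> R) : Prop :=
  harmonic u /\ forall z : C, unit_disc z -> 0 < u z.

Definition has_harmonic_majorant (F : C -> R) (E : C -> Prop) : Prop :=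
  exists u : C -> R, Har_pos u /\ forall z : C, E z -> F z <= u z.

Definition analytic (f : C -> C) : Prop :=
  forall z : C, unit_disc z -> ex_derive (K := C_AbsRing) (V := C_NormedModule) f z.

(* At a zero of f, log|f| is -oo and majorizing it is no condition, whereas
   [ln 0] is the real number 0; the zeros are therefore left out. *)
Definition Nevanlinna (f : C -> C) : Prop :=
  analytic f /\
  has_harmonic_majorant (fun z => ln (Cmod (f z)))
    (fun z => unit_disc z /\ f z <> RtoC 0).

Definition sup_norm (f : C -> C) : Rbar :=
  Lub_Rbar (fun r : R => exists z : C, unit_disc z /\ r = Cmod (f z)).

Definition Hinfty (f : C -> C) : Prop :=
  analytic f /\ is_finite (sup_norm f).

Definition rho (a b : C) : R :=
  Cmod ((a - b) / (RtoC 1 - Cconj b * a))%C.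

Definition rho_set (z : C) (L : C -> Prop) : Rbar :=
  Glb_Rbar (fun r : R => exists l : C, L l /\ r = rho z l).

(* The unimodular normalization |a|/a is dropped when a = 0. *)
Definition blaschke_factor (a z : C) : C :=
  if Ceq_dec a (RtoC 0) then z
  else (RtoC (Cmod a) / a * ((a - z) / (RtoC 1 - Cconj a * z)))%C.

Fixpoint blaschke_partial (lam : nat -> C) (n : nat) (z : C) : C :=
  match n with
  | O => RtoC 1
  | S m => (blaschke_partial lam m z * blaschke_factor (lam m) z)%C
  end.

(* B is the Blaschke product whose zeros, repeated according to multiplicity,
   are the terms of the sequence lam.  By the Blaschke condition every value
   of lam is taken finitely often, so the zero set is infinite. *)
Definition infinite_blaschke_product (lam : nat -> C) (B : C -> C) : Prop :=
  (forall k : nat, unit_disc (lam k)) /\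
  ex_series (fun k : nat => 1 - Cmod (lam k)) /\
  (forall z : C, unit_disc z ->
     filterlim (fun n : nat => blaschke_partial lam n z)
       eventually (locally (B z))).

Definition zero_set (lam : nat -> C) (z : C) : Prop :=
  exists k : nat, z = lam k.

(* Main.v *)
Require Import Defs.
From Stdlib Require Import Reals Lra Lia Arith ClassicalEpsilon FunctionalExtensionality.
From Coquelicot Require Import Coquelicot.

Open Scope R_scope.

(* Write eps_k = 1 - |lam_k|.  There is a positive harmonic H with
   limsup H(lam_k) = oo and still sum eps_k exp(H(lam_k)) < oo: a sparse sum of
   multiples of dilated Poisson kernels peaking at well chosen lam_n.  The
   weights p_k(z) = (1 - |lam_k|^2) P(lam_k, z), with P the Poisson kernel, are
   harmonic in z and dominate 1 - rho(z, lam_k)^2, so that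
   sum_k exp(H(lam_k)) p_k is harmonic.

   For (a), each -log rho(z, lam_k) is at most 4 exp(H(lam_k)) p_k(z) on the given
   set: trivially if rho(z, lam_k) >= 1/2, and otherwise because it is at most
   H(z), which Harnack's inequality compares with H(lam_k).

   For (b), no corona theorem is needed.  Put
   a_k(z) = ((1 - |lam_k|^2) / (1 - conj lam_k z))^2 / f(lam_k), which is bounded
   by exp(H(lam_k)) p_k(z).  The product Phi of the factors 1 - f a_k converges;
   it has the form 1 - f g, and since f a_k = 1 at lam_k each factor is divisible
   by the k-th Blaschke factor, so that Phi = B S.  By the Schwarz lemma the
   quotients are at most 7 exp(H(lam_k)), which gives log|S| <= 10 sum_k
   exp(H(lam_k)) p_k.  Take h = - S.

   The complex analysis rests on Goursat's lemma for rectangles, applied in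
   logarithmic coordinates, which yields Cauchy's formula on circles. *)

(** * Complex derivatives *)

(** Since [f] may vanish, [g] cannot be defined as the quotient of 1 - Phi by [f]. It is the
    telescoping sum of the a_k times the partial products Phi_k, because Phi_k - Phi_(k+1) = f a_k
    Phi_k. Using one factor per index also settles multiple zeros: a value taken m times contributes
    m vanishing factors, and no derivative of [f] has to be interpolated. The demands on [H] pull
    apart: it must be unbounded along the zeros while its exponential stays summable against eps_k.
    Jensen's inequality with dyadic weights separates the peaks of [H], and a peak at a late lam_n
    is nearly invisible at each fixed lam_k, so each peak is placed without regard to the others.
    The same [H] serves (a) and (b). All estimates split at rho = 1/2. Close to lam_k the weight p_k
    is at least 3/4, so a constant multiple of exp(H(lam_k)) is absorbed by a multiple of
    exp(H(lam_k)) p_k; far from lam_k, 1/rho is at most 1 + 2 p_k. *)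

Lemma Cmod_minus_sym (x y : C) : Cmod (x - y) = Cmod (y - x).
Proof. rewrite <- Cmod_opp. f_equal. ring. Qed.

Lemma Cmod_triangle_minus (x y : C) : Cmod (x - y) <= Cmod x + Cmod y.
Proof. unfold Cminus. rewrite <- (Cmod_opp y). apply Cmod_triangle. Qed.

Lemma Cmod_triangle_rev (x y : C) : Cmod x - Cmod y <= Cmod (x - y).
Proof.
  pose proof (Cmod_triangle (x - y) y) as T.
  replace (x - y + y)%C with x in T by ring. lra.
Qed.

Lemma Cmod_sub_eq_0 (x y : C) : Cmod (x - y) = 0 -> x = y.
Proof.
  intros E. apply Cmod_eq_0 in E.
  replace x with (x - y + y)%C by ring. rewrite E. ring.
Qed.

Lemma Cmod_sub_gt_0 (x y : C) : x <> y -> 0 < Cmod (x - y).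
Proof.
  intros H. apply Cmod_gt_0. intros E. apply H.
  replace x with (x - y + y)%C by ring. rewrite E. ring.
Qed.

Lemma Cmod_sqr (z : C) : Cmod z ^ 2 = fst z ^ 2 + snd z ^ 2.
Proof. apply Cmod2_alt. Qed.

Lemma im_le_Cmod (z : C) : Rabs (snd z) <= Cmod z.
Proof. eapply Rle_trans; [apply Rmax_r | apply Rmax_Cmod]. Qed.

Lemma Cmod_le_abs (z : C) : Cmod z <= Rabs (fst z) + Rabs (snd z).
Proof.
  pose proof (Cmod_ge_0 z). pose proof (Rabs_pos (fst z)). pose proof (Rabs_pos (snd z)).
  apply Rsqr_incr_0; try lra. rewrite !Rsqr_pow2, Cmod_sqr.
  rewrite <- (pow2_abs (fst z)), <- (pow2_abs (snd z)). nra.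
Qed.

(* [C] with the balls of [Cmod]; those of [C_UniformSpace] are products of intervals. *)
Notation Cu := (AbsRing_UniformSpace C_AbsRing).

Notation ccont f z := (continuous (U := Cu) f z).
Notation ccontC f z := (continuous (T := Cu) (U := Cu) f z).

(** Carathéodory's form of the derivative: the slope [q] is continuous at [z]. The product and chain
    rules become identities between slopes, and [q] itself is the function to which the Cauchy
    theory is later applied. *)
Definition cdiff (f : C -> C) (z l : C) : Prop :=
  exists q : C -> C, ccontC q z /\ q z = l /\
    forall w, f w = (f z + q w * (w - z))%C.

Definition cdiffable (f : C -> C) (z : C) : Prop := exists l, cdiff f z l.

Lemma ccont_eps {U : UniformSpace} (f : U -> C) (x : U) :
  (forall eps, 0 < eps -> locally x (fun y => Cmod (f y - f x) < eps)) <->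
  ccont f x.
Proof.
  split.
  - intros H. apply filterlim_locally. intros eps. exact (H eps (cond_pos eps)).
  - intros H eps He.
    exact (proj1 (filterlim_locally _ _) H (mkposreal eps He)).
Qed.

Lemma ccont_eps_C (f : C -> C) (z : C) :
  (forall eps, 0 < eps -> exists d, 0 < d /\
     forall w, Cmod (w - z) < d -> Cmod (f w - f z) < eps) <->
  ccontC f z.
Proof.
  rewrite <- (ccont_eps (U := Cu)). split; intros H eps He; destruct (H eps He) as [d Hd].
  - destruct Hd as [Hd Hw]. exists (mkposreal d Hd). intros w Hw'. apply Hw, Hw'.
  - exists d. split; [apply cond_pos|]. intros w Hw. apply Hd, Hw.
Qed.

Lemma ccont_plus {U : UniformSpace} (f g : U -> C) (x : U) :
  ccont f x -> ccont g x -> ccont (fun y => (f y + g y)%C) x.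
Proof. intros; apply (continuous_plus (V := AbsRing_NormedModule C_AbsRing)); assumption. Qed.

Lemma ccont_minus {U : UniformSpace} (f g : U -> C) (x : U) :
  ccont f x -> ccont g x -> ccont (fun y => (f y - g y)%C) x.
Proof. intros; apply (continuous_minus (V := AbsRing_NormedModule C_AbsRing)); assumption. Qed.

Lemma ccont_mult {U : UniformSpace} (f g : U -> C) (x : U) :
  ccont f x -> ccont g x -> ccont (fun y => (f y * g y)%C) x.
Proof. intros; apply (continuous_mult (K := C_AbsRing)); assumption. Qed.

Lemma ccont_const {U : UniformSpace} (c : C) (x : U) : ccont (fun _ : U => c) x.
Proof. apply continuous_const. Qed.

Lemma ccont_inv {U : UniformSpace} (f : U -> C) (x : U) :
  f x <> 0 -> ccont f x -> ccont (fun y => (/ f y)%C) x.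
Proof.
  intros H0 Hf.
  apply (continuous_comp (V := Cu) (W := Cu) f Cinv); [exact Hf|].
  apply ccont_eps_C. intros eps He.
  assert (Hm : 0 < Cmod (f x)) by (now apply Cmod_gt_0).
  set (m := Cmod (f x)) in *.
  exists (Rmin (m / 2) (eps * m * m / 2)). split.
  { apply Rmin_pos; [lra|]. assert (0 < eps * m * m) by (repeat apply Rmult_lt_0_compat; lra). lra. }
  intros w Hw.
  assert (H1 : Cmod (w - f x) < m / 2) by (eapply Rlt_le_trans; [apply Hw | apply Rmin_l]).
  assert (H2 : Cmod (w - f x) < eps * m * m / 2) by (eapply Rlt_le_trans; [apply Hw | apply Rmin_r]).
  assert (H3 : m / 2 < Cmod w).
  { pose proof (Cmod_triangle_rev (f x) w). rewrite Cmod_minus_sym in H. fold m in H. lra. }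
  assert (Hw0 : w <> 0) by (apply Cmod_gt_0; lra).
  replace (/ w - / f x)%C with ((f x - w) / (w * f x))%C by (field; split; assumption).
  rewrite Cmod_div by (now apply Cmult_neq_0).
  rewrite Cmod_mult. fold m. rewrite Cmod_minus_sym.
  apply Rlt_div_l; [nra|].
  eapply Rlt_le_trans; [apply H2|].
  assert (eps * m * (m / 2) <= eps * m * Cmod w) by (apply Rmult_le_compat_l; nra).
  nra.
Qed.

Lemma ccont_div {U : UniformSpace} (f g : U -> C) (x : U) :
  g x <> 0 -> ccont f x -> ccont g x -> ccont (fun y => (f y / g y)%C) x.
Proof. intros. apply ccont_mult; [assumption|]. now apply ccont_inv. Qed.

Lemma ccont_ext_loc {U : UniformSpace} (f g : U -> C) (x : U) :
  locally x (fun y => f y = g y) -> ccont f x -> ccont g x.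
Proof. intros H. apply (continuous_ext_loc (U := Cu)). exact H. Qed.

Lemma cdiff_cont (f : C -> C) (z l : C) :
  cdiff f z l -> ccontC f z.
Proof.
  intros [q [Hq [_ E]]].
  apply (continuous_ext (T := Cu) (U := Cu) (fun w => f z + q w * (w - z))%C).
  { intros w. symmetry. apply E. }
  apply (ccont_plus (U := Cu)); [apply (ccont_const (U := Cu))|].
  apply (ccont_mult (U := Cu)); [exact Hq|].
  apply (ccont_minus (U := Cu)); [apply continuous_id | apply (ccont_const (U := Cu))].
Qed.

Lemma cdiff_ext_loc (f g : C -> C) (z l : C) (d : R) :
  0 < d -> (forall w, Cmod (w - z) < d -> f w = g w) -> cdiff f z l -> cdiff g z l.
Proof.
  intros Hd E [q [Hq [El Ef]]].
  assert (Ez : f z = g z).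
  { apply E. unfold Cminus. rewrite Cplus_opp_r, Cmod_0. exact Hd. }
  (* The slope must satisfy its identity on the whole plane although [f] and [g] agree only near
     [z]; farther away the plain difference quotient of [g] does. *)
  exists (fun w => if Rlt_dec (Cmod (w - z)) d then q w else (g w - g z) / (w - z))%C.
  split; [|split].
  - apply (ccont_ext_loc (U := Cu) q); [|exact Hq].
    exists (mkposreal d Hd). intros w Hw. change (Cmod (w - z) < d) in Hw.
    destruct (Rlt_dec (Cmod (w - z)) d); [reflexivity | contradiction].
  - destruct (Rlt_dec (Cmod (z - z)) d) as [_|n]; [exact El|].
    exfalso. apply n. unfold Cminus. rewrite Cplus_opp_r, Cmod_0. exact Hd.
  - intros w. destruct (Rlt_dec (Cmod (w - z)) d) as [h|n].
    + rewrite <- (E w h), <- Ez. apply Ef.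
    + field. intros E0. apply n. rewrite E0, Cmod_0. exact Hd.
Qed.

Lemma cdiff_ext (f g : C -> C) (z l : C) :
  (forall w, f w = g w) -> cdiff f z l -> cdiff g z l.
Proof. intros E. apply (cdiff_ext_loc f g z l 1); [lra|auto]. Qed.

Lemma cdiff_eps (f : C -> C) (z l : C) :
  cdiff f z l <->
  forall eps, 0 < eps -> exists d, 0 < d /\ forall w, Cmod (w - z) < d ->
    Cmod (f w - f z - l * (w - z)) <= eps * Cmod (w - z).
Proof.
  split.
  - intros [q [Hq [El E]]] eps He.
    destruct (proj2 (ccont_eps_C _ _) Hq eps He) as [d [Hd Hw]].
    exists d. split; [exact Hd|]. intros w h. specialize (Hw w h).
    replace (f w - f z - l * (w - z))%C with ((q w - q z) * (w - z))%C.
    + rewrite Cmod_mult. apply Rmult_le_compat_r; [apply Cmod_ge_0 | lra].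
    + rewrite (E w), El. ring.
  - intros H.
    exists (fun w => if Ceq_dec w z then l else (f w - f z) / (w - z))%C.
    split; [|split].
    + apply ccont_eps_C. intros eps He.
      destruct (H (eps / 2) ltac:(lra)) as [d [Hd Hw]].
      exists d. split; [exact Hd|]. intros w h.
      destruct (Ceq_dec z z) as [_|n]; [|now contradiction n].
      destruct (Ceq_dec w z) as [e|n].
      * unfold Cminus. rewrite Cplus_opp_r, Cmod_0. exact He.
      * pose proof (Cmod_sub_gt_0 _ _ n) as P.
        assert (w - z <> 0)%C by (now apply Cmod_gt_0).
        replace ((f w - f z) / (w - z) - l)%C with ((f w - f z - l * (w - z)) / (w - z))%C
          by (now field).
        rewrite Cmod_div by assumption.
        apply Rle_lt_trans with (eps / 2); [|lra].
        apply Rle_div_l; [exact P|]. apply Hw, h.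
    + destruct (Ceq_dec z z) as [_|n]; [reflexivity|now contradiction n].
    + intros w. destruct (Ceq_dec w z) as [e|n].
      * rewrite e. ring.
      * field. apply Cmod_gt_0, Cmod_sub_gt_0, n.
Qed.

Lemma cdiff_is_derive (f : C -> C) (z l : C) :
  cdiff f z l <-> is_derive (K := C_AbsRing) (V := C_NormedModule) f z l.
Proof.
  rewrite cdiff_eps. split.
  - intros H. split; [apply is_linear_scal_l|].
    intros x Hx.
    assert (Ex : x = z).
    { symmetry. apply (is_filter_lim_locally_unique (V := AbsRing_NormedModule C_AbsRing)). exact Hx. }
    subst x. intros eps. destruct (H eps (cond_pos eps)) as [d [Hd Hw]].
    exists (mkposreal d Hd). intros w h. specialize (Hw w h).
    change (Cmod (f w - f z - (w - z) * l) <= eps * Cmod (w - z)).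
    now rewrite (Cmult_comm _ l).
  - intros [_ H] eps He.
    destruct (H z (fun P h => h) (mkposreal eps He)) as [d Hw].
    exists d. split; [apply cond_pos|]. intros w h. specialize (Hw w h).
    change (Cmod (f w - f z - (w - z) * l) <= eps * Cmod (w - z)) in Hw.
    now rewrite (Cmult_comm l).
Qed.

Lemma cdiff_const (c z : C) : cdiff (fun _ => c) z 0.
Proof. exists (fun _ => RtoC 0). split; [apply (ccont_const (U := Cu))|]. split; [reflexivity|]. intros w. ring. Qed.

Lemma cdiff_id (z : C) : cdiff (fun w => w) z 1.
Proof. exists (fun _ => RtoC 1). split; [apply (ccont_const (U := Cu))|]. split; [reflexivity|]. intros w. ring. Qed.

Lemma cdiff_plus (f g : C -> C) (z l m : C) :
  cdiff f z l -> cdiff g z m -> cdiff (fun w => (f w + g w)%C) z (l + m)%C.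
Proof.
  intros [q [Hq [El E]]] [r [Hr [Em F]]].
  exists (fun w => (q w + r w)%C). split; [now apply (ccont_plus (U := Cu))|].
  split; [now rewrite El, Em|]. intros w. rewrite (E w), (F w). ring.
Qed.

Lemma cdiff_mult (f g : C -> C) (z l m : C) :
  cdiff f z l -> cdiff g z m -> cdiff (fun w => (f w * g w)%C) z (l * g z + f z * m)%C.
Proof.
  intros Df Dg. pose proof (cdiff_cont _ _ _ Dg) as Cg.
  destruct Df as [q [Hq [El E]]], Dg as [r [Hr [Em F]]].
  exists (fun w => (q w * g w + f z * r w)%C). split; [|split].
  - apply (ccont_plus (U := Cu)); apply (ccont_mult (U := Cu)); try assumption. apply (ccont_const (U := Cu)).
  - now rewrite El, Em.
  - intros w. rewrite (E w), (F w). ring.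
Qed.

Lemma cdiff_inv (g : C -> C) (z m : C) :
  g z <> 0 -> cdiff g z m -> cdiffable (fun w => (/ g w)%C) z.
Proof.
  intros H0 Dg. pose proof (cdiff_cont _ _ _ Dg) as Cg.
  destruct Dg as [r [Hr [Em F]]].
  assert (Hd : exists d, 0 < d /\ forall w, Cmod (w - z) < d -> g w <> 0).
  { destruct (proj2 (ccont_eps_C _ _) Cg (Cmod (g z))) as [d [Hd Hw]].
    { now apply Cmod_gt_0. }
    exists d. split; [exact Hd|]. intros w h E. specialize (Hw w h).
    rewrite E in Hw. replace (0 - g z)%C with (- g z)%C in Hw by ring.
    rewrite Cmod_opp in Hw. lra. }
  destruct Hd as [d [Hd Hw]].
  exists (- r z / (g z * g z))%C.
  assert (D : cdiff (fun w => / g z + (- r w / (g w * g z)) * (w - z))%C z (- r z / (g z * g z))%C).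
  { exists (fun w => (- r w / (g w * g z)))%C. split; [|split].
    - apply (ccont_div (U := Cu)); [now apply Cmult_neq_0 | |].
      + apply (continuous_ext (T := Cu) (U := Cu) (fun w => 0 - r w)%C); [intros; simpl; ring|].
        apply (ccont_minus (U := Cu)); [apply (ccont_const (U := Cu)) | exact Hr].
      + apply (ccont_mult (U := Cu)); [exact Cg | apply (ccont_const (U := Cu))].
    - reflexivity.
    - intros w. ring. }
  revert D. apply cdiff_ext_loc with (d := d); [exact Hd|].
  intros w h. specialize (Hw w h).
  transitivity (/ g z - (g w - g z) / (g w * g z))%C.
  - rewrite (F w) at 2. field. split; assumption.
  - field. split; assumption.
Qed.

Lemma cdiff_comp (f g : C -> C) (z l m : C) :
  cdiff f (g z) l -> cdiff g z m -> cdiff (fun w => f (g w)) z (l * m)%C.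
Proof.
  intros [q [Hq [El E]]] Dg. pose proof (cdiff_cont _ _ _ Dg) as Cg.
  destruct Dg as [r [Hr [Em F]]].
  exists (fun w => (q (g w) * r w)%C). split; [|split].
  - apply (ccont_mult (U := Cu)); [|exact Hr].
    apply (continuous_comp (U := Cu) (V := Cu) (W := Cu) g q); assumption.
  - now rewrite El, Em.
  - intros w. rewrite (E (g w)), (F w). ring.
Qed.

Lemma cdiffable_const (c z : C) : cdiffable (fun _ => c) z.
Proof. eexists; apply cdiff_const. Qed.

Lemma cdiffable_id (z : C) : cdiffable (fun w => w) z.
Proof. eexists; apply cdiff_id. Qed.

Lemma cdiffable_plus (f g : C -> C) (z : C) :
  cdiffable f z -> cdiffable g z -> cdiffable (fun w => (f w + g w)%C) z.
Proof. intros [l Hl] [m Hm]. eexists. now apply cdiff_plus; [apply Hl | apply Hm]. Qed.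

Lemma cdiffable_mult (f g : C -> C) (z : C) :
  cdiffable f z -> cdiffable g z -> cdiffable (fun w => (f w * g w)%C) z.
Proof. intros [l Hl] [m Hm]. eexists. now apply cdiff_mult; [apply Hl | apply Hm]. Qed.

Lemma cdiffable_ext (f g : C -> C) (z : C) :
  (forall w, f w = g w) -> cdiffable f z -> cdiffable g z.
Proof. intros E [l Hl]. exists l. now apply (cdiff_ext f). Qed.

Lemma cdiffable_minus (f g : C -> C) (z : C) :
  cdiffable f z -> cdiffable g z -> cdiffable (fun w => (f w - g w)%C) z.
Proof.
  intros Hf Hg. apply (cdiffable_ext (fun w => f w + - (1) * g w)%C); [intros; ring|].
  apply cdiffable_plus; [exact Hf|]. apply cdiffable_mult; [apply cdiffable_const | exact Hg].
Qed.

Lemma cdiffable_div (f g : C -> C) (z : C) :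
  g z <> 0 -> cdiffable f z -> cdiffable g z -> cdiffable (fun w => (f w / g w)%C) z.
Proof.
  intros H0 Hf [m Hm]. apply cdiffable_mult; [exact Hf|]. now apply cdiff_inv with m.
Qed.

Lemma cdiffable_comp (f g : C -> C) (z : C) :
  cdiffable f (g z) -> cdiffable g z -> cdiffable (fun w => f (g w)) z.
Proof. intros [l Hl] [m Hm]. eexists. now apply cdiff_comp; [apply Hl | apply Hm]. Qed.

Lemma cdiffable_cont (f : C -> C) (z : C) :
  cdiffable f z -> ccontC f z.
Proof. intros [l Hl]. now apply cdiff_cont with l. Qed.

Lemma analytic_cdiffable (f : C -> C) :
  analytic f <-> forall z, Cmod z < 1 -> cdiffable f z.
Proof.
  split; intros H z Hz; destruct (H z Hz) as [l Hl]; exists l; now apply cdiff_is_derive.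
Qed.

(** * Integrals of complex-valued functions *)

Notation CInt f a b := (RInt (V := C_R_CompleteNormedModule) f a b : C).
Notation rcont f t := (continuous (T := R_UniformSpace) (U := Cu) f t).

(** Integrals see [C] as a real normed module whose neighbourhoods are products of intervals, while
    continuity is proved with the balls of [Cmod]; this passes from the second to the first. *)
Lemma rcont_C_R (f : R -> C) (t : R) :
  rcont f t -> continuous (T := R_UniformSpace) (U := C_R_NormedModule) f t.
Proof. intros H P HP. apply H. now apply locally_C. Qed.

Lemma rcont_pair (u v : R -> R) (t : R) :
  continuous u t -> continuous v t -> rcont (fun s => (u s, v s)) t.
Proof.
  intros Hu Hv. apply ccont_eps. intros eps He.
  pose proof (proj1 (filterlim_locally _ _) Hu (mkposreal (eps / 2) ltac:(lra))) as Lu.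
  pose proof (proj1 (filterlim_locally _ _) Hv (mkposreal (eps / 2) ltac:(lra))) as Lv.
  generalize (filter_and _ _ Lu Lv). apply filter_imp. intros s [h1 h2].
  change (Rabs (u s - u t) < eps / 2) in h1.
  change (Rabs (v s - v t) < eps / 2) in h2.
  eapply Rle_lt_trans; [apply Cmod_le_abs|]. simpl. unfold Rminus in *. lra.
Qed.

Lemma rcont_comp (f : C -> C) (g : R -> C) (t : R) :
  ccontC f (g t) -> rcont g t -> rcont (fun s => f (g s)) t.
Proof. intros Hf Hg. exact (continuous_comp (V := Cu) (W := Cu) g f t Hg Hf). Qed.

Lemma is_CInt (f : R -> C) (a b : R) :
  a <= b -> (forall t, a <= t <= b -> rcont f t) ->
  is_RInt (V := C_R_NormedModule) f a b (CInt f a b).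
Proof.
  intros Hab Hf.
  apply (RInt_correct (V := C_R_CompleteNormedModule)).
  apply (ex_RInt_continuous (V := C_R_CompleteNormedModule)).
  rewrite Rmin_left, Rmax_right by assumption.
  intros t Ht. now apply rcont_C_R, Hf.
Qed.

Lemma is_CInt_re (f : R -> C) (a b : R) :
  a <= b -> (forall t, a <= t <= b -> rcont f t) ->
  is_RInt (fun t => fst (f t)) a b (fst (CInt f a b)).
Proof. intros Hab Hf. exact (is_RInt_fct_extend_fst _ _ _ _ (is_CInt f a b Hab Hf)). Qed.

Lemma is_CInt_im (f : R -> C) (a b : R) :
  a <= b -> (forall t, a <= t <= b -> rcont f t) ->
  is_RInt (fun t => snd (f t)) a b (snd (CInt f a b)).
Proof. intros Hab Hf. exact (is_RInt_fct_extend_snd _ _ _ _ (is_CInt f a b Hab Hf)). Qed.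

Lemma CInt_eq (f : R -> C) (a b : R) (l : C) :
  is_RInt (fun t => fst (f t)) a b (fst l) -> is_RInt (fun t => snd (f t)) a b (snd l) ->
  CInt f a b = l.
Proof.
  intros H1 H2. rewrite (surjective_pairing l).
  apply (is_RInt_unique (V := C_R_CompleteNormedModule)).
  now apply (is_RInt_fct_extend_pair (U := R_NormedModule) (V := R_NormedModule)).
Qed.

Lemma CInt_scal (c : C) (f : R -> C) (a b : R) :
  a <= b -> (forall t, a <= t <= b -> rcont f t) ->
  CInt (fun t => (c * f t)%C) a b = (c * CInt f a b)%C.
Proof.
  intros Hab Hf.
  pose proof (is_CInt_re f a b Hab Hf) as H1.
  pose proof (is_CInt_im f a b Hab Hf) as H2.
  apply CInt_eq; simpl.
  - apply (is_RInt_minus (V := R_NormedModule));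
    apply (is_RInt_scal (V := R_NormedModule)); assumption.
  - apply (is_RInt_plus (V := R_NormedModule));
    apply (is_RInt_scal (V := R_NormedModule)); assumption.
Qed.

Lemma CInt_minus (f g : R -> C) (a b : R) :
  a <= b -> (forall t, a <= t <= b -> rcont f t) -> (forall t, a <= t <= b -> rcont g t) ->
  CInt (fun t => (f t - g t)%C) a b = (CInt f a b - CInt g a b)%C.
Proof.
  intros Hab Hf Hg.
  apply (is_RInt_unique (V := C_R_CompleteNormedModule)).
  apply (is_RInt_minus (V := C_R_NormedModule)); now apply is_CInt.
Qed.

Lemma CInt_conj (f : R -> C) (a b : R) :
  a <= b -> (forall t, a <= t <= b -> rcont f t) ->
  CInt (fun t => Cconj (f t)) a b = Cconj (CInt f a b).
Proof.
  intros Hab Hf.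
  apply CInt_eq; simpl.
  - now apply is_CInt_re.
  - apply (is_RInt_opp (V := R_NormedModule)). now apply is_CInt_im.
Qed.

Lemma CInt_const (c : C) (a b : R) : CInt (fun _ => c) a b = (RtoC (b - a) * c)%C.
Proof.
  apply CInt_eq; simpl.
  - replace ((b - a) * fst c - 0 * snd c) with (scal (b - a) (fst c)).
    + apply (is_RInt_const (V := R_NormedModule)).
    + unfold scal; simpl; unfold mult; simpl; ring.
  - replace ((b - a) * snd c + 0 * fst c) with (scal (b - a) (snd c)).
    + apply (is_RInt_const (V := R_NormedModule)).
    + unfold scal; simpl; unfold mult; simpl; ring.
Qed.

Lemma CInt_ext (f g : R -> C) (a b : R) :
  a <= b -> (forall t, a <= t <= b -> f t = g t) -> CInt f a b = CInt g a b.
Proof.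
  intros Hab E. apply (RInt_ext (V := C_R_CompleteNormedModule)).
  rewrite Rmin_left, Rmax_right by assumption. intros t Ht. apply E. lra.
Qed.

Lemma CInt_bound (f : R -> C) (a b M : R) :
  a <= b -> (forall t, a <= t <= b -> rcont f t) ->
  (forall t, a <= t <= b -> Cmod (f t) <= M) -> Cmod (CInt f a b) <= (b - a) * M.
Proof.
  intros Hab Hf HM. rewrite Cmod_norm.
  apply (norm_RInt_le_const (V := C_R_NormedModule) f); [assumption | | now apply is_CInt].
  intros t Ht. change (norm (f t)) with (@norm R_AbsRing C_R_NormedModule (f t)).
  specialize (HM t Ht). now rewrite Cmod_norm in HM.
Qed.

Lemma CInt_Chasles (f : R -> C) (a b c : R) :
  a <= b -> b <= c -> (forall t, a <= t <= c -> rcont f t) ->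
  CInt f a c = (CInt f a b + CInt f b c)%C.
Proof.
  intros Hab Hbc Hf.
  apply (is_RInt_unique (V := C_R_CompleteNormedModule)).
  apply (is_RInt_Chasles (V := C_R_NormedModule)) with b; apply is_CInt; trivial;
  intros t Ht; apply Hf; lra.
Qed.

(** The only primitive ever needed: Goursat's lemma subtracts the first-order Taylor polynomial, so
    its exact part is affine. *)
Lemma CInt_affine (p q : C) (a b : R) :
  CInt (fun t => (p + q * RtoC t)%C) a b
  = (p * RtoC (b - a) + q * RtoC ((b ^ 2 - a ^ 2) / 2))%C.
Proof.
  assert (L : forall c d : R, is_RInt (fun t => c + d * t) a b
                (c * (b - a) + d * ((b ^ 2 - a ^ 2) / 2))).
  { intros c d.
    replace (c * (b - a) + d * ((b ^ 2 - a ^ 2) / 2))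
      with (minus ((fun t => c * t + d * (t ^ 2 / 2)) b) ((fun t => c * t + d * (t ^ 2 / 2)) a))
      by (unfold minus, plus, opp; simpl; field).
    apply (is_RInt_derive (V := R_CompleteNormedModule) (fun t => c * t + d * (t ^ 2 / 2))).
    - intros x _. auto_derive; [trivial|]. field.
    - intros x _. apply (continuous_plus (V := R_NormedModule)); [apply continuous_const|].
      apply (continuous_mult (K := R_AbsRing)); [apply continuous_const | apply continuous_id]. }
  apply CInt_eq; simpl.
  - eapply is_RInt_ext; [|replace (_ - _ + _) with
      (fst p * (b - a) + fst q * ((b ^ 2 - a ^ 2) / 2)); [apply L|]].
    + intros x _. simpl. ring.
    + simpl. field.
  - eapply is_RInt_ext; [|replace (_ + _ + _) with
      (snd p * (b - a) + snd q * ((b ^ 2 - a ^ 2) / 2)); [apply L|]].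
    + intros x _. simpl. ring.
    + simpl. field.
Qed.

(** * Goursat's lemma for rectangles *)

(** The counterclockwise contour integral of [F] over the rectangle with lower left corner (x, y),
    width [w] and height [h]; on the vertical sides dz = i dt. *)
Definition rect_int (F : C -> C) (x y w h : R) : C :=
  (CInt (fun s => F (s, y)) x (x + w) + Ci * CInt (fun t => F ((x + w)%R, t)) y (y + h)
   - CInt (fun s => F (s, (y + h)%R)) x (x + w) - Ci * CInt (fun t => F (x, t)) y (y + h))%C.

Definition in_rect (x y w h : R) (z : C) : Prop :=
  x <= fst z <= x + w /\ y <= snd z <= y + h.

Section Rect.

Variable F : C -> C.

Lemma rcont_hor (y s : R) : ccontC F (s, y) -> rcont (fun s => F (s, y)) s.
Proof.
  intros H. apply (rcont_comp F (fun s => (s, y))); [exact H|].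
  apply rcont_pair; [apply continuous_id | apply continuous_const].
Qed.

Lemma rcont_ver (x t : R) : ccontC F (x, t) -> rcont (fun t => F (x, t)) t.
Proof.
  intros H. apply (rcont_comp F (fun t => (x, t))); [exact H|].
  apply rcont_pair; [apply continuous_const | apply continuous_id].
Qed.

Lemma rect_int_split_hor (x y w h : R) :
  0 <= w -> 0 <= h -> (forall z, in_rect x y w h z -> ccontC F z) ->
  rect_int F x y w h
  = (rect_int F x y (w / 2) h + rect_int F (x + w / 2) y (w / 2) h)%C.
Proof.
  intros Hw Hh Hc. unfold rect_int.
  replace (x + w / 2 + w / 2) with (x + w) by field.
  rewrite (CInt_Chasles (fun s => F (s, y)) x (x + w / 2) (x + w)); [| lra | lra |].
  2: { intros s Hs. apply rcont_hor, Hc. unfold in_rect; simpl; lra. }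
  rewrite (CInt_Chasles (fun s => F (s, y + h)) x (x + w / 2) (x + w)); [| lra | lra |].
  2: { intros s Hs. apply rcont_hor, Hc. unfold in_rect; simpl; lra. }
  ring.
Qed.

Lemma rect_int_split_ver (x y w h : R) :
  0 <= w -> 0 <= h -> (forall z, in_rect x y w h z -> ccontC F z) ->
  rect_int F x y w h
  = (rect_int F x y w (h / 2) + rect_int F x (y + h / 2) w (h / 2))%C.
Proof.
  intros Hw Hh Hc. unfold rect_int.
  replace (y + h / 2 + h / 2) with (y + h) by field.
  rewrite (CInt_Chasles (fun t => F (x, t)) y (y + h / 2) (y + h)); [| lra | lra |].
  2: { intros s Hs. apply rcont_ver, Hc. unfold in_rect; simpl; lra. }
  rewrite (CInt_Chasles (fun t => F (x + w, t)) y (y + h / 2) (y + h)); [| lra | lra |].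
  2: { intros s Hs. apply rcont_ver, Hc. unfold in_rect; simpl; lra. }
  ring.
Qed.

Lemma Cmod_plus_halve (a b c : C) : c = (a + b)%C -> Cmod c <= 2 * Cmod a \/ Cmod c <= 2 * Cmod b.
Proof.
  intros ->. pose proof (Cmod_triangle a b).
  destruct (Rle_dec (Cmod a) (Cmod b)); [right | left]; lra.
Qed.

(** Two successive bisections, each keeping the half with the larger integral, replace the sum over
    four quarters; each costs a factor 2. *)
Lemma rect_int_quarter (x y w h : R) :
  0 <= w -> 0 <= h -> (forall z, in_rect x y w h z -> ccontC F z) ->
  exists x' y', x <= x' <= x + w / 2 /\ y <= y' <= y + h / 2 /\
    Cmod (rect_int F x y w h) <= 4 * Cmod (rect_int F x' y' (w / 2) (h / 2)).
Proof.
  intros Hw Hh Hc.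
  assert (A : exists x', x <= x' <= x + w / 2 /\
            Cmod (rect_int F x y w h) <= 2 * Cmod (rect_int F x' y (w / 2) h)).
  { destruct (Cmod_plus_halve _ _ _ (rect_int_split_hor x y w h Hw Hh Hc)); eexists; (split; [|eassumption]); lra. }
  destruct A as [x' [Hx' Lx]].
  assert (Hc' : forall z, in_rect x' y (w / 2) h z -> ccontC F z).
  { intros z [h1 h2]. apply Hc. unfold in_rect. lra. }
  exists x'.
  destruct (Cmod_plus_halve _ _ _ (rect_int_split_ver x' y (w / 2) h ltac:(lra) Hh Hc')) as [H|H].
  - exists y. repeat split; lra.
  - exists (y + h / 2). repeat split; lra.
Qed.

Lemma rect_int_affine (a b : C) (x y w h : R) :
  rect_int (fun z => (a + b * z)%C) x y w h = 0.
Proof.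
  unfold rect_int.
  assert (Hh : forall y s t, CInt (fun s => (a + b * (s, y))%C) s t
     = ((a + b * (Ci * y)) * RtoC (t - s) + b * RtoC ((t ^ 2 - s ^ 2) / 2))%C).
  { intros v s t. rewrite <- CInt_affine. f_equal.
    apply functional_extensionality. intros r.
    replace ((r, v) : C) with (RtoC r + Ci * RtoC v)%C; [ring|].
    unfold RtoC, Ci, Cplus, Cmult; simpl. f_equal; ring. }
  assert (Hv : forall x s t, CInt (fun r => (a + b * (x, r))%C) s t
     = ((a + b * x) * RtoC (t - s) + (b * Ci) * RtoC ((t ^ 2 - s ^ 2) / 2))%C).
  { intros v s t. rewrite <- CInt_affine. f_equal.
    apply functional_extensionality. intros r.
    replace ((v, r) : C) with (RtoC v + Ci * RtoC r)%C; [ring|].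
    unfold RtoC, Ci, Cplus, Cmult; simpl. f_equal; ring. }
  rewrite !Hh, !Hv.
  unfold Rdiv. repeat rewrite ?RtoC_mult, ?RtoC_plus, ?RtoC_minus, ?RtoC_pow.
  assert (I2 : (Ci * Ci)%C = Copp 1) by (apply injective_projections; simpl; ring).
  ring [I2].
Qed.

Lemma rect_int_sub_affine (a b : C) (x y w h : R) :
  0 <= w -> 0 <= h -> (forall z, in_rect x y w h z -> ccontC F z) ->
  rect_int (fun z => (F z - (a + b * z))%C) x y w h = rect_int F x y w h.
Proof.
  intros Hw Hh Hc.
  replace (rect_int F x y w h)
    with (rect_int F x y w h - rect_int (fun z => (a + b * z)%C) x y w h)%C
    by (rewrite rect_int_affine; ring).
  assert (La : forall z, ccontC (fun z => (a + b * z)%C) z).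
  { intros z. apply cdiffable_cont, cdiffable_plus; [apply cdiffable_const|].
    apply cdiffable_mult; [apply cdiffable_const | apply cdiffable_id]. }
  assert (K : forall (c : R -> C) u v, u <= v -> (forall t, u <= t <= v -> rcont c t) ->
    (forall t, u <= t <= v -> in_rect x y w h (c t)) ->
    CInt (fun t => (F (c t) - (a + b * c t))%C) u v
    = (CInt (fun t => F (c t)) u v - CInt (fun t => (a + b * c t)%C) u v)%C).
  { intros c u v Huv Hcc Hin. apply CInt_minus; [exact Huv | |]; intros t Ht.
    - apply rcont_comp; [now apply Hc, Hin | now apply Hcc].
    - apply (rcont_comp (fun z => (a + b * z)%C)); [apply La | now apply Hcc]. }
  unfold rect_int.
  rewrite (K (fun s => (s, y))), (K (fun t => (x + w, t))), (K (fun s => (s, y + h))),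
    (K (fun t => (x, t))); try lra;
  try (intros t Ht; apply rcont_pair; (apply continuous_const || apply continuous_id));
  try (intros t Ht; unfold in_rect; simpl; lra).
  ring.
Qed.

Lemma rect_int_bound (G : C -> C) (x y w h M : R) :
  0 <= w -> 0 <= h -> (forall z, in_rect x y w h z -> ccontC G z) ->
  (forall z, in_rect x y w h z -> Cmod (G z) <= M) ->
  Cmod (rect_int G x y w h) <= 2 * (w + h) * M.
Proof.
  intros Hw Hh Hc HM. unfold rect_int.
  assert (K : forall c : R -> C, forall u v, u <= v ->
    (forall t, u <= t <= v -> rcont c t) ->
    (forall t, u <= t <= v -> in_rect x y w h (c t)) ->
    Cmod (CInt (fun t => G (c t)) u v) <= (v - u) * M).
  { intros c u v Huv Hcc Hin. apply CInt_bound; [exact Huv| |].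
    - intros t Ht. apply rcont_comp; [now apply Hc, Hin | now apply Hcc].
    - intros t Ht. now apply HM, Hin. }
  assert (K1 := K (fun s => (s, y)) x (x + w)).
  assert (K2 := K (fun t => (x + w, t)) y (y + h)).
  assert (K3 := K (fun s => (s, y + h)) x (x + w)).
  assert (K4 := K (fun t => (x, t)) y (y + h)).
  eapply Rle_trans; [apply Cmod_triangle_minus|].
  eapply Rle_trans; [apply Rplus_le_compat_r, Cmod_triangle_minus|].
  eapply Rle_trans; [apply Rplus_le_compat_r, Rplus_le_compat_r, Cmod_triangle|].
  rewrite !Cmod_mult, !Cmod_Ci, !Rmult_1_l.
  replace (2 * (w + h) * M)
    with ((x + w - x) * M + (y + h - y) * M + (x + w - x) * M + (y + h - y) * M) by ring.
  repeat apply Rplus_le_compat; [apply K1 | apply K2 | apply K3 | apply K4]; try lra;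
  try (intros t Ht; apply rcont_pair; (apply continuous_const || apply continuous_id));
  intros t Ht; unfold in_rect; simpl; lra.
Qed.

End Rect.

Lemma nested_intervals (u v : nat -> R) :
  (forall n, u n <= u (S n) /\ u (S n) <= v (S n) /\ v (S n) <= v n) ->
  exists p, forall n, u n <= p <= v n.
Proof.
  intros H.
  assert (Hu : forall n k, u n <= u (n + k)%nat).
  { induction k as [|k IH]; [rewrite Nat.add_0_r; lra|]. rewrite Nat.add_succ_r. specialize (H (n + k)%nat). lra. }
  assert (Hv : forall n k, v (n + k)%nat <= v n).
  { induction k as [|k IH]; [rewrite Nat.add_0_r; lra|]. rewrite Nat.add_succ_r. specialize (H (n + k)%nat). lra. }
  assert (Huv : forall n m, u n <= v m).
  { intros n m. apply Rle_trans with (u (n + S m)%nat); [apply Hu|].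
    apply Rle_trans with (v (n + S m)%nat).
    - rewrite Nat.add_succ_r. apply H.
    - replace (n + S m)%nat with (m + S n)%nat by lia. apply Hv. }
  destruct (completeness (fun r => exists n, r = u n)) as [p [Hp1 Hp2]].
  - exists (v 0%nat). intros r [n ->]. apply Huv.
  - exists (u 0%nat). now exists 0%nat.
  - exists p. intros n. split.
    + apply Hp1. now exists n.
    + apply Hp2. intros r [m ->]. apply Huv.
Qed.

Theorem goursat (F : C -> C) (x y w h : R) :
  0 <= w -> 0 <= h -> (forall z, in_rect x y w h z -> cdiffable F z) ->
  rect_int F x y w h = 0.
Proof.
  intros Hw Hh HF.
  (* [inv n p]: the rectangle with lower left corner [p] and sides scaled by 2^-n lies in the
     original one; [J n p] is the modulus of its contour integral. *)
  set (inv := fun n (p : C) => x <= fst p <= x + w - w / 2 ^ n /\ y <= snd p <= y + h - h / 2 ^ n).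
  set (J := fun n (p : C) => Cmod (rect_int F (fst p) (snd p) (w / 2 ^ n) (h / 2 ^ n))).
  assert (pw : forall n, 0 < 2 ^ n) by (intros; apply pow_lt; lra).
  assert (hw : forall n, 0 <= w / 2 ^ n) by (intros; apply Rdiv_le_0_compat; trivial).
  assert (hh : forall n, 0 <= h / 2 ^ n) by (intros; apply Rdiv_le_0_compat; trivial).
  assert (Sw : forall v n, v / 2 ^ S n = v / 2 ^ n / 2).
  { intros v n. simpl. field. apply Rgt_not_eq, pw. }
  assert (Hsub : forall n p z, inv n p -> in_rect (fst p) (snd p) (w / 2 ^ n) (h / 2 ^ n) z ->
            in_rect x y w h z).
  { intros n p z [i1 i2] [z1 z2]. unfold in_rect. lra. }
  (* The premise [inv n p] stands under the existential so that choice yields a total function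
     [step], which can be iterated. *)
  assert (Hstep : forall n p, exists p', inv n p ->
     inv (S n) p' /\ fst p <= fst p' <= fst p + w / 2 ^ S n /\ snd p <= snd p' <= snd p + h / 2 ^ S n
       /\ J n p <= 4 * J (S n) p').
  { intros n p. destruct (excluded_middle_informative (inv n p)) as [i|ni];
      [|exists p; intros i; contradiction].
    destruct (rect_int_quarter F (fst p) (snd p) (w / 2 ^ n) (h / 2 ^ n) (hw n) (hh n))
      as [x' [y' [Hx [Hy HJ]]]].
    { intros z Hz. apply cdiffable_cont, HF. now apply (Hsub n p). }
    exists (x', y'). intros _. unfold inv, J in *. rewrite !Sw. simpl in *.
    repeat split; try lra. }
  set (step := fun n p => proj1_sig (constructive_indefinite_description _ (Hstep n p))).
  assert (Hs : forall n p, inv n p ->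
     inv (S n) (step n p) /\ fst p <= fst (step n p) <= fst p + w / 2 ^ S n
       /\ snd p <= snd (step n p) <= snd p + h / 2 ^ S n /\ J n p <= 4 * J (S n) (step n p)).
  { intros n p. exact (proj2_sig (constructive_indefinite_description _ (Hstep n p))). }
  clearbody step. clear Hstep.
  set (P := nat_rect (fun _ => C) (x, y) step).
  assert (HP : forall n, inv n (P n)).
  { induction n as [|n IH].
    - unfold inv; simpl. unfold Rdiv. rewrite Rinv_1. lra.
    - apply (Hs n (P n) IH). }
  assert (HJ : forall n, J 0%nat (P 0%nat) <= 4 ^ n * J n (P n)).
  { induction n as [|n IH]; [simpl; lra|].
    eapply Rle_trans; [apply IH|].
    destruct (Hs n (P n) (HP n)) as (_ & _ & _ & H4).
    change (P (S n)) with (step n (P n)). simpl pow.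
    assert (0 < 4 ^ n) by (apply pow_lt; lra). nra. }
  destruct (nested_intervals (fun n => fst (P n)) (fun n => fst (P n) + w / 2 ^ n)) as [px Hpx].
  { intros n. destruct (Hs n (P n) (HP n)) as (_ & H1 & _).
    change (P (S n)) with (step n (P n)). rewrite Sw in *. specialize (hw n). lra. }
  destruct (nested_intervals (fun n => snd (P n)) (fun n => snd (P n) + h / 2 ^ n)) as [py Hpy].
  { intros n. destruct (Hs n (P n) (HP n)) as (_ & _ & H1 & _).
    change (P (S n)) with (step n (P n)). rewrite Sw in *. specialize (hh n). lra. }
  destruct (HF (px, py)) as [l Hl].
  { apply (Hsub 0%nat (P 0%nat) (px, py)); [apply HP|]. split; [apply Hpx | apply Hpy]. }
  pose proof (proj1 (cdiff_eps F (px, py) l) Hl) as Hl'.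
  apply Cmod_eq_0. apply Rle_antisym; [|apply Cmod_ge_0].
  apply Rnot_lt_le. intros Hpos.
  (* Perimeter times a bound for the diameter. At stage n each of the two shrinks by 2^n, which
     makes up exactly for the factor 4^n lost by quartering. *)
  set (A := 2 * (w + h) * (w + h)).
  assert (HA : 0 <= A) by (unfold A; nra).
  destruct (Hl' (Cmod (rect_int F x y w h) / (2 * (A + 1)))) as [d [Hd Hw']].
  { apply Rdiv_lt_0_compat; lra. }
  set (e := Cmod (rect_int F x y w h) / (2 * (A + 1))) in *.
  assert (He : e * A < Cmod (rect_int F x y w h)).
  { unfold e. replace (_ / _ * A) with (Cmod (rect_int F x y w h) * (A / (2 * (A + 1)))) by (field; lra).
    assert (A / (2 * (A + 1)) < 1) by (apply Rlt_div_l; lra). nra. }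
  assert (He0 : 0 < e) by (unfold e; apply Rdiv_lt_0_compat; lra).
  assert (HN : exists n, (w + h) / 2 ^ n < d).
  { destruct (pow_lt_1_zero (1 / 2) ltac:(rewrite Rabs_pos_eq; lra) (d / (w + h + 1))) as [n Hn].
    { apply Rdiv_lt_0_compat; lra. }
    exists n. specialize (Hn n (le_n n)). rewrite Rabs_pos_eq in Hn by (apply pow_le; lra).
    apply Rlt_div_r in Hn; [|lra].
    replace ((w + h) / 2 ^ n) with ((1 / 2) ^ n * (w + h)).
    - assert (0 < (1 / 2) ^ n) by (apply pow_lt; lra). nra.
    - unfold Rdiv at 1. rewrite Rmult_1_l, pow_inv. field. apply Rgt_not_eq, pw. }
  destruct HN as [n Hn].
  assert (B : J n (P n) <= e * A / 4 ^ n).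
  { unfold J.
    rewrite <- (rect_int_sub_affine F (F (px, py) - l * (px, py)) l); trivial.
    2: { intros z Hz. apply cdiffable_cont, HF. now apply (Hsub n (P n)). }
    eapply Rle_trans; [apply rect_int_bound with (M := e * ((w + h) / 2 ^ n)); trivial|].
    - intros z Hz. apply (ccont_minus (U := Cu)).
      + apply cdiffable_cont, HF. now apply (Hsub n (P n)).
      + apply cdiffable_cont, cdiffable_plus; [apply cdiffable_const|].
        apply cdiffable_mult; [apply cdiffable_const | apply cdiffable_id].
    - intros z Hz.
      replace (F z - (F (px, py) - l * (px, py) + l * z))%C
        with (F z - F (px, py) - l * (z - (px, py)))%C by ring.
      assert (Dz : Cmod (z - (px, py)) <= (w + h) / 2 ^ n).
      { eapply Rle_trans; [apply Cmod_le_abs|]. destruct Hz as [z1 z2].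
        specialize (Hpx n). specialize (Hpy n). simpl in *.
        replace ((w + h) / 2 ^ n) with (w / 2 ^ n + h / 2 ^ n) by (field; apply Rgt_not_eq, pw).
        apply Rplus_le_compat; apply Rabs_le; lra. }
      eapply Rle_trans; [apply Hw'; lra|].
      apply Rmult_le_compat_l; lra.
    - apply Req_le. unfold A. replace (4 ^ n) with (2 ^ n * 2 ^ n).
      + field. apply Rgt_not_eq, pw.
      + rewrite <- Rpow_mult_distr. reflexivity. }
  specialize (HJ n).
  replace (J 0%nat (P 0%nat)) with (Cmod (rect_int F x y w h)) in HJ.
  2: { unfold J. simpl. now rewrite !Rdiv_1_r. }
  assert (0 < 4 ^ n) by (apply pow_lt; lra).
  apply Rmult_le_compat_l with (r := 4 ^ n) in B; [|lra].
  replace (4 ^ n * (e * A / 4 ^ n)) with (e * A) in B by (field; lra). lra.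
Qed.

(** * Integrals over circles *)

Definition circ (r t : R) : C := (r * cos t, r * sin t).

Definition cexp (z : C) : C := circ (exp (fst z)) (snd z).

Lemma Cmod_circ (r t : R) : Cmod (circ r t) = Rabs r.
Proof.
  unfold Cmod, circ; simpl.
  replace (r * cos t * (r * cos t * 1) + r * sin t * (r * sin t * 1)) with (Rsqr r).
  - apply sqrt_Rsqr_abs.
  - pose proof (sin2_cos2 t) as E. unfold Rsqr in *.
    replace (r * r) with (r * r * (sin t * sin t + cos t * cos t)) by (rewrite E; ring). ring.
Qed.

Lemma cexp_plus (z w : C) : cexp (z + w) = (cexp z * cexp w)%C.
Proof.
  unfold cexp, circ, Cmult; simpl. rewrite exp_plus, cos_plus, sin_plus.
  apply injective_projections; simpl; ring.
Qed.

Lemma derivable_pt_lim_0_eps (f : R -> R) (l : R) :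
  derivable_pt_lim f 0 l -> forall eps, 0 < eps ->
  exists d, 0 < d /\ forall h, Rabs h < d -> Rabs (f h - f 0 - l * h) <= eps * Rabs h.
Proof.
  intros H eps He. destruct (H eps He) as [d Hd]. exists d. split; [apply cond_pos|].
  intros h Hh. destruct (Req_dec h 0) as [->|h0].
  - replace (f 0 - f 0 - l * 0) with 0 by ring. rewrite Rabs_R0. lra.
  - specialize (Hd h h0 Hh). rewrite Rplus_0_l in Hd.
    replace (f h - f 0 - l * h) with (((f h - f 0) / h - l) * h) by (field; exact h0).
    rewrite Rabs_mult. apply Rmult_le_compat_r; [apply Rabs_pos | lra].
Qed.

(** Estimates are needed at the origin only; the functional equation [cexp_plus] carries the
    derivative to every other point. *)
Lemma cdiff_cexp_0 : cdiff cexp 0 1.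
Proof.
  apply cdiff_eps. intros eps He.
  (* The four error terms below are at most 3, 1, 3 and 1 times [e * m], hence the 8; [e <= 1] keeps
     [exp a] below 3. *)
  set (e := Rmin 1 (eps / 8)).
  assert (e0 : 0 < e) by (apply Rmin_pos; lra).
  assert (e1 : e <= 1) by apply Rmin_l.
  assert (e8 : e <= eps / 8) by apply Rmin_r.
  destruct (derivable_pt_lim_0_eps exp 1) with (eps := e) as [d1 [D1 H1]]; [|exact e0|].
  { replace 1 with (exp 0) by apply exp_0. apply derivable_pt_lim_exp. }
  destruct (derivable_pt_lim_0_eps cos 0) with (eps := e) as [d2 [D2 H2]]; [|exact e0|].
  { pose proof (derivable_pt_lim_cos 0) as D. now rewrite sin_0, Ropp_0 in D. }
  destruct (derivable_pt_lim_0_eps sin 1) with (eps := e) as [d3 [D3 H3]]; [|exact e0|].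
  { rewrite <- cos_0. apply derivable_pt_lim_sin. }
  exists (Rmin (Rmin d1 (e / 2)) (Rmin d2 d3)). split; [repeat apply Rmin_pos; lra|].
  intros w Hw.
  replace (w - 0)%C with w in * by ring.
  pose proof (Rmin_l (Rmin d1 (e / 2)) (Rmin d2 d3)). pose proof (Rmin_r (Rmin d1 (e / 2)) (Rmin d2 d3)).
  pose proof (Rmin_l d1 (e / 2)). pose proof (Rmin_r d1 (e / 2)).
  pose proof (Rmin_l d2 d3). pose proof (Rmin_r d2 d3).
  pose proof (re_le_Cmod w) as Ra. pose proof (im_le_Cmod w) as Rb.
  destruct w as [a b]. simpl in Ra, Rb. set (m := Cmod (a, b)) in *.
  specialize (H1 a ltac:(lra)). specialize (H2 b ltac:(lra)). specialize (H3 b ltac:(lra)).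
  rewrite exp_0 in H1. rewrite cos_0 in H2. rewrite sin_0 in H3.
  eapply Rle_trans; [apply Cmod_le_abs|].
  unfold cexp, circ. simpl. rewrite exp_0, cos_0, sin_0.
  replace (exp a * cos b + - (1 * 1) + - (1 * a - 0 * b))
    with (exp a * (cos b - 1 - 0 * b) + (exp a - 1 - 1 * a)) by ring.
  replace (exp a * sin b + - (1 * 0) + - (1 * b + 0 * a))
    with (exp a * (sin b - 0 - 1 * b) + b * ((exp a - 1 - 1 * a) + a)) by ring.
  pose proof (Rabs_pos a). pose proof (Rabs_pos b).
  assert (Xa : Rabs (exp a) <= 3).
  { rewrite Rabs_pos_eq by (left; apply exp_pos).
    pose proof (Rle_abs (exp a - 1 - 1 * a)). pose proof (Rle_abs a). nra. }
  assert (Y : Rabs ((exp a - 1 - 1 * a) + a) <= e).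
  { eapply Rle_trans; [apply Rabs_triang|]. nra. }
  eapply Rle_trans; [apply Rplus_le_compat; apply Rabs_triang|].
  rewrite !Rabs_mult. 
  set (x1 := Rabs (exp a)) in *. set (x2 := Rabs (cos b - 1 - 0 * b)) in *.
  set (x3 := Rabs (sin b - 0 - 1 * b)) in *. set (x4 := Rabs (exp a - 1 - 1 * a + a)) in *.
  set (x5 := Rabs (exp a - 1 - 1 * a)) in *.
  assert (0 <= x1) by apply Rabs_pos. assert (0 <= x2) by apply Rabs_pos.
  assert (0 <= x3) by apply Rabs_pos. assert (0 <= x4) by apply Rabs_pos.
  assert (x1 * x2 <= 3 * (e * m)) by (apply Rmult_le_compat; nra).
  assert (x1 * x3 <= 3 * (e * m)) by (apply Rmult_le_compat; nra).
  assert (Rabs b * x4 <= m * e) by (apply Rmult_le_compat; lra).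
  assert (x5 <= e * m) by nra.
  assert (0 <= m) by lra.
  assert (e * m <= eps / 8 * m) by (apply Rmult_le_compat_r; lra). lra.
Qed.

Lemma cdiffable_cexp (z : C) : cdiffable cexp z.
Proof.
  apply (cdiffable_ext (fun w => cexp z * cexp (w - z))%C).
  { intros w. rewrite <- cexp_plus. f_equal. ring. }
  apply cdiffable_mult; [apply cdiffable_const|].
  apply (cdiffable_comp cexp (fun w => (w - z)%C)).
  - replace (z - z)%C with (RtoC 0) by ring. exists (RtoC 1). apply cdiff_cexp_0.
  - apply cdiffable_minus; [apply cdiffable_id | apply cdiffable_const].
Qed.

Lemma Cmod_cexp (z : C) : Cmod (cexp z) = exp (fst z).
Proof. unfold cexp. rewrite Cmod_circ. apply Rabs_pos_eq. left; apply exp_pos. Qed.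

Lemma rcont_circ (r t : R) : rcont (circ r) t.
Proof.
  apply rcont_pair; apply (continuous_mult (K := R_AbsRing)); try apply continuous_const.
  - apply continuity_pt_filterlim, continuity_cos.
  - apply continuity_pt_filterlim, continuity_sin.
Qed.

(* [2 * PI] times the mean of [g] over the circle of radius [r]. *)
Definition circle_int (g : C -> C) (r : R) : C := CInt (fun t => g (circ r t)) 0 (2 * PI).

Lemma two_PI_pos : 0 < 2 * PI.
Proof. pose proof PI_RGT_0. lra. Qed.

(** Under w = exp z the form dw/w becomes dz and the annulus becomes a rectangle of height 2 pi. Its
    horizontal sides cancel by periodicity, and its vertical sides are the two circle integrals up
    to the factor i. *)
Lemma circle_int_annulus (g : C -> C) (r1 r2 r r' : R) :
  0 <= r1 -> r1 < r -> r <= r' -> r' < r2 ->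
  (forall w, r1 < Cmod w < r2 -> cdiffable g w) ->
  circle_int g r = circle_int g r'.
Proof.
  intros h1 h2 h3 h4 Hg.
  pose proof two_PI_pos as HPI.
  set (F := fun z => g (cexp z)).
  assert (Hln : ln r <= ln r') by (apply ln_le; lra).
  assert (G : rect_int F (ln r) 0 (ln r' - ln r) (2 * PI) = 0).
  { apply goursat; [lra | lra |].
    intros z [[z1 z2] _]. unfold F.
    apply (cdiffable_comp g cexp); [|apply cdiffable_cexp].
    apply Hg. rewrite Cmod_cexp.
    assert (r <= exp (fst z)).
    { rewrite <- (exp_ln r) by lra. destruct z1 as [z1|z1]; [left; now apply exp_increasing|].
      right; now rewrite z1. }
    assert (exp (fst z) <= r').
    { rewrite <- (exp_ln r') by lra. replace (ln r + (ln r' - ln r)) with (ln r') in z2 by ring.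
      destruct z2 as [z2|z2]; [left; now apply exp_increasing|]. right; now rewrite z2. }
    lra. }
  unfold rect_int in G.
  replace (ln r + (ln r' - ln r)) with (ln r') in G by ring.
  replace (0 + 2 * PI) with (2 * PI) in G by ring.
  assert (E : (fun s => F (s, 2 * PI)) = (fun s => F (s, 0))).
  { apply functional_extensionality. intros s. unfold F, cexp, circ. simpl.
    now rewrite cos_2PI, sin_2PI, cos_0, sin_0. }
  rewrite E in G.
  assert (E1 : circle_int g r = CInt (fun t => F (ln r, t)) 0 (2 * PI)).
  { unfold circle_int, F, cexp. simpl. now rewrite exp_ln by lra. }
  assert (E2 : circle_int g r' = CInt (fun t => F (ln r', t)) 0 (2 * PI)).
  { unfold circle_int, F, cexp. simpl. now rewrite exp_ln by lra. }
  rewrite E1, E2.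
  set (X := CInt (fun t => F (ln r, t)) 0 (2 * PI)) in *.
  set (Y := CInt (fun t => F (ln r', t)) 0 (2 * PI)) in *.
  set (Z := CInt (fun s => F (s, 0)) (ln r) (ln r')) in *.
  assert (I2 : (Ci * Ci)%C = Copp 1) by (apply injective_projections; simpl; ring).
  transitivity (X + (- Ci) * (Z + Ci * Y - Z - Ci * X))%C; [rewrite G; ring | ring [I2]].
Qed.

Lemma circ_continuous_2d (r t eps : R) :
  0 < eps -> exists d : posreal, forall u v, Rabs (u - r) < d -> Rabs (v - t) < d ->
    Cmod (circ u v - circ r t) < eps.
Proof.
  intros He.
  assert (Hc : continuity_2d_pt (fun u v => u * cos v) r t).
  { apply continuity_2d_pt_mult; [apply continuity_2d_pt_id1|].
    apply continuity_1d_2d_pt_comp; [apply continuity_cos | apply continuity_2d_pt_id2]. }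
  assert (Hs : continuity_2d_pt (fun u v => u * sin v) r t).
  { apply continuity_2d_pt_mult; [apply continuity_2d_pt_id1|].
    apply continuity_1d_2d_pt_comp; [apply continuity_sin | apply continuity_2d_pt_id2]. }
  destruct (Hc (mkposreal (eps / 2) ltac:(lra))) as [d1 H1].
  destruct (Hs (mkposreal (eps / 2) ltac:(lra))) as [d2 H2].
  exists (mkposreal (Rmin d1 d2) (Rmin_pos _ _ (cond_pos d1) (cond_pos d2))).
  intros u v Hu Hv. simpl in *.
  pose proof (Rmin_l d1 d2). pose proof (Rmin_r d1 d2).
  specialize (H1 u v ltac:(lra) ltac:(lra)). specialize (H2 u v ltac:(lra) ltac:(lra)).
  eapply Rle_lt_trans; [apply Cmod_le_abs|]. simpl. unfold Rminus in *. lra.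
Qed.

Lemma circle_int_continuous (g : C -> C) (r : R) :
  (exists r2, Rabs r < r2 /\ forall w, Cmod w < r2 -> ccontC g w) ->
  rcont (circle_int g) r.
Proof.
  intros [r2 [Hr Hg]].
  pose proof two_PI_pos as HPI.
  assert (Hgt : forall s t, Rabs s < r2 -> rcont (fun t => g (circ s t)) t).
  { intros s t Hs. apply (rcont_comp g (circ s)); [|apply rcont_circ].
    apply Hg. now rewrite Cmod_circ. }
  assert (H2 : forall eps, 0 < eps -> forall t, exists d : posreal, forall u v,
     Rabs (u - r) < d -> Rabs (v - t) < d -> Cmod (g (circ u v) - g (circ r t)) < eps).
  { intros eps He t.
    destruct (proj2 (ccont_eps_C _ _) (Hg (circ r t) ltac:(now rewrite Cmod_circ)) eps He) as [d [Hd Hw]].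
    destruct (circ_continuous_2d r t d Hd) as [d' Hd'].
    exists d'. intros u v hu hv. now apply Hw, Hd'. }
  apply ccont_eps. intros eps He.
  (* Real and imaginary parts will each vary by less than [e], so the integral moves by at most 2 pi
     * 2 e = 2/3 eps. *)
  set (e := eps / (3 * (2 * PI))).
  assert (e0 : 0 < e) by (apply Rdiv_lt_0_compat; lra).
  destruct (uniform_continuity_2d_1d' (fun u v => fst (g (circ u v))) 0 (2 * PI) r) with (eps := mkposreal e e0)
    as [d1 D1].
  { intros t _ eps'. destruct (H2 eps' (cond_pos eps') t) as [d Hd]. exists d. intros u v hu hv.
    eapply Rle_lt_trans; [|apply (Hd u v hu hv)]. apply (re_le_Cmod (g (circ u v) - g (circ r t))). }
  destruct (uniform_continuity_2d_1d' (fun u v => snd (g (circ u v))) 0 (2 * PI) r) with (eps := mkposreal e e0)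
    as [d2 D2].
  { intros t _ eps'. destruct (H2 eps' (cond_pos eps') t) as [d Hd]. exists d. intros u v hu hv.
    eapply Rle_lt_trans; [|apply (Hd u v hu hv)]. apply (im_le_Cmod (g (circ u v) - g (circ r t))). }
  assert (d0 : 0 < Rmin (r2 - Rabs r) (Rmin d1 d2)).
  { repeat apply Rmin_pos; [lra | apply cond_pos | apply cond_pos]. }
  exists (mkposreal _ d0). intros s Hs. change (Rabs (s - r) < Rmin (r2 - Rabs r) (Rmin d1 d2)) in Hs.
  pose proof (Rmin_l (r2 - Rabs r) (Rmin d1 d2)). pose proof (Rmin_r (r2 - Rabs r) (Rmin d1 d2)).
  pose proof (Rmin_l d1 d2). pose proof (Rmin_r d1 d2).
  assert (Rabs s < r2).
  { pose proof (Rabs_triang_inv s r). lra. }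
  unfold circle_int. rewrite <- CInt_minus; [| lra | |]; [| intros; now apply Hgt ..].
  apply Rle_lt_trans with ((2 * PI - 0) * (2 * e)).
  - apply CInt_bound; [lra | |].
    + intros t _. apply (ccont_minus (U := R_UniformSpace)); now apply Hgt.
    + intros t Ht. apply Rabs_def2 in Hs.
      specialize (D1 t r t s Ht ltac:(pose proof (cond_pos d1); lra) Ht ltac:(lra)
        ltac:(rewrite Rminus_diag, Rabs_R0; apply cond_pos)).
      specialize (D2 t r t s Ht ltac:(pose proof (cond_pos d2); lra) Ht ltac:(lra)
        ltac:(rewrite Rminus_diag, Rabs_R0; apply cond_pos)).
      eapply Rle_trans; [apply Cmod_le_abs|]. simpl in *. unfold Rminus in *. lra.
  - unfold e. replace ((2 * PI - 0) * (2 * (eps / (3 * (2 * PI))))) with (2 / 3 * eps) by (field; lra). lra.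
Qed.

Lemma rcont_const_on (m : R -> C) (a b : R) :
  a <= b -> rcont m a -> rcont m b ->
  (forall r r', a < r -> r <= r' -> r' < b -> m r = m r') -> m a = m b.
Proof.
  intros [Hab| ->] Ha Hb Hm; [|reflexivity].
  apply Cmod_sub_eq_0, Rle_antisym; [|apply Cmod_ge_0].
  apply le_epsilon. intros eps He. rewrite Rplus_0_l.
  destruct (proj2 (ccont_eps _ _) Ha (eps / 2) ltac:(lra)) as [d1 H1].
  destruct (proj2 (ccont_eps _ _) Hb (eps / 2) ltac:(lra)) as [d2 H2].
  set (d := Rmin ((b - a) / 2) (Rmin d1 d2) / 2).
  pose proof (Rmin_l ((b - a) / 2) (Rmin d1 d2)). pose proof (Rmin_r ((b - a) / 2) (Rmin d1 d2)).
  pose proof (Rmin_l d1 d2). pose proof (Rmin_r d1 d2).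
  assert (0 < Rmin ((b - a) / 2) (Rmin d1 d2)).
  { repeat apply Rmin_pos; [lra | apply cond_pos | apply cond_pos]. }
  specialize (H1 (a + d)). specialize (H2 (b - d)).
  assert (K1 : Cmod (m (a + d) - m a) < eps / 2).
  { apply H1. change (Rabs (a + d - a) < d1). replace (a + d - a) with d by ring.
    rewrite Rabs_pos_eq; unfold d in *; lra. }
  assert (K2 : Cmod (m (b - d) - m b) < eps / 2).
  { apply H2. change (Rabs (b - d - b) < d2). replace (b - d - b) with (- d) by ring.
    rewrite Rabs_Ropp, Rabs_pos_eq; unfold d in *; lra. }
  rewrite (Hm (a + d) (b - d)) in K1 by (unfold d in *; lra).
  replace (m a - m b)%C with ((m (b - d)%R - m b) - (m (b - d)%R - m a))%C by ring.
  eapply Rle_trans; [apply Cmod_triangle_minus|]. lra.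
Qed.

Lemma circle_int_0 (g : C -> C) : circle_int g 0 = (RtoC (2 * PI) * g 0)%C.
Proof.
  unfold circle_int.
  replace (fun t => g (circ 0 t)) with (fun _ : R => g 0).
  - rewrite CInt_const, Rminus_0_r. reflexivity.
  - apply functional_extensionality. intros t. f_equal.
    unfold circ. now rewrite !Rmult_0_l.
Qed.

(* An exceptional point [z0] costs nothing: continuity carries the circle integral across the
   radius [Cmod z0]. *)
Lemma circle_int_mean (g : C -> C) (z0 : C) (r r2 : R) :
  Cmod z0 < r < r2 ->
  (forall w, Cmod w < r2 -> ccontC g w) ->
  (forall w, Cmod w < r2 -> w <> z0 -> cdiffable g w) ->
  circle_int g r = (RtoC (2 * PI) * g 0)%C.
Proof.
  intros Hr Hc Hd. pose proof (Cmod_ge_0 z0) as H0.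
  assert (Hm : forall s, 0 <= s < r2 -> rcont (circle_int g) s).
  { intros s Hs. apply circle_int_continuous. exists r2. rewrite Rabs_pos_eq by lra. split; [lra | exact Hc]. }
  rewrite <- circle_int_0. symmetry.
  transitivity (circle_int g (Cmod z0)); (apply rcont_const_on; [lra | apply Hm; lra | apply Hm; lra |]);
    intros s s' h1 h2 h3.
  - apply (circle_int_annulus g 0 (Cmod z0)); try lra.
    intros w Hw. apply Hd; [lra|]. intros ->. lra.
  - apply (circle_int_annulus g (Cmod z0) r); try lra.
    intros w Hw. apply Hd; [lra|]. intros ->. lra.
Qed.

(* On [|w| = R] the conjugate of [w / (w - z)] is [1 / (1 - conj z * w / R^2)], which is analytic. *)
Lemma circle_int_cauchy_kernel (z : C) (R : R) :
  Cmod z < R -> circle_int (fun w => (w / (w - z))%C) R = RtoC (2 * PI).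
Proof.
  intros Hz. pose proof (Cmod_ge_0 z) as H0. pose proof two_PI_pos as HPI.
  assert (HR : R <> 0) by lra.
  set (p := fun w => (1 / (1 - Cconj z / RtoC (R ^ 2) * w))%C).
  assert (HR2 : RtoC (R ^ 2) <> 0).
  { intros E. apply (f_equal fst) in E. simpl in E. apply HR. nra. }
  (* The only pole of [p] is the reflection of [z] in the circle, of modulus R^2/|z| > R; for z = 0
     there is no pole and any radius beyond [R] will do. *)
  set (r2 := if Ceq_dec z 0 then R + 1 else R ^ 2 / Cmod z).
  assert (Hr2 : R < r2 /\ forall w, Cmod w < r2 -> (1 - Cconj z / RtoC (R ^ 2) * w <> 0)%C).
  { unfold r2. destruct (Ceq_dec z 0) as [e|n].
    - split; [lra|]. intros w _ E. rewrite e in E.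
      apply (f_equal Cmod) in E. rewrite Cmod_0 in E.
      replace (1 - Cconj 0 / RtoC (R ^ 2) * w)%C with (RtoC 1) in E.
      + rewrite Cmod_1 in E. lra.
      + replace (Cconj 0) with (RtoC 0) by (apply injective_projections; simpl; ring). field. exact HR2.
    - assert (0 < Cmod z) by now apply Cmod_gt_0.
      split; [apply Rlt_div_r; nra|].
      intros w Hw E. apply Rlt_div_r in Hw; [|lra].
      assert (E' : (Cconj z / RtoC (R ^ 2) * w)%C = 1).
      { replace (Cconj z / RtoC (R ^ 2) * w)%C with (1 - (1 - Cconj z / RtoC (R ^ 2) * w))%C by ring.
        rewrite E. ring. }
      apply (f_equal Cmod) in E'. rewrite Cmod_mult, Cmod_div, Cmod_conj, Cmod_R, Cmod_1 in E' by assumption.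
      rewrite Rabs_pos_eq in E' by (apply pow2_ge_0).
      assert (0 < R ^ 2) by nra.
      apply (f_equal (fun x => x * R ^ 2)) in E'.
      replace (Cmod z / R ^ 2 * Cmod w * R ^ 2) with (Cmod w * Cmod z) in E' by (field; lra). lra. }
  destruct Hr2 as [HRr Hne].
  assert (Dp : forall w, Cmod w < r2 -> cdiffable p w).
  { intros w Hw. apply cdiffable_div; [now apply Hne | apply cdiffable_const|].
    apply cdiffable_minus; [apply cdiffable_const|].
    apply cdiffable_mult; [apply cdiffable_const | apply cdiffable_id]. }
  assert (M : circle_int p R = RtoC (2 * PI)).
  { rewrite (circle_int_mean p z R r2).
    - unfold p. field. exact HR2.
    - lra.
    - intros w Hw. now apply cdiffable_cont, Dp.
    - intros w Hw _. now apply Dp. }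
  replace (RtoC (2 * PI)) with (Cconj (circle_int p R)).
  2: { rewrite M. apply injective_projections; simpl; ring. }
  unfold circle_int. rewrite <- CInt_conj; [|lra|].
  2: { intros t _. apply (rcont_comp p (circ R)); [|apply rcont_circ].
       apply cdiffable_cont, Dp. rewrite Cmod_circ, Rabs_pos_eq; lra. }
  apply CInt_ext; [lra|]. intros t _. unfold p.
  set (w := circ R t).
  assert (Hw : Cmod w = R) by (unfold w; rewrite Cmod_circ, Rabs_pos_eq; lra).
  assert (Ew : (w * Cconj w)%C = RtoC (R ^ 2)) by (rewrite <- Cmod2_conj, Hw; reflexivity).
  assert (Hw0 : w <> 0) by (apply Cmod_gt_0; lra).
  assert (Hcw0 : Cconj w <> 0) by (apply Cmod_gt_0; rewrite Cmod_conj; lra).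
  assert (Hwz : (w - z)%C <> 0).
  { apply Cmod_gt_0. pose proof (Cmod_triangle_rev w z). lra. }
  assert (HD : (1 - Cconj z / RtoC (R ^ 2) * w <> 0)%C) by (apply Hne; rewrite Hw; lra).
  rewrite Cdiv_conj, Cminus_conj, Cmult_conj, Cdiv_conj, Cconj_conj, <- Ew, Cmult_conj, Cconj_conj
    by (assumption || rewrite Ew; assumption).
  replace (Cconj 1) with (RtoC 1) by (apply injective_projections; simpl; ring).
  field. repeat split; try assumption.
Qed.

(** * Cauchy's formula *)

Lemma RtoC_neq_0 (x : R) : x <> 0 -> RtoC x <> 0.
Proof. intros H E. apply H. now apply (f_equal fst) in E. Qed.

Lemma two_PI_neq_0 : RtoC (2 * PI) <> 0.
Proof. apply RtoC_neq_0. pose proof two_PI_pos. lra. Qed.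

Lemma analytic_cont (f : C -> C) (z : C) : analytic f -> Cmod z < 1 -> ccontC f z.
Proof. intros Hf Hz. exact (cdiffable_cont f z (proj1 (analytic_cdiffable f) Hf z Hz)). Qed.

Lemma Cmod_circ_pos (r t : R) : 0 <= r -> Cmod (circ r t) = r.
Proof. intros. rewrite Cmod_circ. now apply Rabs_pos_eq. Qed.

Lemma circ_minus_lb (r t : R) (z : C) : 0 <= r -> r - Cmod z <= Cmod (circ r t - z).
Proof. intros. rewrite <- (Cmod_circ_pos r t) at 1 by assumption. apply Cmod_triangle_rev. Qed.

Lemma circ_minus_neq_0 (r t : R) (z : C) : Cmod z < r -> (circ r t - z)%C <> 0.
Proof.
  intros H. apply Cmod_gt_0. pose proof (Cmod_ge_0 z).
  pose proof (circ_minus_lb r t z). lra.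
Qed.

(** The slope [q] of [f] at [z] is continuous at [z] and differentiable elsewhere, which is exactly
    the exceptional point that [circle_int_mean] tolerates. Since w q(w) vanishes at 0 its mean is
    0, and the value of the Cauchy kernel integral remains. *)
Theorem cauchy_formula (f : C -> C) (z : C) (r : R) :
  analytic f -> Cmod z < r < 1 ->
  circle_int (fun w => (f w * (w / (w - z)))%C) r = (RtoC (2 * PI) * f z)%C.
Proof.
  intros Hf Hr. pose proof (Cmod_ge_0 z) as H0. pose proof two_PI_pos as HPI.
  pose proof (proj1 (analytic_cdiffable f) Hf) as Df.
  destruct (Df z ltac:(lra)) as [l [q [Hq [_ E]]]].
  assert (Dq : forall w, Cmod w < 1 -> w <> z -> cdiffable q w).
  { intros w Hw Hne. pose proof (Cmod_sub_gt_0 _ _ Hne) as Hp.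
    assert (D : cdiffable (fun w => (f w - f z) / (w - z))%C w).
    { apply cdiffable_div; [now apply Cmod_gt_0 | |];
      (apply cdiffable_minus; [|apply cdiffable_const]); [now apply Df | apply cdiffable_id]. }
    destruct D as [m Hm]. exists m. revert Hm.
    apply cdiff_ext_loc with (Cmod (w - z)); [exact Hp|].
    intros v Hv. rewrite (E v). field. apply Cmod_gt_0.
    pose proof (Cmod_triangle_rev (w - z) (w - v)) as T.
    replace (w - z - (w - v))%C with (v - z)%C in T by ring.
    rewrite (Cmod_minus_sym w v) in T. lra. }
  assert (Cq : forall w, Cmod w < 1 -> ccontC q w).
  { intros w Hw. destruct (Ceq_dec w z) as [->|n]; [exact Hq|]. now apply cdiffable_cont, Dq. }
  assert (G : circle_int (fun w => (w * q w)%C) r = 0).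
  { rewrite (circle_int_mean _ z r 1).
    - ring.
    - exact Hr.
    - intros w Hw. apply (ccont_mult (U := Cu)); [apply continuous_id | now apply Cq].
    - intros w Hw Hne. apply cdiffable_mult; [apply cdiffable_id | now apply Dq]. }
  assert (Hk : forall t, rcont (fun t => (circ r t / (circ r t - z))%C) t).
  { intros t. apply (ccont_div (U := R_UniformSpace)); [now apply circ_minus_neq_0 | apply rcont_circ |].
    apply (ccont_minus (U := R_UniformSpace)); [apply rcont_circ | apply ccont_const]. }
  replace (RtoC (2 * PI) * f z)%C with (f z * RtoC (2 * PI))%C by ring.
  rewrite <- (circle_int_cauchy_kernel z r) by lra.
  apply Cmod_sub_eq_0. unfold circle_int in *.
  rewrite <- CInt_scal by (trivial; lra).
  rewrite <- CInt_minus; [| lra | |].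
  - transitivity (Cmod (CInt (fun t => (circ r t * q (circ r t))%C) 0 (2 * PI)));
      [|rewrite G; apply Cmod_0].
    f_equal. apply CInt_ext; [lra|]. intros t _.
    rewrite (E (circ r t)). field. now apply circ_minus_neq_0.
  - intros t _. apply (ccont_mult (U := R_UniformSpace)); [|apply Hk].
    apply (rcont_comp f (circ r)); [|apply rcont_circ].
    apply cdiffable_cont, Df. rewrite Cmod_circ_pos; lra.
  - intros t _. apply (ccont_mult (U := R_UniformSpace)); [apply ccont_const | apply Hk].
Qed.

(** * Differentiation under the integral sign and Cauchy transforms *)

Lemma kernel_cdiff (k : C -> R -> C) (k' : R -> C) (z : C) (a b d M : R) :
  a <= b -> 0 < d ->
  (forall w t, Cmod (w - z) < d -> a <= t <= b -> rcont (k w) t) ->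
  (forall t, a <= t <= b -> rcont k' t) ->
  (forall w t, Cmod (w - z) < d -> a <= t <= b ->
     Cmod (k w t - k z t - k' t * (w - z)) <= M * Cmod (w - z) ^ 2) ->
  cdiff (fun w => CInt (k w) a b) z (CInt k' a b).
Proof.
  intros Hab Hd Hk Hk' HM. apply cdiff_eps. intros eps He.
  set (c := (b - a) * Rabs M + 1).
  pose proof (Rabs_pos M) as HM0.
  assert (Hc : 0 < c) by (unfold c; nra).
  exists (Rmin d (eps / c)). split; [apply Rmin_pos; [exact Hd | now apply Rdiv_lt_0_compat]|].
  intros w Hw. pose proof (Rmin_l d (eps / c)). pose proof (Rmin_r d (eps / c)).
  assert (Hz : Cmod (z - z) < d) by (unfold Cminus; rewrite Cplus_opp_r, Cmod_0; lra).
  assert (E : (CInt (k w) a b - CInt (k z) a b - CInt k' a b * (w - z))%C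
     = CInt (fun t => (k w t - k z t - (w - z) * k' t)%C) a b).
  { rewrite (CInt_minus (fun t => (k w t - k z t)%C) (fun t => ((w - z) * k' t)%C)); trivial.
    - rewrite CInt_minus, CInt_scal; trivial; [ring | |]; intros t Ht; apply Hk; trivial; lra.
    - intros t Ht. apply (ccont_minus (U := R_UniformSpace)); apply Hk; trivial; lra.
    - intros t Ht. apply (ccont_mult (U := R_UniformSpace)); [apply ccont_const | now apply Hk']. }
  rewrite E. pose proof (Cmod_ge_0 (w - z)) as Hm0.
  eapply Rle_trans; [apply CInt_bound with (M := M * Cmod (w - z) ^ 2); trivial|].
  - intros t Ht. apply (ccont_minus (U := R_UniformSpace)).
    + apply (ccont_minus (U := R_UniformSpace)); apply Hk; trivial; lra.
    + apply (ccont_mult (U := R_UniformSpace)); [apply ccont_const | now apply Hk'].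
  - intros t Ht. rewrite (Cmult_comm (w - z)). apply HM; [lra | exact Ht].
  - set (m := Cmod (w - z)) in *.
    assert (Hm : m * c <= eps) by (apply Rle_div_r; [exact Hc | lra]).
    pose proof (Rle_abs M) as HMa.
    assert ((b - a) * M <= c) by (unfold c; nra).
    replace ((b - a) * (M * m ^ 2)) with (((b - a) * M) * m * m) by ring.
    apply Rmult_le_compat_r; nra.
Qed.

Lemma rcont_bounded (phi : R -> C) (a b : R) :
  a <= b -> (forall t, rcont phi t) -> exists M, 0 <= M /\ forall t, a <= t <= b -> Cmod (phi t) <= M.
Proof.
  intros Hab Hp.
  destruct (continuity_ab_maj (fun t => Cmod (phi t)) a b Hab) as [x [Hx _]].
  - intros t _. apply continuity_pt_filterlim. apply filterlim_locally. intros eps.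
    generalize (proj2 (ccont_eps _ _) (Hp t) eps (cond_pos eps)). apply filter_imp. intros s Hs.
    change (Rabs (Cmod (phi s) - Cmod (phi t)) < eps).
    pose proof (Cmod_triangle_rev (phi s) (phi t)). pose proof (Cmod_triangle_rev (phi t) (phi s)).
    rewrite (Cmod_minus_sym (phi t)) in *. apply Rabs_def1; lra.
  - exists (Cmod (phi x)). split; [apply Cmod_ge_0 | exact Hx].
Qed.

Section CauchyTransform.

Variables (phi : R -> C) (r : R).
Hypothesis Hphi : forall t, rcont phi t.
Hypothesis Hr : r <= 1.

(** Cauchy integrals of an arbitrary continuous density, not assumed to be boundary values. The
    factor coming from dw = i w dt is absorbed in [phi], which is [f (circ r t) * circ r t] when a
    function [f] is represented. *)
Definition cauchy1 (z : C) : C := CInt (fun t => (phi t / (circ r t - z))%C) 0 (2 * PI).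
Definition cauchy2 (z : C) : C :=
  CInt (fun t => (phi t / ((circ r t - z) * (circ r t - z)))%C) 0 (2 * PI).

Lemma cauchy_kernel_facts (z : C) (t : R) (w : C) :
  Cmod z < r -> Cmod (w - z) < (r - Cmod z) / 2 ->
  (r - Cmod z) / 2 <= Cmod (circ r t - z) <= 2 /\ (r - Cmod z) / 2 <= Cmod (circ r t - w)
  /\ (circ r t - z <> 0)%C /\ (circ r t - w <> 0)%C.
Proof.
  intros Hz Hw. pose proof (Cmod_ge_0 z) as H0.
  pose proof (circ_minus_lb r t z ltac:(lra)) as L1.
  pose proof (circ_minus_lb r t w ltac:(lra)) as L2.
  pose proof (Cmod_triangle_minus (circ r t) z) as U. rewrite Cmod_circ_pos in U by lra.
  pose proof (Cmod_triangle_rev w z) as T.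
  repeat split; try lra; apply Cmod_gt_0; lra.
Qed.

Lemma cauchy1_cdiff (z : C) : Cmod z < r -> cdiff cauchy1 z (cauchy2 z).
Proof.
  intros Hz. pose proof (Cmod_ge_0 z) as H0. pose proof two_PI_pos as HPI.
  destruct (rcont_bounded phi 0 (2 * PI) ltac:(lra) Hphi) as [B [HB0 HB]].
  set (d := (r - Cmod z) / 2).
  assert (Hd : 0 < d) by (unfold d; lra).
  (* With u and v the distances from the circle point to [z] and [w], the Taylor remainder has
     modulus |phi| |w - z|^2 / (u^2 v), and both distances are at least [d]. *)
  apply (kernel_cdiff (fun w t => (phi t / (circ r t - w))%C)) with (d := d) (M := B / (d * d * d));
    [lra | exact Hd | | |].
  - intros w t Hw _. destruct (cauchy_kernel_facts z t w Hz Hw) as (_ & _ & _ & n).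
    apply (ccont_div (U := R_UniformSpace)); [exact n | apply Hphi |].
    apply (ccont_minus (U := R_UniformSpace)); [apply rcont_circ | apply ccont_const].
  - intros t _. pose proof (circ_minus_neq_0 r t z Hz) as n.
    apply (ccont_div (U := R_UniformSpace)); [now apply Cmult_neq_0 | apply Hphi |].
    apply (ccont_mult (U := R_UniformSpace));
    (apply (ccont_minus (U := R_UniformSpace)); [apply rcont_circ | apply ccont_const]).
  - intros w t Hw Ht. destruct (cauchy_kernel_facts z t w Hz Hw) as ([L1 _] & L2 & n1 & n2).
    fold d in L1, L2.
    replace (phi t / (circ r t - w) - phi t / (circ r t - z)
       - phi t / ((circ r t - z) * (circ r t - z)) * (w - z))%C
      with (phi t * ((w - z) * (w - z)) / ((circ r t - z) * (circ r t - z) * (circ r t - w)))%C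
      by (field; split; assumption).
    rewrite Cmod_div by (repeat apply Cmult_neq_0; assumption). rewrite !Cmod_mult.
    set (h := Cmod (w - z)). set (u := Cmod (circ r t - z)) in *. set (v := Cmod (circ r t - w)) in *.
    assert (0 <= h) by apply Cmod_ge_0.
    assert (d * d <= u * u) by nra.
    assert (d * d * d <= u * u * v) by (apply Rmult_le_compat; nra).
    assert (0 < d * d * d) by (repeat apply Rmult_lt_0_compat; lra).
    replace (B / (d * d * d) * h ^ 2) with ((B * (h * h)) * / (d * d * d)) by (field; lra).
    apply Rmult_le_compat.
    + apply Rmult_le_pos; [apply Cmod_ge_0 | nra].
    + left. apply Rinv_0_lt_compat. lra.
    + apply Rmult_le_compat_r; [nra | now apply HB].
    + apply Rinv_le_contravar; lra.
Qed.

Lemma cauchy2_cdiffable (z : C) : Cmod z < r -> cdiffable cauchy2 z.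
Proof.
  intros Hz. pose proof (Cmod_ge_0 z) as H0. pose proof two_PI_pos as HPI.
  destruct (rcont_bounded phi 0 (2 * PI) ltac:(lra) Hphi) as [B [HB0 HB]].
  set (d := (r - Cmod z) / 2).
  assert (Hd : 0 < d) by (unfold d; lra).
  (* Here the remainder is phi (3u - 2h) h^2 / (u^3 v^2) with h = w - z; the 8 bounds |3u - 2h|,
     since |u| <= 2 and |h| < d <= 1/2. *)
  eexists. apply (kernel_cdiff (fun w t => (phi t / ((circ r t - w) * (circ r t - w)))%C)
    (fun t => (2 * phi t / ((circ r t - z) * (circ r t - z) * (circ r t - z)))%C))
    with (d := d) (M := 8 * B / ((d * d * d) * (d * d)));
    [lra | exact Hd | | |].
  - intros w t Hw _. destruct (cauchy_kernel_facts z t w Hz Hw) as (_ & _ & _ & n).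
    apply (ccont_div (U := R_UniformSpace)); [now apply Cmult_neq_0 | apply Hphi |].
    apply (ccont_mult (U := R_UniformSpace));
    (apply (ccont_minus (U := R_UniformSpace)); [apply rcont_circ | apply ccont_const]).
  - intros t _. pose proof (circ_minus_neq_0 r t z Hz) as n.
    apply (ccont_div (U := R_UniformSpace)); [now repeat apply Cmult_neq_0 | |].
    + apply (ccont_mult (U := R_UniformSpace)); [apply ccont_const | apply Hphi].
    + assert (Hm : rcont (fun t => (circ r t - z)%C) t)
        by (apply (ccont_minus (U := R_UniformSpace)); [apply rcont_circ | apply ccont_const]).
      apply (ccont_mult (U := R_UniformSpace)); [|exact Hm].
      apply (ccont_mult (U := R_UniformSpace)); exact Hm.
  - intros w t Hw Ht. destruct (cauchy_kernel_facts z t w Hz Hw) as ([L1 U1] & L2 & n1 & n2).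
    fold d in L1, L2.
    replace (phi t / ((circ r t - w) * (circ r t - w)) - phi t / ((circ r t - z) * (circ r t - z))
       - 2 * phi t / ((circ r t - z) * (circ r t - z) * (circ r t - z)) * (w - z))%C
      with ((phi t * (3 * (circ r t - z) - 2 * (w - z))) * ((w - z) * (w - z))
         / (((circ r t - z) * (circ r t - z) * (circ r t - z)) * ((circ r t - w) * (circ r t - w))))%C
      by (field; split; assumption).
    rewrite Cmod_div by (repeat apply Cmult_neq_0; assumption).
    set (u0 := (circ r t - z)%C) in *. set (v0 := (circ r t - w)%C) in *. set (h0 := (w - z)%C) in *.
    rewrite !Cmod_mult.
    assert (K : Cmod (3 * u0 - 2 * h0) <= 8).
    { eapply Rle_trans; [apply Cmod_triangle_minus|]. rewrite !Cmod_mult, !Cmod_R, !Rabs_pos_eq by lra.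
      fold d in Hw. assert (d <= 1 / 2) by (unfold d; lra). lra. }
    set (h := Cmod h0) in *. set (u := Cmod u0) in *. set (v := Cmod v0) in *.
    set (c := Cmod (3 * u0 - 2 * h0)) in *.
    assert (0 <= h) by apply Cmod_ge_0. assert (0 <= c) by apply Cmod_ge_0.
    assert (d * d <= u * u) by nra.
    assert (d * d <= v * v) by nra.
    assert (d * d * d <= u * u * u) by (apply Rmult_le_compat; nra).
    assert (0 < d * d * d) by (repeat apply Rmult_lt_0_compat; lra).
    assert (0 < d * d) by (repeat apply Rmult_lt_0_compat; lra).
    assert ((d * d * d) * (d * d) <= (u * u * u) * (v * v)) by (apply Rmult_le_compat; lra).
    assert (0 < d * d * d * (d * d)) by (now apply Rmult_lt_0_compat).
    replace (8 * B / (d * d * d * (d * d)) * h ^ 2) with ((B * 8) * (h * h) * / (d * d * d * (d * d))) by (unfold Rdiv; ring).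
    apply Rmult_le_compat.
    + repeat apply Rmult_le_pos; trivial; apply Cmod_ge_0.
    + left. apply Rinv_0_lt_compat. lra.
    + apply Rmult_le_compat_r; [nra |]. apply Rmult_le_compat; trivial; [apply Cmod_ge_0 | now apply HB].
    + apply Rinv_le_contravar; lra.
Qed.

End CauchyTransform.

(** * Regularity of analytic functions and division by a linear factor *)

Lemma cdiff_unique (f : C -> C) (z l m : C) : cdiff f z l -> cdiff f z m -> l = m.
Proof.
  intros Hl Hm. apply (cdiff_is_derive f z l), is_C_derive_unique in Hl.
  apply (cdiff_is_derive f z m), is_C_derive_unique in Hm. congruence.
Qed.

Lemma rcont_density (f : C -> C) (r : R) (t : R) :
  (forall t, rcont (fun t => f (circ r t)) t) -> rcont (fun t => (f (circ r t) * circ r t)%C) t.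
Proof. intros H. apply (ccont_mult (U := R_UniformSpace)); [apply H | apply rcont_circ]. Qed.

Lemma circle_int_cauchy1 (f : C -> C) (r : R) (z : C) :
  circle_int (fun w => (f w * (w / (w - z)))%C) r = cauchy1 (fun t => (f (circ r t) * circ r t)%C) r z.
Proof.
  unfold circle_int, cauchy1. pose proof two_PI_pos.
  apply CInt_ext; [lra|]. intros t _. unfold Cdiv. ring.
Qed.

(** The common criterion of regularity: derivatives, quotients by z - a and locally uniform limits
    are all shown to be analytic by exhibiting a Cauchy integral. *)
Lemma cauchy_represented (f : C -> C) (phi : R -> C) (r : R) :
  r <= 1 -> (forall t, rcont phi t) ->
  (forall z, Cmod z < r -> cauchy1 phi r z = (RtoC (2 * PI) * f z)%C) ->
  forall z, Cmod z < r -> cdiff f z (cauchy2 phi r z / RtoC (2 * PI))%C.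
Proof.
  intros Hr Hphi Hf z Hz. pose proof two_PI_neq_0 as HPI.
  assert (D : cdiff (fun w => (/ RtoC (2 * PI) * cauchy1 phi r w)%C) z (cauchy2 phi r z / RtoC (2 * PI))%C).
  { pose proof (cdiff_mult _ _ z _ _ (cdiff_const (/ RtoC (2 * PI))%C z) (cauchy1_cdiff phi r Hphi Hr z Hz)) as D.
    replace (cauchy2 phi r z / RtoC (2 * PI))%C
      with (0 * cauchy1 phi r z + / RtoC (2 * PI) * cauchy2 phi r z)%C by (now field). exact D. }
  revert D. apply cdiff_ext_loc with (r - Cmod z); [lra|].
  intros w Hw. rewrite Hf.
  - now field.
  - pose proof (Cmod_triangle_rev w z). lra.
Qed.

Lemma analytic_rcont (f : C -> C) (r : R) (t : R) :
  analytic f -> 0 <= r < 1 -> rcont (fun t => f (circ r t)) t.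
Proof.
  intros Hf Hr. apply (rcont_comp f (circ r)); [|apply rcont_circ].
  apply analytic_cont; [exact Hf|]. rewrite Cmod_circ_pos; lra.
Qed.

Lemma analytic_represented (f : C -> C) (r : R) :
  analytic f -> r < 1 ->
  forall z, Cmod z < r ->
    cdiff f z (cauchy2 (fun t => (f (circ r t) * circ r t)%C) r z / RtoC (2 * PI))%C.
Proof.
  intros Hf Hr z Hz. pose proof (Cmod_ge_0 z).
  apply cauchy_represented; [lra | | | exact Hz].
  - intros t. apply rcont_density. intros s. apply analytic_rcont; [exact Hf | lra].
  - intros w Hw. rewrite <- circle_int_cauchy1. apply cauchy_formula; [exact Hf | lra].
Qed.

(** Choice gives [f'] on the disc; near each point, uniqueness of the derivative identifies it with
    a [cauchy2] integral over one fixed circle, and such an integral is differentiable again. *)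
Theorem analytic_derivative (f : C -> C) :
  analytic f -> exists f', analytic f' /\ forall z, Cmod z < 1 -> cdiff f z (f' z).
Proof.
  intros Hf.
  assert (Hex : forall z, exists l, Cmod z < 1 -> cdiff f z l).
  { intros z. destruct (Rlt_dec (Cmod z) 1) as [h|n].
    - destruct (proj1 (analytic_cdiffable f) Hf z h) as [l Hl]. now exists l.
    - exists 0. intros; contradiction. }
  set (f' := fun z => proj1_sig (constructive_indefinite_description _ (Hex z))).
  assert (Hf' : forall z, Cmod z < 1 -> cdiff f z (f' z)).
  { intros z. exact (proj2_sig (constructive_indefinite_description _ (Hex z))). }
  exists f'. split; [|exact Hf'].
  apply analytic_cdiffable. intros z Hz. pose proof (Cmod_ge_0 z).
  set (r := (1 + Cmod z) / 2).
  assert (Hr : Cmod z < r < 1) by (unfold r; lra).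
  set (phi := fun t => (f (circ r t) * circ r t)%C).
  assert (Hphi : forall t, rcont phi t).
  { intros t. apply rcont_density. intros s. apply analytic_rcont; [exact Hf | lra]. }
  assert (D : cdiffable (fun w => (cauchy2 phi r w / RtoC (2 * PI))%C) z).
  { apply cdiffable_div; [apply two_PI_neq_0 | | apply cdiffable_const].
    apply cauchy2_cdiffable; trivial; lra. }
  destruct D as [l D]. exists l. revert D. apply cdiff_ext_loc with (r - Cmod z); [lra|].
  intros w Hw. pose proof (Cmod_triangle_rev w z).
  apply (cdiff_unique f w).
  - apply analytic_represented; [exact Hf | lra | lra].
  - apply Hf'. lra.
Qed.

(** By partial fractions, (1/(c - w) - 1/(c - a)) / (w - a) = 1/((c - w)(c - a)), so the slope at
    [a] is the Cauchy integral of the density divided by c - a. The same integral at w = a is f'(a),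
    so the singularity is removable. *)
Lemma analytic_quotient (f : C -> C) (a : C) :
  analytic f -> Cmod a < 1 ->
  exists q, analytic q /\ forall w, f w = (f a + q w * (w - a))%C.
Proof.
  intros Hf Ha. pose proof (proj1 (analytic_cdiffable f) Hf) as Df.
  destruct (Df a Ha) as [l Dl].
  pose proof Dl as [q [Hq [Eq E]]].
  exists q. split; [|exact E].
  apply analytic_cdiffable. intros z Hz. pose proof (Cmod_ge_0 z). pose proof (Cmod_ge_0 a).
  pose proof (Rmax_l (Cmod z) (Cmod a)). pose proof (Rmax_r (Cmod z) (Cmod a)).
  assert (Rmax (Cmod z) (Cmod a) < 1) by (now apply Rmax_lub_lt).
  set (r := (1 + Rmax (Cmod z) (Cmod a)) / 2).
  assert (Hr : r < 1) by (unfold r; lra).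
  assert (Hra : Cmod a < r) by (unfold r; lra).
  assert (Hrz : Cmod z < r) by (unfold r; lra).
  set (phi := fun t => (f (circ r t) * circ r t / (circ r t - a))%C).
  assert (Hphi0 : forall t, rcont (fun t => (f (circ r t) * circ r t)%C) t).
  { intros t. apply rcont_density. intros s. apply analytic_rcont; [exact Hf | lra]. }
  assert (Hphi : forall t, rcont phi t).
  { intros t. apply (ccont_div (U := R_UniformSpace)); [now apply circ_minus_neq_0 | apply Hphi0 |].
    apply (ccont_minus (U := R_UniformSpace)); [apply rcont_circ | apply ccont_const]. }
  pose proof two_PI_pos as HPI.
  eexists. apply (cauchy_represented q phi r); [lra | exact Hphi | | exact Hrz].
  intros w Hw. destruct (Ceq_dec w a) as [->|n].
  - rewrite Eq, (cdiff_unique f a _ _ Dl (analytic_represented f r Hf Hr a Hra)).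
    replace (RtoC (2 * PI) * (_ / RtoC (2 * PI)))%C
      with (cauchy2 (fun t => (f (circ r t) * circ r t)%C) r a) by (field; apply two_PI_neq_0).
    unfold cauchy1, cauchy2, phi. apply CInt_ext; [lra|]. intros t _.
    field. now apply circ_minus_neq_0.
  - assert (Hn : (w - a <> 0)%C) by now apply Cmod_gt_0, Cmod_sub_gt_0.
    assert (Hk : forall v, Cmod v < r ->
       (forall t, rcont (fun t => (f (circ r t) * circ r t / (circ r t - v))%C) t)).
    { intros v Hv t. apply (ccont_div (U := R_UniformSpace)); [now apply circ_minus_neq_0 | apply Hphi0 |].
      apply (ccont_minus (U := R_UniformSpace)); [apply rcont_circ | apply ccont_const]. }
    assert (Ef : forall v, Cmod v < r -> cauchy1 (fun t => (f (circ r t) * circ r t)%C) r v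
         = (RtoC (2 * PI) * f v)%C).
    { intros v Hv. rewrite <- circle_int_cauchy1. apply cauchy_formula; [exact Hf | lra]. }
    replace (RtoC (2 * PI) * q w)%C
      with (/ (w - a) * (RtoC (2 * PI) * f w - RtoC (2 * PI) * f a))%C
      by (rewrite (E w); field; exact Hn).
    rewrite <- !Ef by assumption. unfold cauchy1.
    rewrite <- CInt_minus; [| lra | intros; now apply Hk | intros; now apply Hk].
    rewrite <- CInt_scal; [| lra |].
    + apply CInt_ext; [lra|]. intros t _. unfold phi. field.
      repeat split; trivial; now apply circ_minus_neq_0.
    + intros t _. apply (ccont_minus (U := R_UniformSpace)); now apply Hk.
Qed.

(** * Series with nonnegative terms and locally uniform limits of analytic functions *)

Definition clim (u : nat -> C) (l : C) : Prop :=
  forall eps, 0 < eps -> exists N, forall n, (N <= n)%nat -> Cmod (u n - l) < eps.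

Lemma Cmod_dist_triangle (x y z : C) : Cmod (x - z) <= Cmod (x - y) + Cmod (y - z).
Proof. replace (x - z)%C with ((x - y) + (y - z))%C by ring. apply Cmod_triangle. Qed.

Lemma Cmod_minus_diag (x : C) : Cmod (x - x) = 0.
Proof. unfold Cminus. now rewrite Cplus_opp_r, Cmod_0. Qed.

Fixpoint psum (a : nat -> R) (n : nat) : R :=
  match n with O => 0 | S m => psum a m + a m end.

Lemma psum_mono (a : nat -> R) (n m : nat) :
  (forall k, 0 <= a k) -> (n <= m)%nat -> psum a n <= psum a m.
Proof. intros Ha H. induction H as [|m H IH]; [lra|]. simpl. specialize (Ha m). lra. Qed.

(** Boundedness of the partial sums is convergence for nonnegative terms, and it is to such terms
    that the notion is applied. *)
Definition summable (a : nat -> R) : Prop := exists L, forall n, psum a n <= L.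

Lemma summable_tail (a : nat -> R) :
  (forall n, 0 <= a n) -> summable a ->
  exists L, (forall n, psum a n <= L) /\
    forall eps, 0 < eps -> exists N, forall n, (N <= n)%nat -> L - psum a n < eps.
Proof.
  intros Ha [B HB].
  destruct (completeness (fun r => exists n, r = psum a n)) as [L [HL1 HL2]].
  { exists B. intros r [n ->]. apply HB. }
  { exists 0. now exists 0%nat. }
  exists L. split; [intros n; apply HL1; now exists n|].
  intros eps He.
  assert (HN : exists N, L - psum a N < eps).
  { apply NNPP. intros Hno. assert (L <= L - eps); [|lra]. apply HL2. intros r [n ->].
    apply Rnot_lt_le. intros h. apply Hno. exists n. lra. }
  destruct HN as [N HN]. exists N. intros n Hn.
  pose proof (psum_mono a N n Ha Hn). lra.
Qed.

Lemma psum_dist (u : nat -> C) (M : nat -> R) (n k : nat) :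
  (forall n, Cmod (u (S n) - u n) <= M n) ->
  Cmod (u (n + k)%nat - u n) <= psum M (n + k) - psum M n.
Proof.
  intros H. induction k as [|k IH].
  - rewrite Nat.add_0_r, Cmod_minus_diag. lra.
  - rewrite Nat.add_succ_r. simpl.
    pose proof (Cmod_dist_triangle (u (S (n + k))) (u (n + k)%nat) (u n)). specialize (H (n + k)%nat). lra.
Qed.

Lemma cseq_converges (u : nat -> C) (M : nat -> R) (L : R) :
  (forall n, Cmod (u (S n) - u n) <= M n) -> (forall n, psum M n <= L) ->
  (forall eps, 0 < eps -> exists N, forall n, (N <= n)%nat -> L - psum M n < eps) ->
  exists l, forall n, Cmod (u n - l) <= L - psum M n.
Proof.
  intros Hu HL Ht.
  assert (HM : forall n m, (n <= m)%nat -> Cmod (u m - u n) <= L - psum M n).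
  { intros n m Hnm. replace m with (n + (m - n))%nat by lia.
    eapply Rle_trans; [apply psum_dist, Hu|]. specialize (HL (n + (m - n))%nat). lra. }
  assert (Hc : forall p : C -> R, (forall x y : C, Rabs (p x - p y) <= Cmod (x - y)) ->
            ex_finite_lim_seq (fun n => p (u n))).
  { intros p Hp. apply ex_lim_seq_cauchy_corr. intros eps.
    destruct (Ht (eps / 2) ltac:(pose proof (cond_pos eps); lra)) as [N HN].
    exists N. intros n m hn hm. eapply Rle_lt_trans; [apply Hp|].
    pose proof (Cmod_dist_triangle (u n) (u N) (u m)).
    rewrite (Cmod_minus_sym (u N)) in H. specialize (HN N (le_n N)).
    pose proof (HM N n hn). pose proof (HM N m hm). lra. }
  destruct (Hc fst) as [l1 H1].
  { intros x y. apply (re_le_Cmod (x - y)). }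
  destruct (Hc snd) as [l2 H2].
  { intros x y. apply (im_le_Cmod (x - y)). }
  exists (l1, l2). intros n. apply le_epsilon. intros eps He.
  apply is_lim_seq_spec in H1. apply is_lim_seq_spec in H2.
  destruct (H1 (mkposreal (eps / 2) ltac:(lra))) as [N1 K1].
  destruct (H2 (mkposreal (eps / 2) ltac:(lra))) as [N2 K2]. simpl in K1, K2.
  set (m := (n + N1 + N2)%nat).
  specialize (K1 m ltac:(unfold m; lia)). specialize (K2 m ltac:(unfold m; lia)).
  pose proof (Cmod_dist_triangle (u n) (u m) (l1, l2)).
  pose proof (HM n m ltac:(unfold m; lia)). rewrite Cmod_minus_sym in H0.
  assert (Cmod (u m - (l1, l2)) <= eps).
  { eapply Rle_trans; [apply Cmod_le_abs|]. simpl. unfold Rminus in *. lra. }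
  lra.
Qed.

(** The Weierstrass M-test makes the convergence uniform on each smaller disc, so Cauchy's formula
    passes to the limit, and the limit is again a Cauchy integral of its values on a circle. *)
Theorem analytic_limit (F : nat -> C -> C) :
  (forall n, analytic (F n)) ->
  (forall r, r < 1 -> exists M, summable M /\ (forall n, 0 <= M n) /\
     forall n z, Cmod z <= r -> Cmod (F (S n) z - F n z) <= M n) ->
  exists G, analytic G /\ forall z, Cmod z < 1 -> clim (fun n => F n z) (G z).
Proof.
  intros HF HM.
  assert (HU : forall r, r < 1 -> exists tau : nat -> R,
     (forall eps, 0 < eps -> exists N, forall n, (N <= n)%nat -> tau n < eps) /\
     forall z, Cmod z <= r -> exists l, forall n, Cmod (F n z - l) <= tau n).
  { intros r Hr. destruct (HM r Hr) as [M [Hs [Hp Hb]]].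
    destruct (summable_tail M Hp Hs) as [L [HL Ht]].
    exists (fun n => L - psum M n). split; [exact Ht|].
    intros z Hz. apply cseq_converges; trivial. intros n. now apply Hb. }
  assert (Hex : forall z, exists l, Cmod z < 1 -> clim (fun n => F n z) l).
  { intros z. destruct (Rlt_dec (Cmod z) 1) as [h|n]; [|exists 0; intros; contradiction].
    destruct (HU (Cmod z) h) as [tau [Ht Hl]]. destruct (Hl z (Rle_refl _)) as [l H].
    exists l. intros _ eps He. destruct (Ht eps He) as [N HN]. exists N. intros n Hn.
    specialize (H n). specialize (HN n Hn). lra. }
  set (G := fun z => proj1_sig (constructive_indefinite_description _ (Hex z))).
  assert (HG : forall z, Cmod z < 1 -> clim (fun n => F n z) (G z)).
  { intros z. exact (proj2_sig (constructive_indefinite_description _ (Hex z))). }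
  clearbody G. exists G. split; [|exact HG].
  assert (HGu : forall r, r < 1 -> forall eps, 0 < eps -> exists n, forall z, Cmod z <= r ->
            Cmod (F n z - G z) <= eps).
  { intros r Hr eps He. destruct (HU r Hr) as [tau [Ht Hl]].
    destruct (Ht (eps / 2) ltac:(lra)) as [n Hn]. exists n. intros z Hz.
    apply le_epsilon. intros e' He'.
    destruct (HG z ltac:(lra) e' He') as [N1 HN1].
    destruct (Hl z Hz) as [l H].
    set (m := (n + N1)%nat).
    specialize (HN1 m ltac:(unfold m; lia)).
    pose proof (Hn n (le_n n)). pose proof (Hn m ltac:(unfold m; lia)).
    pose proof (H n). pose proof (H m).
    pose proof (Cmod_dist_triangle (F n z) (F m z) (G z)).
    pose proof (Cmod_dist_triangle (F n z) l (F m z)).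
    rewrite (Cmod_minus_sym l) in *. lra. }
  apply analytic_cdiffable. intros z Hz. pose proof (Cmod_ge_0 z). pose proof two_PI_pos as HPI.
  set (r := (1 + Cmod z) / 2).
  assert (Hr : Cmod z < r < 1) by (unfold r; lra).
  assert (Hc : forall t, rcont (fun t => G (circ r t)) t).
  { intros t. apply ccont_eps. intros eps He.
    destruct (HGu r ltac:(lra) (eps / 4) ltac:(lra)) as [n Hn].
    generalize (proj2 (ccont_eps _ _) (analytic_rcont (F n) r t (HF n) ltac:(lra)) (eps / 4) ltac:(lra)).
    apply filter_imp. intros s Hs.
    assert (Hcm : forall s, Cmod (circ r s) <= r) by (intros; rewrite Cmod_circ_pos; lra).
    pose proof (Hn _ (Hcm s)). pose proof (Hn _ (Hcm t)).
    pose proof (Cmod_dist_triangle (G (circ r s)) (F n (circ r s)) (G (circ r t))).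
    pose proof (Cmod_dist_triangle (F n (circ r s)) (F n (circ r t)) (G (circ r t))).
    rewrite (Cmod_minus_sym (G (circ r s)) (F n (circ r s))) in *. lra. }
  eexists. apply (cauchy_represented G (fun t => (G (circ r t) * circ r t)%C) r); try lra.
  - intros t. now apply rcont_density.
  - intros w Hw. rewrite <- circle_int_cauchy1. pose proof (Cmod_ge_0 w).
    apply Cmod_sub_eq_0, Rle_antisym; [|apply Cmod_ge_0].
    apply le_epsilon. intros eps He. rewrite Rplus_0_l.
    (* Two errors of size [eps / c]: on the circle, where the kernel is at most r/(r - |w|), and at
       the point [w]. *)
    set (c := 2 * PI * (r / (r - Cmod w)) + 2 * PI).
    assert (0 < r / (r - Cmod w)) by (apply Rdiv_lt_0_compat; lra).
    assert (Hc0 : 0 < c) by (unfold c; nra).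
    destruct (HGu r ltac:(lra) (eps / c)) as [n Hn].
    { now apply Rdiv_lt_0_compat. }
    set (e := eps / c) in *.
    assert (He0 : 0 <= e) by (left; now apply Rdiv_lt_0_compat).
    replace (circle_int (fun v => (G v * (v / (v - w)))%C) r - RtoC (2 * PI) * G w)%C
      with ((circle_int (fun v => (G v * (v / (v - w)))%C) r - circle_int (fun v => (F n v * (v / (v - w)))%C) r)
         + RtoC (2 * PI) * (F n w - G w))%C.
    2: { rewrite (cauchy_formula (F n)); [ring | apply HF | lra]. }
    assert (Hk : forall t, rcont (fun t => (circ r t / (circ r t - w))%C) t).
    { intros t. apply (ccont_div (U := R_UniformSpace)); [now apply circ_minus_neq_0 | apply rcont_circ |].
      apply (ccont_minus (U := R_UniformSpace)); [apply rcont_circ | apply ccont_const]. }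
    assert (HkG : forall t, rcont (fun t => (G (circ r t) * (circ r t / (circ r t - w)))%C) t)
      by (intros; apply (ccont_mult (U := R_UniformSpace)); [apply Hc | apply Hk]).
    assert (HkF : forall t, rcont (fun t => (F n (circ r t) * (circ r t / (circ r t - w)))%C) t)
      by (intros; apply (ccont_mult (U := R_UniformSpace)); [apply analytic_rcont; [apply HF | lra] | apply Hk]).
    eapply Rle_trans; [apply Cmod_triangle|].
    apply Rle_trans with (2 * PI * (r / (r - Cmod w)) * e + 2 * PI * e).
    + apply Rplus_le_compat.
      * unfold circle_int. rewrite <- CInt_minus; [| lra | intros; apply HkG | intros; apply HkF].
        replace (2 * PI * (r / (r - Cmod w)) * e) with ((2 * PI - 0) * (r / (r - Cmod w) * e)) by ring.
        apply CInt_bound; [lra | |].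
        -- intros t _. apply (ccont_minus (U := R_UniformSpace)); [apply HkG | apply HkF].
        -- intros t _.
           replace (G (circ r t) * (circ r t / (circ r t - w)) - F n (circ r t) * (circ r t / (circ r t - w)))%C
             with ((circ r t / (circ r t - w)) * (G (circ r t) - F n (circ r t)))%C by ring.
           rewrite Cmod_mult, Cmod_div by (now apply circ_minus_neq_0).
           rewrite Cmod_circ_pos by lra.
           apply Rmult_le_compat; [| apply Cmod_ge_0 | |].
           ++ apply Rdiv_le_0_compat; [lra|]. apply Cmod_gt_0. now apply circ_minus_neq_0.
           ++ apply Rmult_le_compat_l; [lra|]. apply Rinv_le_contravar; [lra|]. apply circ_minus_lb. lra.
           ++ rewrite Cmod_minus_sym. apply Hn. rewrite Cmod_circ_pos; lra.
      * rewrite Cmod_mult, Cmod_R, Rabs_pos_eq by lra. apply Rmult_le_compat_l; [lra|]. apply Hn. lra.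
    + replace (2 * PI * (r / (r - Cmod w)) * e + 2 * PI * e) with (c * e) by (unfold c; ring).
      unfold e. right. field. lra.
Qed.

(** A crude constant avoids the maximum principle. If |z| >= 1/2 the triangle inequality suffices;
    otherwise the two Cauchy kernels on the circle of radius 3/4 differ by z/(w - z), and |w - z| >=
    1/4. *)
Lemma schwarz_bound_0 (f : C -> C) :
  analytic f -> (forall z, Cmod z < 1 -> Cmod (f z) <= 1) ->
  forall z, Cmod z < 1 -> Cmod (f z - f 0) <= 4 * Cmod z.
Proof.
  intros Hf Hb z Hz. pose proof (Cmod_ge_0 z). pose proof two_PI_pos as HPI.
  destruct (Rle_dec (1 / 2) (Cmod z)) as [h|n].
  - eapply Rle_trans; [apply Cmod_triangle_minus|].
    pose proof (Hb z Hz). pose proof (Hb 0 ltac:(rewrite Cmod_0; lra)). lra.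
  - set (r := 3 / 4).
    assert (Hk : forall v, Cmod v < r -> forall t,
       rcont (fun t => (f (circ r t) * (circ r t / (circ r t - v)))%C) t).
    { intros v Hv t. apply (ccont_mult (U := R_UniformSpace)); [apply analytic_rcont; [exact Hf | unfold r; lra] |].
      apply (ccont_div (U := R_UniformSpace)); [now apply circ_minus_neq_0 | apply rcont_circ |].
      apply (ccont_minus (U := R_UniformSpace)); [apply rcont_circ | apply ccont_const]. }
    assert (Hzr : Cmod z < r) by (unfold r; lra).
    assert (H0r : Cmod 0 < r) by (rewrite Cmod_0; unfold r; lra).
    assert (Hr1 : r < 1) by (unfold r; lra).
    apply Rmult_le_reg_l with (2 * PI); [lra|].
    rewrite <- (Rabs_pos_eq (2 * PI)) at 1 by lra. rewrite <- Cmod_R, <- Cmod_mult.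
    replace (RtoC (2 * PI) * (f z - f 0))%C with (RtoC (2 * PI) * f z - RtoC (2 * PI) * f 0)%C by ring.
    rewrite <- (cauchy_formula f z r), <- (cauchy_formula f 0 r) by (trivial; lra).
    unfold circle_int. rewrite <- CInt_minus; [| lra | intros; now apply Hk | intros; now apply Hk].
    replace (2 * PI * (4 * Cmod z)) with ((2 * PI - 0) * (4 * Cmod z)) by ring.
    apply CInt_bound; [lra | |].
    + intros t _. apply (ccont_minus (U := R_UniformSpace)); now apply Hk.
    + intros t _. pose proof (circ_minus_neq_0 r t z Hzr) as n1. pose proof (circ_minus_neq_0 r t 0 H0r) as n2.
      replace (circ r t - 0)%C with (circ r t) in * by ring.
      replace (f (circ r t) * (circ r t / (circ r t - z)) - f (circ r t) * (circ r t / circ r t))%C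
        with (f (circ r t) * (z / (circ r t - z)))%C by (field; split; assumption).
      rewrite Cmod_mult, Cmod_div by assumption.
      pose proof (circ_minus_lb r t z ltac:(unfold r; lra)) as L.
      pose proof (Hb (circ r t) ltac:(rewrite Cmod_circ_pos; unfold r; lra)) as B.
      assert (Cmod z / Cmod (circ r t - z) <= 4 * Cmod z).
      { apply Rle_div_l; unfold r in *; nra. }
      assert (0 <= Cmod z / Cmod (circ r t - z)) by (apply Rdiv_le_0_compat; unfold r in *; lra).
      pose proof (Cmod_ge_0 (f (circ r t))). nra.
Qed.

(** * Poisson kernels *)

Lemma unit_disc_open (x y : R) :
  Cmod (x, y) < 1 -> locally_2d (fun u v => Cmod (u, v) < 1) x y.
Proof.
  intros H. exists (mkposreal ((1 - Cmod (x, y)) / 2) ltac:(lra)). intros u v hu hv. simpl in *.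
  pose proof (Cmod_triangle_rev (u, v) (x, y)).
  pose proof (Cmod_le_abs ((u, v) - (x, y))%C). simpl in *. unfold Rminus in *. lra.
Qed.

Lemma derive_re_x (F : C -> C) (l : C) (x y : R) :
  cdiff F (x, y) l -> is_derive (fun s => fst (F (s, y))) x (fst l).
Proof.
  intros D. apply is_derive_Reals. intros eps He.
  destruct (proj1 (cdiff_eps _ _ _) D (eps / 2) ltac:(lra)) as [d [Hd Hw]].
  exists (mkposreal d Hd). intros h h0 Hh. simpl in Hh.
  specialize (Hw (x + h, y)).
  replace (((x + h)%R, y) - (x, y))%C with (RtoC h) in Hw by (apply injective_projections; simpl; ring).
  rewrite Cmod_R in Hw. specialize (Hw Hh).
  match goal with |- Rabs ?e < _ => replace e
    with (fst (F ((x + h)%R, y) - F (x, y) - l * RtoC h)%C / h) by (simpl; field; exact h0) end.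
  unfold Rdiv. rewrite Rabs_mult, Rabs_inv.
  assert (0 < Rabs h) by now apply Rabs_pos_lt.
  apply Rle_lt_trans with (eps / 2); [|lra].
  apply Rle_div_l; [assumption|].
  eapply Rle_trans; [apply re_le_Cmod | exact Hw].
Qed.

(** The Cauchy-Riemann equations in multiplicative form: the derivative in y is the real part of i
    F', so it stays within real parts of analytic functions. *)
Lemma derive_re_y (F : C -> C) (l : C) (x y : R) :
  cdiff F (x, y) l -> is_derive (fun t => fst (F (x, t))) y (fst (Ci * l)%C).
Proof.
  intros D. apply is_derive_Reals. intros eps He.
  destruct (proj1 (cdiff_eps _ _ _) D (eps / 2) ltac:(lra)) as [d [Hd Hw]].
  exists (mkposreal d Hd). intros h h0 Hh. simpl in Hh.
  specialize (Hw (x, y + h)).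
  replace ((x, (y + h)%R) - (x, y))%C with (Ci * RtoC h)%C in Hw by (apply injective_projections; simpl; ring).
  rewrite Cmod_mult, Cmod_Ci, Rmult_1_l, Cmod_R in Hw. specialize (Hw Hh).
  match goal with |- Rabs ?e < _ => replace e
    with (fst (F (x, (y + h)%R) - F (x, y) - l * (Ci * RtoC h))%C / h) by (simpl; field; exact h0) end.
  unfold Rdiv. rewrite Rabs_mult, Rabs_inv.
  assert (0 < Rabs h) by now apply Rabs_pos_lt.
  apply Rle_lt_trans with (eps / 2); [|lra].
  apply Rle_div_l; [assumption|].
  eapply Rle_trans; [apply re_le_Cmod | exact Hw].
Qed.

Lemma continuity_re (F : C -> C) (x y : R) :
  ccontC F (x, y) -> continuity_2d_pt (fun s t => fst (F (s, t))) x y.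
Proof.
  intros HF eps. destruct (proj2 (ccont_eps_C _ _) HF eps (cond_pos eps)) as [d [Hd Hw]].
  exists (mkposreal (d / 2) ltac:(lra)). intros u v hu hv. simpl in hu, hv.
  eapply Rle_lt_trans; [apply (re_le_Cmod (F (u, v) - F (x, y)))|]. apply Hw.
  pose proof (Cmod_le_abs ((u, v) - (x, y))%C). simpl in *. unfold Rminus in *. lra.
Qed.

Lemma analytic_Ci (F : C -> C) : analytic F -> analytic (fun z => (Ci * F z)%C).
Proof.
  intros HF. apply analytic_cdiffable. intros z Hz.
  apply cdiffable_mult; [apply cdiffable_const | now apply (proj1 (analytic_cdiffable F))].
Qed.

(** The induction runs over all analytic [F] at once, because the two partial derivatives of Re F
    are Re F' and Re (i F'). *)
Lemma re_analytic_smooth (n : nat) (F : C -> C) (x y : R) :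
  analytic F -> Cmod (x, y) < 1 -> ex_diff_n (fun s t => fst (F (s, t))) n x y.
Proof.
  revert F x y. induction n as [|n IH]; intros F x y HF Hz.
  - split; [|trivial]. now apply continuity_re, analytic_cont.
  - destruct (analytic_derivative F HF) as [F' [HF' D]].
    destruct (unit_disc_open x y Hz) as [d Hd].
    split; [|split; [|split; [|split]]].
    + now apply continuity_re, analytic_cont.
    + eexists. now apply derive_re_x, D.
    + eexists. now apply derive_re_y, D.
    + apply (ex_diff_n_ext_loc (fun s t => fst (F' (s, t)))); [|now apply IH].
      exists d. intros u v hu hv. symmetry. apply is_derive_unique, derive_re_x, D. now apply Hd.
    + apply (ex_diff_n_ext_loc (fun s t => fst (Ci * F' (s, t))%C)).
      * exists d. intros u v hu hv. symmetry. apply is_derive_unique, derive_re_y, D. now apply Hd.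
      * apply (IH (fun z => (Ci * F' z)%C)); [now apply analytic_Ci | exact Hz].
Qed.

Lemma re_analytic_harmonic (F : C -> C) : analytic F -> harmonic (fun z => fst (F z)).
Proof.
  intros HF x y Hz. split; [now apply re_analytic_smooth|].
  destruct (analytic_derivative F HF) as [F' [HF' D]].
  destruct (analytic_derivative F' HF') as [F'' [_ D']].
  destruct (unit_disc_open x y Hz) as [d Hd].
  assert (D2 : cdiff (fun z => (Ci * F' z)%C) (x, y) (Ci * F'' (x, y))%C).
  { replace (Ci * F'' (x, y))%C with (0 * F' (x, y) + Ci * F'' (x, y))%C by ring.
    apply (cdiff_mult (fun _ => Ci)); [apply cdiff_const | now apply D']. }
  assert (Exx : Derive (fun s => Derive (fun t => fst (F (t, y))) s) x = fst (F'' (x, y))).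
  { transitivity (Derive (fun s => fst (F' (s, y))) x).
    - apply Derive_ext_loc. exists d. intros s hs. apply is_derive_unique, derive_re_x, D.
      apply Hd; [exact hs|]. rewrite Rminus_diag, Rabs_R0. apply cond_pos.
    - now apply is_derive_unique, derive_re_x, D'. }
  assert (Eyy : Derive (fun s => Derive (fun t => fst (F (x, t))) s) y = fst (Ci * (Ci * F'' (x, y)))%C).
  { transitivity (Derive (fun t => fst (Ci * F' (x, t))%C) y).
    - apply Derive_ext_loc. exists d. intros s hs. apply is_derive_unique, derive_re_y, D.
      apply Hd; [|exact hs]. rewrite Rminus_diag, Rabs_R0. apply cond_pos.
    - now apply is_derive_unique, (derive_re_y (fun z => (Ci * F' z)%C)), D2. }
  unfold partial_derive. simpl Derive_n. rewrite Exx, Eyy. simpl. ring.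
Qed.

(** The classical Poisson kernel when |b| = 1; for |b| < 1 it is dilated, hence harmonic in [z]
    beyond the unit circle. It is the real part of the Herglotz kernel (1 + w)/(1 - w) at w = conj b
    z. *)
Definition poisson (b z : C) : R :=
  (1 - Cmod (Cconj b * z)%C ^ 2) / Cmod (1 - Cconj b * z)%C ^ 2.

Lemma one_minus_neq_0 (w : C) : Cmod w < 1 -> (1 - w)%C <> 0.
Proof. intros H. apply Cmod_gt_0. pose proof (Cmod_triangle_rev 1 w). rewrite Cmod_1 in H0. lra. Qed.

Lemma re_herglotz (w : C) :
  (1 - w)%C <> 0 -> fst ((1 + w) / (1 - w))%C = (1 - Cmod w ^ 2) / Cmod (1 - w)%C ^ 2.
Proof.
  intros H. apply Cmod_gt_0 in H. assert (H2 : 0 < Cmod (1 - w)%C ^ 2) by (apply pow_lt; lra).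
  rewrite !Cmod_sqr in *. destruct w as [a b]. simpl in *. field. lra.
Qed.

Lemma Cmod_conj_mult (b z : C) : Cmod (Cconj b * z)%C = Cmod b * Cmod z.
Proof. now rewrite Cmod_mult, Cmod_conj. Qed.

Lemma Cmod_mult_lt_1 (b z : C) : Cmod b < 1 -> Cmod z < 1 -> Cmod b * Cmod z < 1.
Proof. intros. pose proof (Cmod_ge_0 b). pose proof (Cmod_ge_0 z). nra. Qed.

Lemma psum_le (a b : nat -> R) (n : nat) : (forall k, a k <= b k) -> psum a n <= psum b n.
Proof. intros H. induction n as [|n IH]; simpl; [lra|]. specialize (H n). lra. Qed.

Lemma psum_scal (c : R) (a : nat -> R) (n : nat) : psum (fun k => c * a k) n = c * psum a n.
Proof. induction n as [|n IH]; simpl; [ring|]. rewrite IH. ring. Qed.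

Lemma summable_scal (c : R) (a : nat -> R) :
  0 <= c -> summable a -> summable (fun k => c * a k).
Proof.
  intros Hc [L HL]. exists (c * L). intros n. rewrite psum_scal. now apply Rmult_le_compat_l.
Qed.

Lemma summable_le (a b : nat -> R) : (forall k, a k <= b k) -> summable b -> summable a.
Proof.
  intros H [L HL]. exists L. intros n. eapply Rle_trans; [apply psum_le, H | apply HL].
Qed.

Lemma poisson_ge_0 (b z : C) : Cmod b < 1 -> Cmod z < 1 -> 0 <= poisson b z.
Proof.
  intros Hb Hz. unfold poisson. pose proof (Cmod_mult_lt_1 b z Hb Hz) as H.
  rewrite <- (Cmod_conj_mult b z) in H. pose proof (Cmod_ge_0 (Cconj b * z)%C).
  apply Rdiv_le_0_compat; [nra|]. apply pow_lt, Cmod_gt_0, one_minus_neq_0, H.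
Qed.

(** [u] is the real part of a convergent series of Herglotz kernels. The constant 1 keeps [u]
    strictly positive even if all coefficients vanish, and the two bounds together say that [u] is 1
    plus the supremum of the partial sums. *)
Theorem poisson_sum (c : nat -> R) (b : nat -> C) :
  (forall k, 0 <= c k) -> summable c -> (forall k, Cmod (b k) < 1) ->
  exists u, Har_pos u /\ forall z, Cmod z < 1 ->
    (forall n, 1 + psum (fun k => c k * poisson (b k) z) n <= u z) /\
    (forall B, (forall n, psum (fun k => c k * poisson (b k) z) n <= B) -> u z <= 1 + B).
Proof.
  intros Hc Hs Hb.
  set (F := fix F (n : nat) (z : C) : C := match n with
     | O => RtoC 1
     | S m => (F m z + RtoC (c m) * ((1 + Cconj (b m) * z) / (1 - Cconj (b m) * z)))%C end).
  assert (Hw : forall k z, Cmod z < 1 -> Cmod (Cconj (b k) * z)%C < 1).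
  { intros k z Hz. rewrite Cmod_conj_mult. now apply Cmod_mult_lt_1. }
  assert (HF : forall n, analytic (F n)).
  { intros n. apply analytic_cdiffable. intros z Hz. induction n as [|n IH].
    - apply cdiffable_const.
    - simpl. assert (Dm : cdiffable (fun z => (Cconj (b n) * z)%C) z)
        by (apply cdiffable_mult; [apply cdiffable_const | apply cdiffable_id]).
      apply cdiffable_plus; [exact IH|]. apply cdiffable_mult; [apply cdiffable_const|].
      apply cdiffable_div; [now apply one_minus_neq_0, Hw | |].
      + apply cdiffable_plus; [apply cdiffable_const | exact Dm].
      + apply cdiffable_minus; [apply cdiffable_const | exact Dm]. }
  assert (ReF : forall n z, Cmod z < 1 -> fst (F n z) = 1 + psum (fun k => c k * poisson (b k) z) n).
  { intros n z Hz. induction n as [|n IH]; [simpl; ring|].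
    change (F (S n) z) with (F n z + RtoC (c n) * ((1 + Cconj (b n) * z) / (1 - Cconj (b n) * z)))%C.
    change (fst (F n z + RtoC (c n) * ((1 + Cconj (b n) * z) / (1 - Cconj (b n) * z)))%C)
      with (fst (F n z) + (c n * fst ((1 + Cconj (b n) * z) / (1 - Cconj (b n) * z))%C
              - 0 * snd ((1 + Cconj (b n) * z) / (1 - Cconj (b n) * z))%C)).
    rewrite IH, re_herglotz by (now apply one_minus_neq_0, Hw).
    simpl psum. unfold poisson. ring. }
  destruct (analytic_limit F HF) as [G [HG Hlim]].
  { intros r Hr. exists (fun n => (2 / (1 - r)) * c n).
    assert (0 <= 2 / (1 - r)) by (apply Rdiv_le_0_compat; lra).
    split; [now apply summable_scal|]. split; [intros; now apply Rmult_le_pos|].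
    intros n z Hz. simpl.
    replace (F n z + RtoC (c n) * ((1 + Cconj (b n) * z) / (1 - Cconj (b n) * z)) - F n z)%C
      with (RtoC (c n) * ((1 + Cconj (b n) * z) / (1 - Cconj (b n) * z)))%C by ring.
    pose proof (Hw n z ltac:(lra)) as H1.
    assert (H2 : Cmod (Cconj (b n) * z)%C <= r).
    { rewrite Cmod_conj_mult. pose proof (Cmod_ge_0 (b n)). pose proof (Cmod_ge_0 z). specialize (Hb n). nra. }
    set (w := (Cconj (b n) * z)%C) in *.
    rewrite Cmod_mult, Cmod_R, Rabs_pos_eq, Rmult_comm by apply Hc.
    apply Rmult_le_compat_r; [apply Hc|].
    rewrite Cmod_div by (now apply one_minus_neq_0).
    pose proof (Cmod_triangle_rev 1 w). pose proof (Cmod_triangle 1 w). rewrite Cmod_1 in *.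
    apply Rmult_le_compat; [apply Cmod_ge_0 | | lra |].
    - left. apply Rinv_0_lt_compat. lra.
    - apply Rinv_le_contravar; lra. }
  exists (fun z => fst (G z)).
  assert (Hlb : forall z, Cmod z < 1 -> forall n, 1 + psum (fun k => c k * poisson (b k) z) n <= fst (G z)).
  { intros z Hz n. apply le_epsilon. intros eps He.
    destruct (Hlim z Hz eps He) as [N HN].
    set (m := (n + N)%nat). specialize (HN m ltac:(unfold m; lia)).
    assert (psum (fun k => c k * poisson (b k) z) n <= psum (fun k => c k * poisson (b k) z) m).
    { apply psum_mono; [|unfold m; lia]. intros k. apply Rmult_le_pos; [apply Hc | now apply poisson_ge_0]. }
    pose proof (re_le_Cmod (F m z - G z)) as T.
    change (Rabs (fst (F m z) - fst (G z)) <= Cmod (F m z - G z)) in T.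
    rewrite ReF in T by exact Hz. apply Rabs_le_between in T. lra. }
  split; [split|].
  - now apply re_analytic_harmonic.
  - intros z Hz. specialize (Hlb z Hz 0%nat). simpl in Hlb. lra.
  - intros z Hz. split; [now apply Hlb|]. intros B HB.
    apply le_epsilon. intros eps He.
    destruct (Hlim z Hz eps He) as [N HN]. specialize (HN N (le_n N)).
    pose proof (re_le_Cmod (F N z - G z)) as T.
    change (Rabs (fst (F N z) - fst (G z)) <= Cmod (F N z - G z)) in T.
    rewrite ReF in T by exact Hz. apply Rabs_le_between in T. specialize (HB N). lra.
Qed.

(** * A slowly growing harmonic function *)

(** The factor normalizes the peak: for |l| < 1 the value at z = l is 1 + |l|^2. *)
Definition pweight (l z : C) : R := (1 - Cmod l ^ 2) * poisson l z.

Lemma one_minus_conj_lb (l z : C) : Cmod l < 1 -> 1 - Cmod z <= Cmod (1 - Cconj l * z)%C.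
Proof.
  intros Hl. pose proof (Cmod_triangle_rev 1 (Cconj l * z)) as T.
  rewrite Cmod_1, Cmod_conj_mult in T. pose proof (Cmod_ge_0 l). pose proof (Cmod_ge_0 z). nra.
Qed.

Lemma one_minus_conj_neq_0 (l z : C) : Cmod l < 1 -> Cmod z < 1 -> (1 - Cconj l * z)%C <> 0.
Proof. intros. apply one_minus_neq_0. rewrite Cmod_conj_mult. now apply Cmod_mult_lt_1. Qed.

Lemma one_minus_conj_sqr (l z : C) :
  Cmod (1 - Cconj l * z)%C ^ 2 = Cmod (z - l)%C ^ 2 + (1 - Cmod l ^ 2) * (1 - Cmod z ^ 2).
Proof. rewrite !Cmod_sqr. destruct l, z. simpl. ring. Qed.

Lemma rho_eq (l z : C) : Cmod l < 1 -> Cmod z < 1 -> rho z l = Cmod (z - l) / Cmod (1 - Cconj l * z).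
Proof. intros. unfold rho. now apply Cmod_div, one_minus_conj_neq_0. Qed.

Lemma rho_ge_0 (l z : C) : 0 <= rho z l.
Proof. apply Cmod_ge_0. Qed.

Lemma one_minus_rho_sqr (l z : C) : Cmod l < 1 -> Cmod z < 1 ->
  1 - rho z l ^ 2 = (1 - Cmod l ^ 2) * (1 - Cmod z ^ 2) / Cmod (1 - Cconj l * z) ^ 2.
Proof.
  intros Hl Hz. rewrite rho_eq by assumption.
  pose proof (one_minus_conj_sqr l z) as E.
  assert (0 < Cmod (1 - Cconj l * z)) by now apply Cmod_gt_0, one_minus_conj_neq_0.
  set (d := Cmod (1 - Cconj l * z)) in *.
  replace ((1 - Cmod l ^ 2) * (1 - Cmod z ^ 2)) with (d ^ 2 - Cmod (z - l) ^ 2) by (rewrite E; ring).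
  field. lra.
Qed.

Lemma rho_le_1 (l z : C) : Cmod l < 1 -> Cmod z < 1 -> rho z l <= 1.
Proof.
  intros Hl Hz. pose proof (one_minus_rho_sqr l z Hl Hz) as E.
  assert (0 <= 1 - rho z l ^ 2).
  { rewrite E. pose proof (Cmod_ge_0 l). pose proof (Cmod_ge_0 z).
    apply Rdiv_le_0_compat; [apply Rmult_le_pos; nra|].
    now apply pow_lt, Cmod_gt_0, one_minus_conj_neq_0. }
  pose proof (rho_ge_0 l z). nra.
Qed.

Lemma pweight_ge_0 (l z : C) : Cmod l < 1 -> Cmod z < 1 -> 0 <= pweight l z.
Proof.
  intros Hl Hz. apply Rmult_le_pos; [|now apply poisson_ge_0].
  pose proof (Cmod_ge_0 l). nra.
Qed.

Lemma rho_le_pweight (l z : C) : Cmod l < 1 -> Cmod z < 1 -> 1 - rho z l ^ 2 <= pweight l z.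
Proof.
  intros Hl Hz. rewrite one_minus_rho_sqr by assumption. unfold pweight, poisson.
  rewrite Cmod_conj_mult. pose proof (Cmod_ge_0 l). pose proof (Cmod_ge_0 z).
  unfold Rdiv. rewrite Rmult_assoc. apply Rmult_le_compat_l; [nra|].
  apply Rmult_le_compat_r.
  - left. apply Rinv_0_lt_compat. now apply pow_lt, Cmod_gt_0, one_minus_conj_neq_0.
  - assert ((Cmod l * Cmod z) ^ 2 <= Cmod z ^ 2); [|lra]. apply pow_incr. nra.
Qed.

(** This explains the square in a_k: squared, the kernel has the denominator of the Poisson kernel,
    and one of its two numerators 1 - |l|^2 is at most 1 - |l z|^2. *)
Lemma kernel_le_pweight (l z : C) : Cmod l < 1 -> Cmod z < 1 ->
  (Cmod (RtoC (1 - Cmod l ^ 2) / (1 - Cconj l * z))) ^ 2 <= pweight l z.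
Proof.
  intros Hl Hz. unfold pweight, poisson.
  rewrite Cmod_div by now apply one_minus_conj_neq_0.
  pose proof (Cmod_ge_0 l). pose proof (Cmod_ge_0 z).
  rewrite Cmod_conj_mult, Cmod_R, Rabs_pos_eq by nra.
  assert (0 < Cmod (1 - Cconj l * z)) by now apply Cmod_gt_0, one_minus_conj_neq_0.
  set (d := Cmod (1 - Cconj l * z)) in *.
  replace (((1 - Cmod l ^ 2) / d) ^ 2) with ((1 - Cmod l ^ 2) * ((1 - Cmod l ^ 2) / d ^ 2)) by (field; lra).
  apply Rmult_le_compat_l; [nra|]. apply Rmult_le_compat_r.
  - left. apply Rinv_0_lt_compat. now apply pow_lt.
  - assert ((Cmod l * Cmod z) ^ 2 <= Cmod l ^ 2); [|lra]. apply pow_incr. nra.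
Qed.

Lemma pweight_le (l z : C) (r : R) : Cmod l < 1 -> Cmod z <= r -> r < 1 ->
  pweight l z <= 2 / (1 - r) ^ 2 * (1 - Cmod l).
Proof.
  intros Hl Hz Hr. unfold pweight, poisson.
  pose proof (one_minus_conj_lb l z Hl) as L.
  pose proof (Cmod_ge_0 l). pose proof (Cmod_ge_0 (Cconj l * z)%C).
  set (d := Cmod (1 - Cconj l * z)) in *.
  assert (H2 : 0 < (1 - r) ^ 2) by (apply pow_lt; lra).
  assert (H3 : (1 - r) ^ 2 <= d ^ 2) by (apply pow_incr; lra).
  replace (2 / (1 - r) ^ 2 * (1 - Cmod l)) with ((2 * (1 - Cmod l)) * (1 / (1 - r) ^ 2)) by (field; lra).
  assert (0 <= poisson l z) by (apply poisson_ge_0; lra). unfold poisson in *. fold d in H1.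
  apply Rmult_le_compat; [nra | exact H1 | nra |].
  apply Rmult_le_compat.
  - pose proof (Cmod_mult_lt_1 l z Hl ltac:(lra)) as K. rewrite <- Cmod_conj_mult in K. nra.
  - left. apply Rinv_0_lt_compat. lra.
  - nra.
  - now apply Rinv_le_contravar.
Qed.

Lemma pweight_le_4 (l z : C) : Cmod l < 1 -> Cmod z < 1 -> pweight l z <= 4.
Proof.
  intros Hl Hz. unfold pweight, poisson.
  pose proof (Cmod_triangle_rev 1 (Cconj l * z)) as L. rewrite Cmod_1, Cmod_conj_mult in *.
  pose proof (Cmod_ge_0 l). pose proof (Cmod_ge_0 z).
  set (d := Cmod (1 - Cconj l * z)) in *.
  set (w := Cmod l * Cmod z) in *.
  assert (Hw : 0 <= w <= Cmod l) by (unfold w; nra).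
  assert (Hd : 0 < d) by lra.
  apply Rle_trans with ((1 - Cmod l ^ 2) * (2 / (1 - Cmod l))).
  - apply Rmult_le_compat_l; [nra|]. apply Rle_div_l; [nra|].
    apply Rle_trans with (2 / (1 - Cmod l) * ((1 - Cmod l) * (1 - w))).
    + replace (2 / (1 - Cmod l) * ((1 - Cmod l) * (1 - w))) with (2 * (1 - w)) by (field; lra). nra.
    + apply Rmult_le_compat_l; [apply Rdiv_le_0_compat; lra|]. nra.
  - replace ((1 - Cmod l ^ 2) * (2 / (1 - Cmod l))) with (2 * (1 + Cmod l)) by (field; lra). lra.
Qed.

Lemma pweight_self (l : C) : Cmod l < 1 -> 1 <= pweight l l.
Proof.
  intros Hl. unfold pweight, poisson. pose proof (Cmod_ge_0 l).
  replace (1 - Cconj l * l)%C with (RtoC (1 - Cmod l ^ 2)).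
  - rewrite Cmod_conj_mult, Cmod_R, Rabs_pos_eq by nra.
    replace (_ * _) with (1 + Cmod l ^ 2) by (field; nra). nra.
  - rewrite RtoC_minus, Cmod2_conj. ring.
Qed.

(* The Cayley transform of [conj b * z] has real part [poisson b z], and
   moves by a bounded hyperbolic distance when [z] does. *)
Lemma poisson_harnack (b l z : C) :
  Cmod b < 1 -> Cmod l < 1 -> Cmod z < 1 -> rho z l < 1 / 2 ->
  poisson b z <= 3 * poisson b l.
Proof.
  intros Hb Hl Hz Hrho.
  pose proof (poisson_ge_0 b z Hb Hz) as HX. pose proof (poisson_ge_0 b l Hb Hl) as HY.
  pose proof (one_minus_conj_neq_0 b z Hb Hz) as nz. pose proof (one_minus_conj_neq_0 b l Hb Hl) as nl.
  assert (Ez : poisson b z = fst ((1 + Cconj b * z) / (1 - Cconj b * z))%C)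
    by (symmetry; now apply re_herglotz).
  assert (El : poisson b l = fst ((1 + Cconj b * l) / (1 - Cconj b * l))%C)
    by (symmetry; now apply re_herglotz).
  assert (HD : Rabs (poisson b z - poisson b l)
     <= 2 * Cmod b * Cmod (z - l) / (Cmod (1 - Cconj b * z) * Cmod (1 - Cconj b * l))).
  { rewrite Ez, El.
    eapply Rle_trans; [apply (re_le_Cmod ((1 + Cconj b * z) / (1 - Cconj b * z) - (1 + Cconj b * l) / (1 - Cconj b * l)))|].
    replace ((1 + Cconj b * z) / (1 - Cconj b * z) - (1 + Cconj b * l) / (1 - Cconj b * l))%C
      with (2 * Cconj b * (z - l) / ((1 - Cconj b * z) * (1 - Cconj b * l)))%C by (field; split; assumption).
    rewrite Cmod_div by (now apply Cmult_neq_0).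
    rewrite !Cmod_mult, Cmod_conj, Cmod_R, Rabs_pos_eq by lra. lra. }
  apply Cmod_gt_0 in nz. apply Cmod_gt_0 in nl.
  (* rho < 1/2 means 4 |z - l|^2 < |1 - conj l z|^2, and [one_minus_conj_sqr] expands the right
     side. *)
  assert (H3 : 3 * Cmod (z - l) ^ 2 <= (1 - Cmod l ^ 2) * (1 - Cmod z ^ 2)).
  { assert (n : 0 < Cmod (1 - Cconj l * z)) by now apply Cmod_gt_0, one_minus_conj_neq_0.
    pose proof (one_minus_conj_sqr l z) as E. rewrite rho_eq in Hrho by assumption.
    apply (Rlt_div_l _ _ _ n) in Hrho. pose proof (Cmod_ge_0 (z - l)). nra. }
  set (X := poisson b z) in *. set (Y := poisson b l) in *.
  assert (EX : X * Cmod (1 - Cconj b * z) ^ 2 = 1 - (Cmod b * Cmod z) ^ 2).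
  { unfold X, poisson. rewrite Cmod_conj_mult. field. lra. }
  assert (EY : Y * Cmod (1 - Cconj b * l) ^ 2 = 1 - (Cmod b * Cmod l) ^ 2).
  { unfold Y, poisson. rewrite Cmod_conj_mult. field. lra. }
  clearbody X Y.
  set (p := Cmod (1 - Cconj b * z)) in *. set (q := Cmod (1 - Cconj b * l)) in *.
  set (d := Cmod (z - l)) in *.
  assert (Hd : 0 <= d) by apply Cmod_ge_0.
  pose proof (Cmod_ge_0 b) as Hb0. pose proof (Cmod_ge_0 l) as Hl0. pose proof (Cmod_ge_0 z) as Hz0.
  set (beta := Cmod b) in *. set (x := Cmod l) in *. set (y := Cmod z) in *.
  clearbody p q d beta x y.
  assert (Hpq : 0 < p * q) by now apply Rmult_lt_0_compat.
  apply Rle_div_r in HD; [|exact Hpq].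
  assert (K1 : (X - Y) ^ 2 * (p * q) ^ 2 <= 4 * d ^ 2).
  { rewrite <- (pow2_abs (X - Y)), <- Rpow_mult_distr.
    apply Rle_trans with ((2 * beta * d) ^ 2).
    - apply pow_incr. split; [apply Rmult_le_pos; [apply Rabs_pos | lra] | exact HD].
    - replace (4 * d ^ 2) with (1 ^ 2 * (2 * d) ^ 2) by ring.
      replace ((2 * beta * d) ^ 2) with (beta ^ 2 * (2 * d) ^ 2) by ring.
      apply Rmult_le_compat_r; [apply pow2_ge_0|]. apply pow_incr. lra. }
  assert (K2 : (1 - x ^ 2) * (1 - y ^ 2) <= X * Y * (p * q) ^ 2).
  { replace (X * Y * (p * q) ^ 2) with ((Y * q ^ 2) * (X * p ^ 2)) by ring. rewrite EX, EY.
    assert ((beta * x) ^ 2 <= x ^ 2) by (apply pow_incr; nra).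
    assert ((beta * y) ^ 2 <= y ^ 2) by (apply pow_incr; nra).
    apply Rmult_le_compat; nra. }
  (* The inequality [K3] is (3X - Y)(X - 3Y) <= 0; for nonnegative X and Y this forces X <= 3Y. *)
  assert (K3 : 3 * (X - Y) ^ 2 <= 4 * (X * Y)).
  { apply Rmult_le_reg_r with ((p * q) ^ 2); [apply pow_lt; exact Hpq|]. lra. }
  nra.
Qed.

(** * Convexity of the exponential *)

Lemma psum_plus (a b : nat -> R) (n : nat) : psum (fun k => a k + b k) n = psum a n + psum b n.
Proof. induction n as [|n IH]; simpl; [ring|]. rewrite IH. ring. Qed.

Lemma psum_S (a : nat -> R) (n : nat) : psum a (S n) = psum a n + a n.
Proof. reflexivity. Qed.

Lemma psum_ext_eq (a b : nat -> R) (n : nat) : (forall k, a k = b k) -> psum a n = psum b n.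
Proof. intros H. induction n as [|n IH]; simpl; [reflexivity|]. now rewrite IH, H. Qed.

Lemma exp_midpoint (a b : R) : exp ((a + b) / 2) <= (exp a + exp b) / 2.
Proof.
  replace a with (a / 2 + a / 2) at 2 by field. replace b with (b / 2 + b / 2) at 2 by field.
  replace ((a + b) / 2) with (a / 2 + b / 2) by field. rewrite !exp_plus.
  pose proof (pow2_ge_0 (exp (a / 2) - exp (b / 2))). nra.
Qed.

(** Jensen's inequality with weights 1/2, 1/4, ... and the remaining mass 2^-m at 0. The exponential
    of a sum becomes a sum of exponentials, at the price of amplifying the j-th term by 2^(j+1). *)
Lemma exp_psum_convex (x : nat -> R) (m : nat) :
  exp (psum x m) <= psum (fun j => / 2 ^ S j * exp (2 ^ S j * x j)) m + / 2 ^ m.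
Proof.
  (* The free value [y] carries the remaining mass, so that one induction step is a single midpoint
     inequality. *)
  assert (G : forall y, exp (psum x m + / 2 ^ m * y)
     <= psum (fun j => / 2 ^ S j * exp (2 ^ S j * x j)) m + / 2 ^ m * exp y).
  { induction m as [|m IH]; intros y.
    - simpl. rewrite Rinv_1, !Rmult_1_l, !Rplus_0_l. lra.
    - assert (Hp : 0 < 2 ^ m) by (apply pow_lt; lra).
      replace (psum x (S m) + / 2 ^ S m * y)
        with (psum x m + / 2 ^ m * ((2 ^ S m * x m + y) / 2)) by (simpl; field; lra).
      eapply Rle_trans; [apply IH|].
      rewrite (psum_S (fun j => / 2 ^ S j * exp (2 ^ S j * x j))). pose proof (exp_midpoint (2 ^ S m * x m) y) as E.
      apply Rmult_le_compat_l with (r := / 2 ^ m) in E; [|left; now apply Rinv_0_lt_compat].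
      replace (/ 2 ^ m * ((exp (2 ^ S m * x m) + exp y) / 2))
        with (/ 2 ^ S m * exp (2 ^ S m * x m) + / 2 ^ S m * exp y) in E by (simpl; field; lra). lra. }
  specialize (G 0). rewrite Rmult_0_r, Rplus_0_r, exp_0, Rmult_1_r in G. exact G.
Qed.

Lemma exp_le (x y : R) : x <= y -> exp x <= exp y.
Proof. intros [h| ->]; [left; now apply exp_increasing | lra]. Qed.

Section SlowWeight.

Variable lam : nat -> C.
Hypothesis Hlam : forall k, Cmod (lam k) < 1.
Hypothesis Hsum : summable (fun k => 1 - Cmod (lam k)).

Lemma gap_ge_0 (k : nat) : 0 <= 1 - Cmod (lam k).
Proof. specialize (Hlam k). lra. Qed.

Lemma gap_small (delta : R) (N : nat) :
  0 < delta -> exists n, (N <= n)%nat /\ 1 - Cmod (lam n) <= delta.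
Proof.
  intros Hd. destruct (summable_tail _ gap_ge_0 Hsum) as [L [HL Ht]].
  destruct (Ht delta Hd) as [M HM]. exists (N + M)%nat. split; [lia|].
  specialize (HM (N + M)%nat ltac:(lia)). specialize (HL (S (N + M))). simpl in HL. lra.
Qed.

Lemma gap_lb (N : nat) : exists m, 0 < m /\ forall k, (k < N)%nat -> m <= 1 - Cmod (lam k).
Proof.
  induction N as [|N [m [Hm IH]]]; [exists 1; split; [lra | lia]|].
  exists (Rmin m (1 - Cmod (lam N))). split.
  - apply Rmin_pos; [exact Hm|]. specialize (Hlam N). lra.
  - intros k Hk. destruct (Nat.eq_dec k N) as [->|n]; [apply Rmin_r|].
    eapply Rle_trans; [apply Rmin_l | apply IH; lia].
Qed.

Lemma psum_cut (a : nat -> R) (N K : nat) :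
  psum (fun k => if lt_dec k N then 0 else a k) K = psum a (Nat.max K N) - psum a N.
Proof.
  induction K as [|K IH]; [simpl; lra|]. simpl psum at 1. rewrite IH.
  destruct (lt_dec K N).
  - rewrite !Nat.max_r by lia. lra.
  - rewrite !Nat.max_l by lia. simpl. lra.
Qed.

(* Dominated convergence: [pweight (lam n)] is bounded and tends to [0] pointwise. *)
Lemma exp_pweight_psum : exists C0, forall (A delta : R) (N0 : nat), 0 <= A -> 0 < delta ->
  exists n, (N0 <= n)%nat /\ 1 - Cmod (lam n) <= delta /\
    forall K, psum (fun k => (1 - Cmod (lam k)) * exp (A * pweight (lam n) (lam k))) K <= C0.
Proof.
  destruct (summable_tail _ gap_ge_0 Hsum) as [L [HL Ht]].
  (* The bound must not depend on [A]: indices below [N] contribute at most a factor e, and the tail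
     contributes at most 1. *)
  exists (exp 1 * L + 1). intros A delta N0 HA Hd.
  (* [pweight] is at most 4, so the exponential is at most exp(4A) on the tail; the tail of the gaps
     is made smaller than its inverse. *)
  destruct (Ht (exp (- (4 * A))) (exp_pos _)) as [N HN].
  destruct (gap_lb N) as [m [Hm Hlb]].
  (* With a gap this small at lam_n, [pweight_le] gives [A * pweight (lam n) (lam k)] <= A/(A + 1)
     <= 1 for all k < N, these points being at distance at least [m] from the unit circle. *)
  assert (Hdm : 0 < m ^ 2 / (2 * (A + 1))).
  { apply Rdiv_lt_0_compat; [now apply pow_lt | lra]. }
  destruct (gap_small (Rmin delta (m ^ 2 / (2 * (A + 1)))) N0) as [n [Hn Hg]].
  { now apply Rmin_pos. }
  pose proof (Rmin_l delta (m ^ 2 / (2 * (A + 1)))). pose proof (Rmin_r delta (m ^ 2 / (2 * (A + 1)))).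
  exists n. split; [exact Hn|]. split; [lra|]. intros K.
  apply Rle_trans with (psum (fun k => exp 1 * (1 - Cmod (lam k))
     + exp (4 * A) * (if lt_dec k N then 0 else 1 - Cmod (lam k))) K).
  - apply psum_le. intros k. pose proof (gap_ge_0 k) as Hk.
    pose proof (exp_pos 1) as E1. pose proof (exp_pos (4 * A)) as E4.
    destruct (lt_dec k N) as [l|g].
    + rewrite Rmult_0_r, Rplus_0_r, Rmult_comm. apply Rmult_le_compat_r; [exact Hk|]. apply exp_le.
      specialize (Hlb k l).
      pose proof (pweight_le (lam n) (lam k) (1 - m) (Hlam n) ltac:(lra) ltac:(lra)) as P.
      replace (1 - (1 - m)) with m in P by ring.
      apply Rle_trans with (A * (2 / m ^ 2 * (m ^ 2 / (2 * (A + 1))))).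
      * apply Rmult_le_compat_l; [exact HA|]. eapply Rle_trans; [exact P|].
        apply Rmult_le_compat_l; [|lra]. apply Rdiv_le_0_compat; [lra | now apply pow_lt].
      * replace (2 / m ^ 2 * (m ^ 2 / (2 * (A + 1)))) with (/ (A + 1)) by (field; lra).
        apply Rle_div_l; lra.
    + pose proof (pweight_le_4 (lam n) (lam k) (Hlam n) (Hlam k)).
      assert (exp (A * pweight (lam n) (lam k)) <= exp (4 * A)) by (apply exp_le; nra). nra.
  - rewrite psum_plus, !psum_scal, psum_cut.
    pose proof (HL K) as L1. pose proof (HL (Nat.max K N)) as L2. specialize (HN N (le_n N)).
    pose proof (exp_pos 1) as E1. pose proof (exp_pos (4 * A)) as E4.
    assert (EE : exp (4 * A) * exp (- (4 * A)) = 1) by (rewrite <- exp_plus, Rplus_opp_r; apply exp_0).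
    apply Rplus_le_compat; [nra|].
    apply Rle_trans with (exp (4 * A) * exp (- (4 * A))); [apply Rmult_le_compat_l; lra | lra].
Qed.

Lemma psum_inv_pow2 (m : nat) : psum (fun j => / 2 ^ S j) m = 1 - / 2 ^ m.
Proof.
  induction m as [|m IH]; [simpl; field|]. rewrite psum_S, IH. simpl. field.
  apply pow_nonzero. lra.
Qed.

(** The j-th peak, of height at least j, sits at [lam (nn j)]. As [C0] does not depend on the
    amplification, the dyadic average of the amplified peaks is bounded by [C0] however many peaks
    are taken. *)
Theorem slow_weight : exists H, Har_pos H /\
  (forall M N, exists n, (N <= n)%nat /\ M < H (lam n)) /\
  (forall z, Cmod z < 1 -> 1 <= H z) /\
  (forall l z, Cmod l < 1 -> Cmod z < 1 -> rho z l < 1 / 2 -> H z <= 3 * H l) /\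
  summable (fun k => (1 - Cmod (lam k)) * exp (H (lam k))).
Proof.
  destruct exp_pweight_psum as [C0 HC0].
  assert (Hp2 : forall j, 0 < 2 ^ j) by (intros; apply pow_lt; lra).
  (* The height j of the peak times the amplification 2^(j+1) from [exp_psum_convex]. *)
  assert (HA : forall j, 0 <= 2 ^ S j * INR j).
  { intros j. apply Rmult_le_pos; [left; apply Hp2 | apply pos_INR]. }
  (* A gap of this size makes the coefficient [c j] at most 2 * 2^-(j+1), so the sum of the kernels
     converges. *)
  assert (Hd : forall j, 0 < / (2 ^ S j * (INR j + 1))).
  { intros j. apply Rinv_0_lt_compat, Rmult_lt_0_compat; [apply Hp2|]. pose proof (pos_INR j). lra. }
  set (nn := fun j => proj1_sig (constructive_indefinite_description _ (HC0 _ _ j (HA j) (Hd j)))).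
  assert (Hnn : forall j, (j <= nn j)%nat /\ 1 - Cmod (lam (nn j)) <= / (2 ^ S j * (INR j + 1)) /\
    forall K, psum (fun k => (1 - Cmod (lam k)) * exp (2 ^ S j * INR j * pweight (lam (nn j)) (lam k))) K <= C0).
  { intros j. exact (proj2_sig (constructive_indefinite_description _ (HC0 _ _ j (HA j) (Hd j)))). }
  clearbody nn.
  set (c := fun j => INR j * (1 - Cmod (lam (nn j)) ^ 2)).
  assert (Hc : forall j, 0 <= c j).
  { intros j. apply Rmult_le_pos; [apply pos_INR|]. pose proof (Cmod_ge_0 (lam (nn j))).
    specialize (Hlam (nn j)). nra. }
  destruct (poisson_sum c (fun j => lam (nn j)) Hc) as [H [HH HB]].
  { exists 2. intros n. apply Rle_trans with (psum (fun j => 2 * / 2 ^ S j) n).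
    - apply psum_le. intros j. unfold c. destruct (Hnn j) as [_ [Hg _]].
      pose proof (pos_INR j) as Hj. pose proof (Cmod_ge_0 (lam (nn j))). pose proof (Hlam (nn j)).
      rewrite Rinv_mult in Hg.
      assert (0 < / 2 ^ S j) by now apply Rinv_0_lt_compat.
      apply Rle_trans with (INR j * (2 * (/ 2 ^ S j * / (INR j + 1)))).
      + apply Rmult_le_compat_l; [exact Hj | nra].
      + replace (INR j * (2 * (/ 2 ^ S j * / (INR j + 1)))) with ((2 * / 2 ^ S j) * (INR j / (INR j + 1)))
          by (field; split; [lra | apply Rgt_not_eq, Hp2]).
        assert (INR j / (INR j + 1) <= 1) by (apply Rle_div_l; lra). nra.
    - rewrite psum_scal, psum_inv_pow2. assert (0 < / 2 ^ n) by (apply Rinv_0_lt_compat, Hp2). lra. }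
  { intros; apply Hlam. }
  assert (Hterm : forall j z, c j * poisson (lam (nn j)) z = INR j * pweight (lam (nn j)) z).
  { intros. unfold c, pweight. ring. }
  exists H. split; [exact HH|]. split; [|split; [|split]].
  - intros M N. destruct (INR_unbounded (Rmax M 0)) as [j0 Hj0].
    set (j := (N + j0)%nat).
    destruct (Hnn j) as [Hj _]. exists (nn j). split; [unfold j in *; lia|].
    destruct (HB (lam (nn j)) (Hlam _)) as [Hlb _]. specialize (Hlb (S j)). simpl in Hlb.
    rewrite Hterm in Hlb.
    assert (0 <= psum (fun k => c k * poisson (lam (nn k)) (lam (nn j))) j).
    { change 0 with (psum (fun k => c k * poisson (lam (nn k)) (lam (nn j))) 0).
      apply psum_mono; [|lia]. intros k. apply Rmult_le_pos; [apply Hc | apply poisson_ge_0; apply Hlam]. }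
    pose proof (pweight_self (lam (nn j)) (Hlam _)).
    assert (INR j0 <= INR j) by (apply le_INR; unfold j; lia).
    pose proof (Rmax_l M 0). pose proof (pos_INR j). nra.
  - intros z Hz. destruct (HB z Hz) as [Hlb _]. specialize (Hlb 0%nat). simpl in Hlb. lra.
  - intros l z Hl Hz Hrho. destruct (HB z Hz) as [_ Hub]. destruct (HB l Hl) as [Hlb _].
    (* [H] is 1 plus the supremum of its partial sums, so Harnack's inequality for each kernel
       passes to [H - 1]. *)
    apply Rle_trans with (1 + 3 * (H l - 1)).
    + apply Hub. intros n. specialize (Hlb n).
      apply Rle_trans with (3 * psum (fun k => c k * poisson (lam (nn k)) l) n); [|lra].
      rewrite <- psum_scal. apply psum_le. intros k.
      pose proof (poisson_harnack (lam (nn k)) l z (Hlam _) Hl Hz Hrho). specialize (Hc k). nra.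
    + lra.
  - destruct Hsum as [L HL].
    (* Only finitely many points enter a partial sum, so a single truncation of the series for [H]
       serves them all; the constant 2 in place of 1 leaves room for the truncation. *)
    assert (Hm : forall K, exists m, forall k, (k < K)%nat ->
       H (lam k) <= 2 + psum (fun j => INR j * pweight (lam (nn j)) (lam k)) m).
    { assert (Hmono : forall k m m', (m <= m')%nat ->
         psum (fun j => INR j * pweight (lam (nn j)) (lam k)) m
         <= psum (fun j => INR j * pweight (lam (nn j)) (lam k)) m').
      { intros k m m' h. apply psum_mono; [|exact h]. intros j.
        apply Rmult_le_pos; [apply pos_INR | apply pweight_ge_0; apply Hlam]. }
      induction K as [|K [m IH]]; [exists 0%nat; lia|].
      assert (Hm1 : exists m1, H (lam K) <= 2 + psum (fun j => INR j * pweight (lam (nn j)) (lam K)) m1).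
      { apply NNPP. intros Hno. destruct (HB (lam K) (Hlam K)) as [_ Hub].
        assert (H (lam K) <= 1 + (H (lam K) - 2)); [|lra]. apply Hub. intros n.
        apply Rnot_lt_le. intros h. apply Hno. exists n.
        rewrite <- (psum_ext_eq _ _ n (fun j => Hterm j (lam K))). lra. }
      destruct Hm1 as [m1 Hm1]. exists (Nat.max m m1). intros k Hk.
      destruct (Nat.eq_dec k K) as [->|n].
      - pose proof (Hmono K m1 (Nat.max m m1) ltac:(lia)). lra.
      - pose proof (Hmono k m (Nat.max m m1) ltac:(lia)). specialize (IH k ltac:(lia)). lra. }
    exists (exp 2 * (C0 + L)). intros K. destruct (Hm K) as [m Hk].
    set (g := fun k => psum (fun j => / 2 ^ S j * exp (2 ^ S j * INR j * pweight (lam (nn j)) (lam k))) m).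
    apply Rle_trans with (psum (fun k => exp 2 * ((1 - Cmod (lam k)) * g k + (1 - Cmod (lam k)))) K).
    + assert (Hcmp : forall n, (n <= K)%nat -> psum (fun k => (1 - Cmod (lam k)) * exp (H (lam k))) n
         <= psum (fun k => exp 2 * ((1 - Cmod (lam k)) * g k + (1 - Cmod (lam k)))) n);
        [|now apply Hcmp].
      induction n as [|n IH]; intros hn; [simpl; lra|]. simpl. apply Rplus_le_compat; [apply IH; lia|].
      specialize (Hk n ltac:(lia)). pose proof (gap_ge_0 n) as Hg.
      assert (E : exp (H (lam n)) <= exp 2 * (g n + 1)).
      { eapply Rle_trans; [apply exp_le, Hk|]. rewrite exp_plus.
        apply Rmult_le_compat_l; [left; apply exp_pos|].
        eapply Rle_trans; [apply exp_psum_convex|].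
        apply Rplus_le_compat.
        - apply Req_le, psum_ext_eq. intros j. do 2 f_equal. ring.
        - rewrite <- Rinv_1. apply Rinv_le_contravar; [lra|]. apply pow_R1_Rle. lra. }
      replace (exp 2 * ((1 - Cmod (lam n)) * g n + (1 - Cmod (lam n))))
        with ((1 - Cmod (lam n)) * (exp 2 * (g n + 1))) by ring.
      now apply Rmult_le_compat_l.
    + rewrite psum_scal, psum_plus. apply Rmult_le_compat_l; [left; apply exp_pos|].
      apply Rplus_le_compat; [|apply HL].
      assert (C0pos : 0 <= C0).
      { destruct (Hnn 0%nat) as [_ [_ h]]. specialize (h 0%nat). exact h. }
      (* The factor 1 - 2^-m is the total of the dyadic weights; keeping it exact makes the
         induction on [m] close. *)
      apply Rle_trans with ((1 - / 2 ^ m) * C0).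
      * unfold g. clear g Hk. induction m as [|m IH].
        -- simpl. rewrite Rinv_1, Rminus_diag, Rmult_0_l.
           rewrite (psum_ext_eq _ (fun k => 0 * 0)) by (intros; simpl; ring). rewrite psum_scal. lra.
        -- rewrite (psum_ext_eq _ (fun k => (1 - Cmod (lam k)) *
               psum (fun j => / 2 ^ S j * exp (2 ^ S j * INR j * pweight (lam (nn j)) (lam k))) m
             + / 2 ^ S m * ((1 - Cmod (lam k)) * exp (2 ^ S m * INR m * pweight (lam (nn m)) (lam k)))))
             by (intros; rewrite psum_S; ring).
           rewrite psum_plus, psum_scal. destruct (Hnn m) as [_ [_ h]]. specialize (h K).
           assert (Hi : 0 < / 2 ^ S m) by now apply Rinv_0_lt_compat.
           apply Rmult_le_compat_l with (r := / 2 ^ S m) in h; [|lra].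
           replace (1 - / 2 ^ S m) with (1 - / 2 ^ m + / 2 ^ S m); [lra|].
           simpl. field. apply Rgt_not_eq, Hp2.
      * assert (0 < / 2 ^ m) by now apply Rinv_0_lt_compat. nra.
Qed.

End SlowWeight.

(** * Blaschke factors and limits *)

Lemma rho_lt_1 (l z : C) : Cmod l < 1 -> Cmod z < 1 -> rho z l < 1.
Proof.
  intros Hl Hz. pose proof (one_minus_rho_sqr l z Hl Hz) as E.
  assert (0 < 1 - rho z l ^ 2).
  { rewrite E. pose proof (Cmod_ge_0 l). pose proof (Cmod_ge_0 z).
    apply Rdiv_lt_0_compat; [apply Rmult_lt_0_compat; nra|].
    now apply pow_lt, Cmod_gt_0, one_minus_conj_neq_0. }
  pose proof (rho_ge_0 l z). nra.
Qed.

Definition moebius (l z : C) : C := ((l - z) / (1 - Cconj l * z))%C.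

Lemma Cmod_moebius (l z : C) : Cmod l < 1 -> Cmod z < 1 -> Cmod (moebius l z) = rho z l.
Proof.
  intros Hl Hz. unfold moebius. rewrite rho_eq, Cmod_div by (trivial; now apply one_minus_conj_neq_0).
  now rewrite Cmod_minus_sym.
Qed.

Lemma Cmod_moebius_lt_1 (l z : C) : Cmod l < 1 -> Cmod z < 1 -> Cmod (moebius l z) < 1.
Proof. intros. rewrite Cmod_moebius by assumption. now apply rho_lt_1. Qed.

Lemma moebius_involutive (l z : C) : Cmod l < 1 -> Cmod z < 1 -> moebius l (moebius l z) = z.
Proof.
  intros Hl Hz.
  pose proof (one_minus_conj_neq_0 l z Hl Hz) as n1.
  pose proof (one_minus_conj_neq_0 l l Hl Hl) as n2.
  pose proof (one_minus_conj_neq_0 l _ Hl (Cmod_moebius_lt_1 l z Hl Hz)) as n3.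
  unfold moebius in *. field. split; [exact n1|].
  replace (1 - Cconj l * z - Cconj l * (l - z))%C with (1 - Cconj l * l)%C by ring. exact n2.
Qed.

Lemma analytic_moebius (l : C) : Cmod l < 1 -> analytic (moebius l).
Proof.
  intros Hl. apply analytic_cdiffable. intros z Hz.
  apply cdiffable_div; [now apply one_minus_conj_neq_0 | |];
    (apply cdiffable_minus; [apply cdiffable_const|]).
  - apply cdiffable_id.
  - apply cdiffable_mult; [apply cdiffable_const | apply cdiffable_id].
Qed.

Lemma schwarz_bound (f : C -> C) (l z : C) :
  analytic f -> (forall z, Cmod z < 1 -> Cmod (f z) <= 1) ->
  Cmod l < 1 -> Cmod z < 1 -> Cmod (f z - f l) <= 4 * rho z l.
Proof.
  intros Hf Hb Hl Hz.
  pose proof (schwarz_bound_0 (fun w => f (moebius l w))) as S.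
  replace (f z) with (f (moebius l (moebius l z))) by (now rewrite moebius_involutive).
  replace (f l) with (f (moebius l 0)).
  2: { f_equal. unfold moebius. field. }
  rewrite <- Cmod_moebius by assumption.
  apply S.
  - apply analytic_cdiffable. intros w Hw. apply cdiffable_comp.
    + apply (proj1 (analytic_cdiffable f) Hf). now apply Cmod_moebius_lt_1.
    + now apply (proj1 (analytic_cdiffable _) (analytic_moebius l Hl)).
  - intros w Hw. now apply Hb, Cmod_moebius_lt_1.
  - now apply Cmod_moebius_lt_1.
Qed.

Lemma Cmod_neq_0 (a : C) : a <> 0 -> RtoC (Cmod a) <> 0.
Proof. intros n. apply RtoC_neq_0. apply Cmod_gt_0 in n. lra. Qed.

Lemma Cmod_blaschke_factor (a z : C) :
  Cmod a < 1 -> Cmod z < 1 -> Cmod (blaschke_factor a z) = rho z a.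
Proof.
  intros Ha Hz. unfold blaschke_factor. destruct (Ceq_dec a 0) as [->|n].
  - unfold rho. f_equal. replace (Cconj 0) with (RtoC 0) by (apply injective_projections; simpl; ring). field.
  - rewrite Cmod_mult. fold (moebius a z). rewrite Cmod_moebius by assumption.
    rewrite Cmod_div, Cmod_R, Rabs_pos_eq by (trivial; apply Cmod_ge_0).
    apply Cmod_gt_0 in n. field. lra.
Qed.

Lemma blaschke_divide (f : C -> C) (a : C) :
  analytic f -> Cmod a < 1 -> f a = 0 ->
  exists s, analytic s /\ forall z, Cmod z < 1 -> f z = (blaschke_factor a z * s z)%C.
Proof.
  intros Hf Ha H0. destruct (analytic_quotient f a Hf Ha) as [q [Hq E]].
  unfold blaschke_factor. destruct (Ceq_dec a 0) as [e|n].
  - exists q. split; [exact Hq|]. intros z _. rewrite (E z), H0, e. ring.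
  - pose proof (Cmod_neq_0 a n) as n'.
    exists (fun z => (q z * (- (a / RtoC (Cmod a)) * (1 - Cconj a * z)))%C). split.
    + apply analytic_cdiffable. intros z Hz. apply cdiffable_mult; [now apply (proj1 (analytic_cdiffable q))|].
      apply cdiffable_mult; [apply cdiffable_const|]. apply cdiffable_minus; [apply cdiffable_const|].
      apply cdiffable_mult; [apply cdiffable_const | apply cdiffable_id].
    + intros z Hz. rewrite (E z), H0. field. repeat split; trivial. now apply one_minus_conj_neq_0.
Qed.

(** The unimodular normalization gives 1 - b_a(z) = (1 - |a|)(a + |a| z) / (a (1 - conj a z)), a
    quantity of the order of 1 - |a|, hence summable over the zeros. *)
Lemma one_minus_blaschke_factor (a z : C) (r : R) :
  a <> 0 -> Cmod a < 1 -> Cmod z <= r -> r < 1 ->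
  Cmod (1 - blaschke_factor a z) <= 2 * (1 - Cmod a) / (1 - r).
Proof.
  intros n Ha Hz Hr. unfold blaschke_factor. destruct (Ceq_dec a 0) as [e|_]; [contradiction|].
  pose proof (Cmod_neq_0 a n) as n'. pose proof (one_minus_conj_neq_0 a z Ha ltac:(lra)) as nd.
  pose proof (one_minus_conj_lb a z Ha) as L.
  replace (1 - RtoC (Cmod a) / a * ((a - z) / (1 - Cconj a * z)))%C
    with (RtoC (1 - Cmod a) * ((a + RtoC (Cmod a) * z) / a) / (1 - Cconj a * z))%C.
  - rewrite Cmod_div by exact nd. rewrite Cmod_mult, Cmod_R, Rabs_pos_eq, Cmod_div by (trivial; lra).
    assert (Ha0 : 0 < Cmod a) by now apply Cmod_gt_0.
    assert (U : Cmod (a + RtoC (Cmod a) * z) / Cmod a <= 2).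
    { apply Rle_div_l; [exact Ha0|]. eapply Rle_trans; [apply Cmod_triangle|].
      rewrite Cmod_mult, Cmod_R, Rabs_pos_eq by lra. pose proof (Cmod_ge_0 z). nra. }
    assert (0 <= Cmod (a + RtoC (Cmod a) * z) / Cmod a) by (apply Rdiv_le_0_compat; [apply Cmod_ge_0 | exact Ha0]).
    apply Rmult_le_compat.
    + apply Rmult_le_pos; lra.
    + left. apply Rinv_0_lt_compat. lra.
    + nra.
    + apply Rinv_le_contravar; lra.
  - rewrite RtoC_minus.
    assert (E2 : (a * Cconj a)%C = (RtoC (Cmod a) * RtoC (Cmod a))%C).
    { rewrite <- Cmod2_conj, <- RtoC_mult. f_equal. ring. }
    assert (K : (a * (1 - Cconj a * z) - RtoC (Cmod a) * (a - z)
      = (1 - RtoC (Cmod a)) * (a + RtoC (Cmod a) * z))%C) by ring [E2].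
    transitivity ((1 - RtoC (Cmod a)) * (a + RtoC (Cmod a) * z) / (a * (1 - Cconj a * z)))%C;
      [field; split; assumption|].
    rewrite <- K. field. split; assumption.
Qed.

Lemma clim_le (u : nat -> C) (l : C) (B : R) :
  clim u l -> (forall n, Cmod (u n) <= B) -> Cmod l <= B.
Proof.
  intros Hu HB. apply le_epsilon. intros eps He. destruct (Hu eps He) as [N HN].
  specialize (HN N (le_n N)). rewrite Cmod_minus_sym in HN.
  pose proof (Cmod_triangle_rev l (u N)). specialize (HB N). lra.
Qed.

Lemma clim_ge (u : nat -> C) (l : C) (B : R) :
  clim u l -> (forall n, B <= Cmod (u n)) -> B <= Cmod l.
Proof.
  intros Hu HB. apply le_epsilon. intros eps He. destruct (Hu eps He) as [N HN].
  specialize (HN N (le_n N)).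
  pose proof (Cmod_triangle_rev (u N) l). specialize (HB N). lra.
Qed.

Lemma clim_unique (u : nat -> C) (l m : C) : clim u l -> clim u m -> l = m.
Proof.
  intros Hl Hm. apply Cmod_sub_eq_0, Rle_antisym; [|apply Cmod_ge_0].
  apply le_epsilon. intros eps He. rewrite Rplus_0_l.
  destruct (Hl (eps / 2) ltac:(lra)) as [N1 H1]. destruct (Hm (eps / 2) ltac:(lra)) as [N2 H2].
  specialize (H1 (N1 + N2)%nat ltac:(lia)). specialize (H2 (N1 + N2)%nat ltac:(lia)).
  pose proof (Cmod_dist_triangle l (u (N1 + N2)%nat) m).
  rewrite (Cmod_minus_sym l (u (N1 + N2)%nat)) in *. lra.
Qed.

Lemma clim_const (c : C) : clim (fun _ => c) c.
Proof. intros eps He. exists 0%nat. intros. now rewrite Cmod_minus_diag. Qed.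

Lemma clim_minus (u v : nat -> C) (l m : C) :
  clim u l -> clim v m -> clim (fun n => (u n - v n)%C) (l - m)%C.
Proof.
  intros Hu Hv eps He.
  destruct (Hu (eps / 2) ltac:(lra)) as [N1 H1]. destruct (Hv (eps / 2) ltac:(lra)) as [N2 H2].
  exists (N1 + N2)%nat. intros n Hn. specialize (H1 n ltac:(lia)). specialize (H2 n ltac:(lia)).
  replace (u n - v n - (l - m))%C with ((u n - l) - (v n - m))%C by ring.
  eapply Rle_lt_trans; [apply Cmod_triangle_minus|]. lra.
Qed.

Lemma clim_mult (u v : nat -> C) (l m : C) :
  clim u l -> clim v m -> clim (fun n => (u n * v n)%C) (l * m)%C.
Proof.
  intros Hu Hv eps He.
  pose proof (Cmod_ge_0 l) as Hl0. pose proof (Cmod_ge_0 m) as Hm0.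
  set (e := Rmin 1 (eps / (2 * (Cmod l + Cmod m + 1)))).
  assert (e0 : 0 < e) by (apply Rmin_pos; [lra | apply Rdiv_lt_0_compat; lra]).
  assert (e1 : e <= 1) by apply Rmin_l.
  assert (e2 : e * (2 * (Cmod l + Cmod m + 1)) <= eps).
  { apply Rle_div_r; [lra | apply Rmin_r]. }
  destruct (Hu e e0) as [N1 H1]. destruct (Hv e e0) as [N2 H2].
  exists (N1 + N2)%nat. intros n Hn. specialize (H1 n ltac:(lia)). specialize (H2 n ltac:(lia)).
  replace (u n * v n - l * m)%C with ((u n - l) * (v n - m) + ((u n - l) * m + l * (v n - m)))%C by ring.
  eapply Rle_lt_trans; [apply Cmod_triangle|].
  eapply Rle_lt_trans; [apply Rplus_le_compat_l, Cmod_triangle|]. rewrite !Cmod_mult.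
  pose proof (Cmod_ge_0 (u n - l)). pose proof (Cmod_ge_0 (v n - m)). nra.
Qed.

Lemma clim_ext (u v : nat -> C) (l : C) : (forall n, u n = v n) -> clim u l -> clim v l.
Proof. intros E H eps He. destruct (H eps He) as [N HN]. exists N. intros n Hn. rewrite <- E. now apply HN. Qed.

Lemma filterlim_clim (u : nat -> C) (l : C) :
  filterlim u eventually (locally l) -> clim u l.
Proof.
  intros H eps He.
  assert (Hl : locally l (fun w : C_UniformSpace => Cmod (w - l) < eps)).
  { apply (locally_C l (fun w => Cmod (w - l) < eps)). exists (mkposreal eps He). intros w Hw. exact Hw. }
  destruct (H _ Hl) as [N HN]. exists N. exact HN.
Qed.

Lemma sum_n_psum (a : nat -> R) (n : nat) : sum_n a n = psum a (S n).
Proof.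
  induction n as [|n IH].
  - rewrite sum_O. simpl. ring.
  - rewrite sum_Sn, IH. reflexivity.
Qed.

Lemma ex_series_summable (a : nat -> R) : (forall n, 0 <= a n) -> ex_series a -> summable a.
Proof.
  intros Ha [L HL]. exists L. intros n.
  apply Rle_trans with (psum a (S n)); [apply psum_mono; [exact Ha | lia]|].
  rewrite <- sum_n_psum.
  apply (is_lim_seq_incr_compare (sum_n a)); [exact HL|].
  intros k. rewrite sum_Sn. unfold plus; simpl. specialize (Ha (S k)). lra.
Qed.

Lemma weight_majorant (lam : nat -> C) (E : nat -> R) (kappa : R) :
  (forall k, Cmod (lam k) < 1) -> (forall k, 0 <= E k) -> 0 <= kappa ->
  summable (fun k => (1 - Cmod (lam k)) * E k) ->
  exists u, Har_pos u /\
    forall z, Cmod z < 1 -> forall n, kappa * psum (fun k => E k * pweight (lam k) z) n <= u z.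
Proof.
  intros Hlam HE Hk Hs.
  destruct (poisson_sum (fun k => kappa * (E k * (1 - Cmod (lam k) ^ 2))) lam) as [u [Hu Hb]].
  - intros k. apply Rmult_le_pos; [exact Hk|]. apply Rmult_le_pos; [apply HE|].
    pose proof (Cmod_ge_0 (lam k)). specialize (Hlam k). nra.
  - apply summable_le with (fun k => kappa * 2 * ((1 - Cmod (lam k)) * E k)).
    + intros k. pose proof (Cmod_ge_0 (lam k)). specialize (Hlam k). specialize (HE k).
      rewrite Rmult_assoc. apply Rmult_le_compat_l; [exact Hk|].
      replace (2 * ((1 - Cmod (lam k)) * E k)) with (E k * (2 * (1 - Cmod (lam k)))) by ring.
      apply Rmult_le_compat_l; nra.
    + apply summable_scal; [lra | exact Hs].
  - exact Hlam.
  - exists u. split; [exact Hu|]. intros z Hz n. destruct (Hb z Hz) as [Hlb _]. specialize (Hlb n).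
    rewrite <- psum_scal. rewrite (psum_ext_eq _ (fun k => kappa * (E k * (1 - Cmod (lam k) ^ 2)) * poisson (lam k) z)).
    + lra.
    + intros k. unfold pweight. ring.
Qed.

(** 1 - rho <= 1 - rho^2 <= p <= 2 rho p for p = [pweight l z]; then divide by rho. *)
Lemma inv_rho_le (l z : C) : Cmod l < 1 -> Cmod z < 1 -> 1 / 2 <= rho z l ->
  / rho z l <= 1 + 2 * pweight l z.
Proof.
  intros Hl Hz Hr. pose proof (rho_le_pweight l z Hl Hz). pose proof (rho_le_1 l z Hl Hz).
  apply Rmult_le_reg_r with (rho z l); [lra|]. rewrite Rinv_l by lra. nra.
Qed.

(** * Majorizing -log|B| and solving the Bezout equation *)

Section Main.

Variables (lam : nat -> C) (B : C -> C) (H : C -> R).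
Hypothesis Hlam : forall k, Cmod (lam k) < 1.
Hypothesis HB : forall z, Cmod z < 1 -> clim (fun n => blaschke_partial lam n z) (B z).
Hypothesis H_ge_1 : forall z, Cmod z < 1 -> 1 <= H z.
Hypothesis H_harnack : forall l z, Cmod l < 1 -> Cmod z < 1 -> rho z l < 1 / 2 -> H z <= 3 * H l.
Hypothesis H_sum : summable (fun k => (1 - Cmod (lam k)) * exp (H (lam k))).

Let E (k : nat) : R := exp (H (lam k)).
Let P (k : nat) (z : C) : R := E k * pweight (lam k) z.

Lemma E_ge_1 (k : nat) : 1 <= E k.
Proof. unfold E. pose proof (exp_ineq1_le (H (lam k))). pose proof (H_ge_1 _ (Hlam k)). lra. Qed.

Lemma P_ge_pweight (k : nat) (z : C) : Cmod z < 1 -> 0 <= pweight (lam k) z <= P k z.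
Proof.
  intros Hz. pose proof (pweight_ge_0 (lam k) z (Hlam k) Hz). pose proof (E_ge_1 k). unfold P. nra.
Qed.

Lemma E_le_P (k : nat) (z : C) : Cmod z < 1 -> rho z (lam k) < 1 / 2 -> 3 * E k <= 4 * P k z.
Proof.
  intros Hz Hr. pose proof (rho_le_pweight (lam k) z (Hlam k) Hz). pose proof (rho_ge_0 (lam k) z).
  pose proof (E_ge_1 k). unfold P. assert (3 / 4 <= pweight (lam k) z) by nra. nra.
Qed.

Lemma majorant (kappa : R) : 0 <= kappa -> exists u, Har_pos u /\
  forall z, Cmod z < 1 -> forall n, kappa * psum (fun k => P k z) n <= u z.
Proof.
  intros Hk. apply weight_majorant; trivial. intros k. pose proof (E_ge_1 k). lra.
Qed.

Lemma blaschke_majorant :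
  has_harmonic_majorant (fun z : C => - ln (Cmod (B z)))
    (fun z : C => unit_disc z /\ Rbar_le (exp (- H z)) (rho_set z (zero_set lam))).
Proof.
  destruct (majorant 4 ltac:(lra)) as [u [Hu Hb]]. exists u. split; [exact Hu|].
  intros z [Hz Hset]. unfold unit_disc in Hz.
  assert (Hrho : forall k, exp (- H z) <= rho z (lam k)).
  { intros k. destruct (Glb_Rbar_correct (fun r => exists l, zero_set lam l /\ r = rho z l)) as [Hglb _].
    specialize (Hglb (rho z (lam k))). 
    apply (Rbar_le_trans (exp (- H z)) _ (rho z (lam k)) Hset). apply Hglb.
    exists (lam k). split; [now exists k | reflexivity]. }
  (* Near lam_k the chain is [H z <= 3 * H (lam k) <= 3 * E k <= 4 * P k z]; away from it, 1/rho <=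
     1 + 2 p_k <= exp(4 P). *)
  assert (Hk : forall k, exp (- (4 * P k z)) <= rho z (lam k)).
  { intros k. pose proof (P_ge_pweight k z Hz).
    destruct (Rlt_dec (rho z (lam k)) (1 / 2)) as [h|h].
    - eapply Rle_trans; [|apply Hrho]. apply exp_le.
      pose proof (H_harnack (lam k) z (Hlam k) Hz h). pose proof (E_le_P k z Hz h).
      assert (H (lam k) <= E k) by (unfold E; pose proof (exp_ineq1_le (H (lam k))); lra). lra.
    - apply Rnot_lt_le in h. pose proof (inv_rho_le (lam k) z (Hlam k) Hz h).
      pose proof (exp_ineq1_le (4 * P k z)).
      rewrite exp_Ropp, <- (Rinv_inv (rho z (lam k))).
      apply Rinv_le_contravar; [apply Rinv_0_lt_compat; lra | lra]. }
  (* A lower bound uniform in n survives the limit; it also shows that B(z) is nonzero, so the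
     logarithm in the conclusion is genuine. *)
  assert (Hn : forall n, exp (- u z) <= Cmod (blaschke_partial lam n z)).
  { intros n. apply Rle_trans with (exp (- (4 * psum (fun k => P k z) n))).
    - apply exp_le. specialize (Hb z Hz n). lra.
    - induction n as [|n IH].
      + simpl. rewrite Rmult_0_r, Ropp_0, exp_0, Cmod_1. lra.
      + rewrite psum_S. simpl blaschke_partial. rewrite Cmod_mult, Cmod_blaschke_factor by trivial.
        replace (- (4 * (psum (fun k => P k z) n + P n z)))
          with (- (4 * psum (fun k => P k z) n) + - (4 * P n z)) by ring.
        rewrite exp_plus. apply Rmult_le_compat; trivial; left; apply exp_pos. }
  pose proof (clim_ge _ _ _ (HB z Hz) Hn) as HBz.
  apply Ropp_le_cancel. rewrite Ropp_involutive. rewrite <- (ln_exp (- u z)).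
  apply ln_le; [apply exp_pos | exact HBz].
Qed.

(** * The Bezout equation for a given [f] *)

Section Bezout.

Variable f : C -> C.
Hypothesis Hf : analytic f.
Hypothesis Hf1 : forall z, Cmod z < 1 -> Cmod (f z) <= 1.
Hypothesis Hfl : forall k, exp (- H (lam k)) <= Cmod (f (lam k)).

Let e (k : nat) (z : C) : C := (RtoC (1 - Cmod (lam k) ^ 2) / (1 - Cconj (lam k) * z))%C.
Let a (k : nat) (z : C) : C := (e k z * e k z / f (lam k))%C.

Lemma f_lam_neq_0 (k : nat) : f (lam k) <> 0.
Proof. apply Cmod_gt_0. eapply Rlt_le_trans; [apply exp_pos | apply Hfl]. Qed.

Lemma inv_f_lam (k : nat) : / Cmod (f (lam k)) <= E k.
Proof.
  unfold E. rewrite <- (Ropp_involutive (H (lam k))), exp_Ropp.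
  apply Rinv_le_contravar; [apply exp_pos | apply Hfl].
Qed.

Lemma a_bound (k : nat) (z : C) : Cmod z < 1 -> Cmod (a k z) <= P k z.
Proof.
  intros Hz. unfold a, P. rewrite Cmod_div by apply f_lam_neq_0. rewrite Cmod_mult.
  pose proof (kernel_le_pweight (lam k) z (Hlam k) Hz) as K. fold (e k z) in K.
  pose proof (Cmod_ge_0 (e k z)).
  rewrite (Rmult_comm (E k)). apply Rmult_le_compat.
  - nra.
  - left. apply Rinv_0_lt_compat, Cmod_gt_0, f_lam_neq_0.
  - lra.
  - apply inv_f_lam.
Qed.

Lemma a_analytic (k : nat) : analytic (a k).
Proof.
  apply analytic_cdiffable. intros z Hz.
  assert (De : cdiffable (e k) z).
  { apply cdiffable_div; [now apply one_minus_conj_neq_0 | apply cdiffable_const |].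
    apply cdiffable_minus; [apply cdiffable_const|].
    apply cdiffable_mult; [apply cdiffable_const | apply cdiffable_id]. }
  apply cdiffable_div; [apply f_lam_neq_0 | | apply cdiffable_const].
  now apply cdiffable_mult.
Qed.

Lemma e_self (k : nat) : e k (lam k) = 1.
Proof.
  unfold e. pose proof (one_minus_conj_neq_0 _ _ (Hlam k) (Hlam k)) as n.
  replace (RtoC (1 - Cmod (lam k) ^ 2)) with (1 - Cconj (lam k) * lam k)%C; [now field|].
  rewrite RtoC_minus, Cmod2_conj. ring.
Qed.

(** With l = lam_k, split f(l) - f e^2 = f (1 - e)(1 + e) - (f - f(l)). Here 1 - e is conj l times
    the Möbius map, so |1 - e| <= rho, while |1 + e| <= 3 and Schwarz bounds the last difference by
    4 rho: this is the 7. *)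
Lemma factor_bound (k : nat) (z : C) :
  Cmod z < 1 -> Cmod (1 - f z * a k z) <= 7 * E k * rho z (lam k).
Proof.
  intros Hz. pose proof (f_lam_neq_0 k) as nf.
  pose proof (one_minus_conj_neq_0 _ _ (Hlam k) Hz) as nd.
  replace (1 - f z * a k z)%C with ((f z * ((1 - e k z) * (1 + e k z)) - (f z - f (lam k))) / f (lam k))%C
    by (unfold a; field; exact nf).
  rewrite Cmod_div by exact nf.
  assert (K1 : Cmod (1 - e k z) <= rho z (lam k)).
  { replace (1 - e k z)%C with (Cconj (lam k) * moebius (lam k) z)%C.
    - rewrite Cmod_mult, Cmod_conj, Cmod_moebius by trivial.
      pose proof (Hlam k). pose proof (Cmod_ge_0 (lam k)). pose proof (rho_ge_0 (lam k) z). nra.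
    - unfold e, moebius. rewrite RtoC_minus, Cmod2_conj. field. exact nd. }
  assert (K2 : Cmod (1 + e k z) <= 3).
  { eapply Rle_trans; [apply Cmod_triangle|]. rewrite Cmod_1.
    assert (Cmod (e k z) <= 2); [|lra].
    unfold e. pose proof (Hlam k). pose proof (Cmod_ge_0 (lam k)).
    rewrite Cmod_div, Cmod_R, Rabs_pos_eq by (trivial; nra).
    apply Rle_div_l; [now apply Cmod_gt_0|].
    pose proof (Cmod_triangle_rev 1 (Cconj (lam k) * z)) as T. rewrite Cmod_1, Cmod_conj_mult in T.
    pose proof (Cmod_ge_0 z). nra. }
  pose proof (schwarz_bound f (lam k) z Hf Hf1 (Hlam k) Hz) as K3.
  pose proof (rho_ge_0 (lam k) z) as Hr0.
  replace (7 * E k * rho z (lam k)) with (7 * rho z (lam k) * E k) by ring.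
  apply Rmult_le_compat; [apply Cmod_ge_0 | | | apply inv_f_lam].
  - left. now apply Rinv_0_lt_compat, Cmod_gt_0.
  - eapply Rle_trans; [apply Cmod_triangle_minus|].
    rewrite !Cmod_mult.
    assert (Cmod (1 - e k z) * Cmod (1 + e k z) <= rho z (lam k) * 3)
      by (apply Rmult_le_compat; trivial; apply Cmod_ge_0).
    assert (0 <= Cmod (1 - e k z) * Cmod (1 + e k z)) by (apply Rmult_le_pos; apply Cmod_ge_0).
    pose proof (Hf1 z Hz). pose proof (Cmod_ge_0 (f z)). nra.
Qed.

Lemma factor_analytic (k : nat) : analytic (fun z => (1 - f z * a k z)%C).
Proof.
  apply analytic_cdiffable. intros z Hz. apply cdiffable_minus; [apply cdiffable_const|].
  apply cdiffable_mult; [now apply (proj1 (analytic_cdiffable f)) | now apply (proj1 (analytic_cdiffable _) (a_analytic k))].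
Qed.

Lemma quotient_exists (k : nat) : exists s, analytic s /\
  forall z, Cmod z < 1 -> (1 - f z * a k z)%C = (blaschke_factor (lam k) z * s z)%C.
Proof.
  apply blaschke_divide; [apply factor_analytic | apply Hlam |].
  unfold a. rewrite e_self. field. apply f_lam_neq_0.
Qed.

(** Away from lam_k, divide [factor_bound] by rho; at lam_k itself, where rho = 0, the bound follows
    by continuity of [s] along the points lam_k + h. *)
Lemma quotient_bound (k : nat) (s : C -> C) : analytic s ->
  (forall z, Cmod z < 1 -> (1 - f z * a k z)%C = (blaschke_factor (lam k) z * s z)%C) ->
  forall z, Cmod z < 1 -> Cmod (s z) <= 7 * E k.
Proof.
  intros Hs Es.
  assert (Hne : forall z, Cmod z < 1 -> z <> lam k -> Cmod (s z) <= 7 * E k).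
  { intros z Hz n. pose proof (factor_bound k z Hz) as F. rewrite (Es z Hz) in F.
    rewrite Cmod_mult, Cmod_blaschke_factor in F by trivial.
    assert (0 < rho z (lam k)).
    { rewrite rho_eq by trivial. apply Rdiv_lt_0_compat; [now apply Cmod_sub_gt_0|].
      now apply Cmod_gt_0, one_minus_conj_neq_0. }
    apply Rmult_le_reg_r with (rho z (lam k)); lra. }
  intros z Hz. destruct (Ceq_dec z (lam k)) as [->|n]; [|now apply Hne].
  apply le_epsilon. intros eps He.
  destruct (proj2 (ccont_eps_C _ _) (analytic_cont s _ Hs (Hlam k)) eps He) as [d [Hd Hw]].
  set (h := Rmin d (1 - Cmod (lam k)) / 2).
  assert (0 < Rmin d (1 - Cmod (lam k))) by (apply Rmin_pos; [exact Hd | specialize (Hlam k); lra]).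
  pose proof (Rmin_l d (1 - Cmod (lam k))). pose proof (Rmin_r d (1 - Cmod (lam k))).
  set (w := (lam k + RtoC h)%C).
  assert (Ew : (w - lam k)%C = RtoC h) by (unfold w; ring).
  assert (Hh : Cmod (RtoC h) = h) by (rewrite Cmod_R; apply Rabs_pos_eq; unfold h; lra).
  specialize (Hw w). rewrite Ew, Hh in Hw. specialize (Hw ltac:(unfold h; lra)).
  assert (Hw1 : Cmod w < 1).
  { unfold w. eapply Rle_lt_trans; [apply Cmod_triangle|]. rewrite Hh. unfold h. lra. }
  assert (Hwn : w <> lam k).
  { intros e0. apply (f_equal Cmod) in Ew. rewrite e0, Cmod_minus_diag, Hh in Ew. unfold h in Ew. lra. }
  specialize (Hne w Hw1 Hwn). rewrite Cmod_minus_sym in Hw.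
  pose proof (Cmod_triangle_rev (s (lam k)) (s w)). lra.
Qed.

(** Near lam_k, 7 E <= (28/3) P <= exp(10 P). Away from it, |s| <= (1 + P)(1 + 2P), and each factor
    is at most exp(5 P). *)
Lemma quotient_exp_bound (k : nat) (s : C -> C) : analytic s ->
  (forall z, Cmod z < 1 -> (1 - f z * a k z)%C = (blaschke_factor (lam k) z * s z)%C) ->
  forall z, Cmod z < 1 -> Cmod (s z) <= exp (10 * P k z).
Proof.
  intros Hs Es z Hz. pose proof (P_ge_pweight k z Hz) as HP.
  destruct (Rlt_dec (rho z (lam k)) (1 / 2)) as [h|h].
  - pose proof (quotient_bound k s Hs Es z Hz). pose proof (E_le_P k z Hz h).
    pose proof (exp_ineq1_le (10 * P k z)). lra.
  - apply Rnot_lt_le in h. pose proof (inv_rho_le (lam k) z (Hlam k) Hz h) as K.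
    assert (Er : Cmod (1 - f z * a k z) = rho z (lam k) * Cmod (s z)).
    { rewrite (Es z Hz), Cmod_mult, Cmod_blaschke_factor; trivial. }
    assert (K2 : Cmod (1 - f z * a k z) <= 1 + P k z).
    { eapply Rle_trans; [apply Cmod_triangle_minus|]. rewrite Cmod_1, Cmod_mult.
      pose proof (a_bound k z Hz). pose proof (Hf1 z Hz). pose proof (Cmod_ge_0 (f z)). pose proof (Cmod_ge_0 (a k z)). nra. }
    replace (Cmod (s z)) with (Cmod (1 - f z * a k z) * / rho z (lam k)) by (rewrite Er; field; lra).
    apply Rle_trans with ((1 + P k z) * (1 + 2 * P k z)).
    + apply Rmult_le_compat; trivial; [apply Cmod_ge_0 | left; apply Rinv_0_lt_compat; lra | lra].
    + pose proof (exp_ineq1_le (5 * P k z)). 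
      replace (10 * P k z) with (5 * P k z + 5 * P k z) by ring. rewrite exp_plus.
      apply Rmult_le_compat; lra.
Qed.

Lemma P_le (k : nat) (z : C) (r : R) : Cmod z <= r -> r < 1 ->
  P k z <= 2 / (1 - r) ^ 2 * ((1 - Cmod (lam k)) * E k).
Proof.
  intros Hz Hr. pose proof (pweight_le (lam k) z r (Hlam k) Hz Hr). pose proof (E_ge_1 k).
  unfold P. nra.
Qed.

(** The summable rate behind the convergence of the product of the quotients. If lam_k is not close
    to the unit circle, its gap is at least (1 - r)/2 and the crude bound 8 E suffices. Otherwise
    lam_k is nonzero and stays away from [z], and b_k (s - 1) = (1 - b_k) - f a_k is small. *)
Lemma quotient_minus_1 (k : nat) (s : C -> C) : analytic s ->
  (forall z, Cmod z < 1 -> (1 - f z * a k z)%C = (blaschke_factor (lam k) z * s z)%C) ->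
  forall z r, Cmod z <= r -> r < 1 ->
    Cmod (s z - 1) <= 16 / (1 - r) ^ 3 * ((1 - Cmod (lam k)) * E k).
Proof.
  intros Hs Es z r Hz Hr. pose proof (Cmod_ge_0 z) as Hz0. pose proof (E_ge_1 k) as HE.
  pose proof (Hlam k) as Hl. pose proof (Cmod_ge_0 (lam k)) as Hl0.
  assert (Hz1 : Cmod z < 1) by lra.
  set (d := 1 - r). assert (Hd : 0 < d <= 1) by (unfold d; lra).
  assert (Hd3 : 0 < d ^ 3) by (apply pow_lt; lra).
  set (eps := 1 - Cmod (lam k)). assert (He : 0 < eps) by (unfold eps; lra).
  destruct (Rle_dec (Cmod (lam k)) ((1 + r) / 2)) as [h|h].
  - pose proof (quotient_bound k s Hs Es z Hz1) as Q.
    pose proof (Cmod_triangle_minus (s z) 1) as T. rewrite Cmod_1 in T.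
    assert (d <= 2 * eps) by (unfold d, eps; lra).
    assert (8 * E k <= 16 / d ^ 3 * (eps * E k)); [|lra].
    replace (16 / d ^ 3 * (eps * E k)) with (8 * E k * (2 * eps / d ^ 3)) by (field; lra).
    assert (1 <= 2 * eps / d ^ 3); [|nra].
    apply Rle_div_r; [exact Hd3|].
    assert (d ^ 3 <= d); [|lra]. simpl. assert (d * (d * 1) <= 1) by nra. nra.
  - apply Rnot_le_lt in h.
    assert (nl : lam k <> 0) by (intros e0; rewrite e0, Cmod_0 in h; lra).
    (* |lam_k - z| is at least (1 + r)/2 - r = d/2, and the denominator of rho is at most 2. *)
    assert (Hrho : d / 4 <= rho z (lam k)).
    { rewrite rho_eq by assumption.
      apply (Rle_div_r (d / 4)); [now apply Cmod_gt_0, one_minus_conj_neq_0|].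
      pose proof (Cmod_triangle_minus 1 (Cconj (lam k) * z)) as T. rewrite Cmod_1, Cmod_conj_mult in T.
      pose proof (Cmod_triangle_rev (lam k) z) as T2. rewrite Cmod_minus_sym in T2.
      assert (Cmod (lam k) * Cmod z <= 1) by nra.
      unfold d in *. nra. }
    assert (K : rho z (lam k) * Cmod (s z - 1) <= 2 * eps / d + P k z).
    { rewrite <- (Cmod_blaschke_factor (lam k) z), <- Cmod_mult by trivial.
      replace (blaschke_factor (lam k) z * (s z - 1))%C
        with ((1 - blaschke_factor (lam k) z) - f z * a k z)%C.
      - eapply Rle_trans; [apply Cmod_triangle_minus|]. apply Rplus_le_compat.
        + now apply one_minus_blaschke_factor.
        + rewrite Cmod_mult. pose proof (a_bound k z Hz1). pose proof (Hf1 z Hz1).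
          pose proof (Cmod_ge_0 (f z)). pose proof (Cmod_ge_0 (a k z)). nra.
      - transitivity ((1 - f z * a k z) - blaschke_factor (lam k) z)%C; [ring|].
        rewrite (Es z Hz1). ring. }
    pose proof (P_le k z r Hz Hr) as HP. fold d eps in HP.
    pose proof (Cmod_ge_0 (s z - 1)) as Hs0.
    apply Rmult_le_reg_l with (d / 4); [lra|].
    apply Rle_trans with (rho z (lam k) * Cmod (s z - 1)); [now apply Rmult_le_compat_r|].
    eapply Rle_trans; [exact K|].
    replace (d / 4 * (16 / d ^ 3 * (eps * E k))) with (2 / d ^ 2 * (eps * E k) + 2 / d ^ 2 * (eps * E k)) by (field; lra).
    apply Rplus_le_compat; [|exact HP].
    replace (2 * eps / d) with (2 / d ^ 2 * (eps * d)) by (field; lra).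
    apply Rmult_le_compat_l; [apply Rdiv_le_0_compat; [lra | apply pow_lt; lra]|].
    apply Rmult_le_compat_l; lra.
Qed.

Lemma nevanlinna_of_exp_bound (G : C -> C) (u : C -> R) :
  analytic G -> Har_pos u -> (forall z, Cmod z < 1 -> Cmod (G z) <= exp (u z)) -> Nevanlinna G.
Proof.
  intros HG Hu Hb. split; [exact HG|]. exists u. split; [exact Hu|].
  intros z [Hz n]. rewrite <- (ln_exp (u z)). apply ln_le; [now apply Cmod_gt_0 | now apply Hb].
Qed.

Theorem bezout : exists g h : C -> C, Nevanlinna g /\ Nevanlinna h /\
  forall z, Cmod z < 1 -> (f z * g z = 1 + B z * h z)%C.
Proof.
  set (s := fun k => proj1_sig (constructive_indefinite_description _ (quotient_exists k))).
  assert (Hs : forall k, analytic (s k) /\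
     forall z, Cmod z < 1 -> (1 - f z * a k z)%C = (blaschke_factor (lam k) z * s k z)%C).
  { intros k. exact (proj2_sig (constructive_indefinite_description _ (quotient_exists k))). }
  clearbody s.
  (* The partial objects satisfy f G_n = 1 - Phi_n and Phi_n = B_n T_n exactly, B_n being the
     partial Blaschke product; only [G] and [T] need limits. *)
  set (Phi := fix Phi (n : nat) (z : C) : C := match n with
     | O => RtoC 1 | S m => (Phi m z * (1 - f z * a m z))%C end).
  set (G := fix G (n : nat) (z : C) : C := match n with
     | O => RtoC 0 | S m => (G m z + a m z * Phi m z)%C end).
  set (T := fix T (n : nat) (z : C) : C := match n with
     | O => RtoC 1 | S m => (T m z * s m z)%C end).
  assert (EG : forall n z, (f z * G n z)%C = (1 - Phi n z)%C).
  { intros n z. induction n as [|n IH]; simpl; [ring|].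
    transitivity (f z * G n z + f z * a n z * Phi n z)%C; [ring|]. rewrite IH. ring. }
  assert (ET : forall n z, Cmod z < 1 -> Phi n z = (blaschke_partial lam n z * T n z)%C).
  { intros n z Hz. induction n as [|n IH]; simpl; [ring|].
    rewrite IH, (proj2 (Hs n) z Hz). ring. }
  assert (BP : forall n z, Cmod z < 1 -> Cmod (Phi n z) <= exp (psum (fun k => P k z) n)).
  { intros n z Hz. induction n as [|n IH]; [simpl; rewrite Cmod_1, exp_0; lra|].
    rewrite psum_S, exp_plus. simpl Phi. rewrite Cmod_mult.
    apply Rmult_le_compat; [apply Cmod_ge_0 | apply Cmod_ge_0 | exact IH |].
    eapply Rle_trans; [apply Cmod_triangle_minus|]. rewrite Cmod_1, Cmod_mult.
    pose proof (a_bound n z Hz). pose proof (Hf1 z Hz). pose proof (Cmod_ge_0 (f z)).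
    pose proof (Cmod_ge_0 (a n z)). pose proof (exp_ineq1_le (P n z)). nra. }
  (* The extra 1 makes the induction exact: the increment is at most P_n times exp of the sum so
     far, and 1 + P_n <= exp(P_n). *)
  assert (BG : forall n z, Cmod z < 1 -> Cmod (G n z) + 1 <= exp (psum (fun k => P k z) n)).
  { intros n z Hz. induction n as [|n IH]; [simpl; rewrite Cmod_0, exp_0; lra|].
    rewrite psum_S, exp_plus. simpl G. pose proof (Cmod_triangle (G n z) (a n z * Phi n z)) as Tr.
    rewrite Cmod_mult in Tr.
    pose proof (a_bound n z Hz). pose proof (BP n z Hz). pose proof (Cmod_ge_0 (a n z)).
    pose proof (Cmod_ge_0 (Phi n z)). pose proof (exp_ineq1_le (P n z)).
    assert (Cmod (a n z) * Cmod (Phi n z) <= P n z * exp (psum (fun k => P k z) n))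
      by (apply Rmult_le_compat; assumption).
    pose proof (exp_pos (psum (fun k => P k z) n)). nra. }
  assert (BT : forall n z, Cmod z < 1 -> Cmod (T n z) <= exp (10 * psum (fun k => P k z) n)).
  { intros n z Hz. induction n as [|n IH]; [simpl; rewrite Cmod_1, Rmult_0_r, exp_0; lra|].
    rewrite psum_S, Rmult_plus_distr_l, exp_plus. simpl T. rewrite Cmod_mult.
    apply Rmult_le_compat; [apply Cmod_ge_0 | apply Cmod_ge_0 | exact IH |].
    destruct (Hs n) as [s1 s2]. now apply quotient_exp_bound. }
  assert (AP : forall n, analytic (Phi n)).
  { intros n. apply analytic_cdiffable. intros z Hz. induction n as [|n IH]; [apply cdiffable_const|].
    simpl. apply cdiffable_mult; [exact IH|]. now apply (proj1 (analytic_cdiffable _) (factor_analytic n)). }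
  assert (AG : forall n, analytic (G n)).
  { intros n. apply analytic_cdiffable. intros z Hz. induction n as [|n IH]; [apply cdiffable_const|].
    simpl. apply cdiffable_plus; [exact IH|].
    apply cdiffable_mult; [now apply (proj1 (analytic_cdiffable _) (a_analytic n)) | now apply (proj1 (analytic_cdiffable _) (AP n))]. }
  assert (AT : forall n, analytic (T n)).
  { intros n. apply analytic_cdiffable. intros z Hz. induction n as [|n IH]; [apply cdiffable_const|].
    simpl. apply cdiffable_mult; [exact IH|]. now apply (proj1 (analytic_cdiffable _) (proj1 (Hs n))). }
  assert (HW0 : forall k, 0 <= (1 - Cmod (lam k)) * E k).
  { intros k. apply Rmult_le_pos; [specialize (Hlam k); lra | pose proof (E_ge_1 k); lra]. }
  destruct H_sum as [W HW]. fold E in HW.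
  assert (HQ : forall r n z, Cmod z <= r -> r < 1 -> psum (fun k => P k z) n <= 2 / (1 - r) ^ 2 * W).
  { intros r n z Hz Hr. eapply Rle_trans; [apply psum_le; intros k; apply (P_le k z r Hz Hr)|].
    rewrite psum_scal. apply Rmult_le_compat_l; [|apply HW].
    apply Rdiv_le_0_compat; [lra | apply pow_lt; lra]. }
  destruct (analytic_limit G AG) as [g [Ag Lg]].
  { intros r Hr. set (Q := 2 / (1 - r) ^ 2 * W).
    assert (Hc : 0 <= 2 / (1 - r) ^ 2) by (apply Rdiv_le_0_compat; [lra | apply pow_lt; lra]).
    pose proof (exp_pos Q) as HQ0.
    exists (fun k => exp Q * (2 / (1 - r) ^ 2) * ((1 - Cmod (lam k)) * E k)).
    split; [|split].
    - apply summable_scal; [nra|]. now exists W.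
    - intros k. apply Rmult_le_pos; [nra | apply HW0].
    - intros n z Hz. simpl.
      replace (G n z + a n z * Phi n z - G n z)%C with (Phi n z * a n z)%C by ring.
      rewrite Cmod_mult, Rmult_assoc. apply Rmult_le_compat; try apply Cmod_ge_0.
      + eapply Rle_trans; [apply BP; lra|]. now apply exp_le, HQ.
      + eapply Rle_trans; [apply a_bound; lra | now apply P_le]. }
  destruct (analytic_limit T AT) as [t [At Lt]].
  { intros r Hr. set (Q := 2 / (1 - r) ^ 2 * W).
    assert (Hc : 0 <= 16 / (1 - r) ^ 3) by (apply Rdiv_le_0_compat; [lra | apply pow_lt; lra]).
    pose proof (exp_pos (10 * Q)) as HQ0.
    exists (fun k => exp (10 * Q) * (16 / (1 - r) ^ 3) * ((1 - Cmod (lam k)) * E k)).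
    split; [|split].
    - apply summable_scal; [nra|]. now exists W.
    - intros k. apply Rmult_le_pos; [nra | apply HW0].
    - intros n z Hz. simpl.
      replace (T n z * s n z - T n z)%C with (T n z * (s n z - 1))%C by ring.
      rewrite Cmod_mult, Rmult_assoc. apply Rmult_le_compat; try apply Cmod_ge_0.
      + eapply Rle_trans; [apply BT; lra|]. apply exp_le.
        pose proof (HQ r n z Hz Hr). unfold Q. lra.
      + destruct (Hs n) as [s1 s2]. now apply quotient_minus_1. }
  exists g, (fun z => (- (1) * t z)%C). split; [|split].
  - destruct (majorant 1 ltac:(lra)) as [u [Hu Hb]].
    apply nevanlinna_of_exp_bound with u; trivial. intros z Hz.
    apply (clim_le _ _ _ (Lg z Hz)). intros n. pose proof (BG n z Hz).
    specialize (Hb z Hz n). rewrite Rmult_1_l in Hb. apply exp_le in Hb. lra.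
  - destruct (majorant 10 ltac:(lra)) as [u [Hu Hb]].
    apply nevanlinna_of_exp_bound with u; trivial.
    + apply analytic_cdiffable. intros z Hz.
      apply cdiffable_mult; [apply cdiffable_const | now apply (proj1 (analytic_cdiffable t))].
    + intros z Hz. rewrite Cmod_mult, Cmod_m1, Rmult_1_l.
      apply (clim_le _ _ _ (Lt z Hz)). intros n.
      eapply Rle_trans; [now apply BT|]. apply exp_le, Hb, Hz.
  - intros z Hz. transitivity (1 - B z * t z)%C; [|ring].
    (* The limit of f G_n is computed twice: through [G], and through 1 - B_n T_n. *)
    apply (clim_unique (fun n => (f z * G n z)%C)).
    + apply clim_mult; [apply clim_const | now apply Lg].
    + apply (clim_ext (fun n => (1 - blaschke_partial lam n z * T n z)%C)).
      { intros n. now rewrite EG, ET. }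
      apply clim_minus; [apply clim_const|]. apply clim_mult; [now apply HB | now apply Lt].
Qed.

End Bezout.

End Main.

Theorem theorem2 (lam : nat -> C) (B : C -> C)
  (hB : infinite_blaschke_product lam B) :
  (exists H : C -> R,
     Har_pos H /\
     is_LimSup_seq (fun k : nat => H (lam k)) p_infty /\
     has_harmonic_majorant (fun z : C => - ln (Cmod (B z)))
       (fun z : C => unit_disc z /\
          Rbar_le (exp (- H z)) (rho_set z (zero_set lam)))) /\
  (exists H : C -> R,
     Har_pos H /\
     is_LimSup_seq (fun k : nat => H (lam k)) p_infty /\
     forall f : C -> C,
       Hinfty f ->
       Rbar_le (sup_norm f) 1 ->
       (forall k : nat, exp (- H (lam k)) <= Cmod (f (lam k))) ->
       exists g h : C -> C,
         Nevanlinna g /\ Nevanlinna h /\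
         forall z : C, unit_disc z -> (f z * g z = RtoC 1 + B z * h z)%C).
Proof.
  destruct hB as [Hlam [Hser HB]].
  assert (HBc : forall z, Cmod z < 1 -> clim (fun n => blaschke_partial lam n z) (B z))
    by (intros; now apply filterlim_clim, HB).
  destruct (slow_weight lam Hlam) as [H [Hpos [Hlim [Hge [Hhar Hsum]]]]].
  { apply ex_series_summable; [|exact Hser]. intros n. specialize (Hlam n). unfold unit_disc in Hlam. lra. }
  split; exists H; (split; [exact Hpos|]); (split; [exact Hlim|]).
  - now apply blaschke_majorant.
  - intros f [Hf _] Hf1 Hfl. apply (bezout lam B H); trivial.
    intros z Hz. destruct (Lub_Rbar_correct (fun r => exists z, unit_disc z /\ r = Cmod (f z))) as [Hub _].
    apply (Rbar_le_trans (Cmod (f z)) (sup_norm f) 1); [|exact Hf1].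
    apply Hub. now exists z.
Qed.
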